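(* Let $M$ and $N$ be connected $C^1$ Finsler manifolds of the same dimension, where $M$ is complete, and let $f:M\to N$ be a locally Lipschitz mapping such that $\partial f(x)$ has maximal rank for all $x\in M$. Assume that there exists $x_0\in M$ such that $$\int_0^\infty m(t)\,dt=\infty,\qquad\text{where}\qquad m(t)=\inf_{x\in\overline{B}_M(x_0,t)} c_x(\partial f(x)),$$ where $c_x(\partial f(x))$ denotes the co-norm of the Clarke generalized differential of $f$ at $x$ and $\overline{B}_M(x_0,t)=\{y\in M: d_M(x_0,y)\le t\}$. Assume moreover that either $N$ is simply connected, or the fundamental groups $\pi_1(M)$ and $\pi_1(N)$ are isomorphic and finite. Then $f$ is a global homeomorphism from $M$ onto $N$.
   Context: All manifolds are finite-dimensional. A $C^1$ Finsler manifold is a $C^1$-smooth manifold $M$ with a continuous map $\|\cdot\|_M:TM\to[0,\infty)$ whose restriction $\|\cdot\|_x$ to each tangent space $T_xM$ is a norm. If $M$ is connected, the Finsler distance is $d_M(x,y)=\inf\int_a^b\|\gamma'(t)\|_{\gamma(t)}\,dt$, the infimum over all piecewise $C^1$ paths $\gamma:[a,b]\to M$ joining $x$ to $y$ (it induces the manifold topology). $M$ is complete if $(M,d_M)$ is a complete metric space. A map $f:M\to N$ ($\dim M=m$, $\dim N=n$) is Lipschitz on a neighborhood of $x$ if there are charts $(U,\varphi)$ of $M$ at $x$ and $(V,\psi)$ of $N$ at $f(x)$, $f(U)\subset V$, such that $\psi\circ f\circ\varphi^{-1}$ is Lipschitz on a neighborhood of $\varphi(x)$; $f$ is locally Lipschitz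 if this holds at every $x\in M$. Clarke generalized differential: for $F$ from an open subset of $\mathbb{R}^m$ to $\mathbb{R}^n$, Lipschitz near $p$, $\partial F(p)$ is the convex hull of all limits $\lim_i dF(p_i)$ with $p_i\to p$ and $F$ differentiable at each $p_i$. For $f:M\to N$ Lipschitz on a neighborhood of $x$, $$\partial f(x)=\{d\psi^{-1}(\psi(f(x)))\circ A\circ d\varphi(x): A\in\partial(\psi\circ f\circ\varphi^{-1})(\varphi(x))\}\subset\mathcal{L}(T_xM,T_{f(x)}N),$$ for charts $\varphi$ at $x$ and $\psi$ at $f(x)$; this does not depend on the charts. When $\dim M=\dim N$, $\partial f(x)$ has maximal rank if every $B\in\partial f(x)$ is an invertible linear map $T_xM\to T_{f(x)}N$. The co-norm of $\partial f(x)$ is $c_x(\partial f(x))=\inf_{B\in\partial f(x)}\ \inf\{\|Bv\|_{f(x)}: v\in T_xM,\ \|v\|_x=1\}$. *)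

(* Defs.v *)
From HB Require Import structures.
From mathcomp Require Import all_boot all_order all_algebra.
From mathcomp Require Import all_classical all_reals all_analysis.

Set Implicit Arguments.
Unset Strict Implicit.
Unset Printing Implicit Defensive.

Import Order.TTheory GRing.Theory Num.Theory.
Import numFieldNormedType.Exports.

Local Open Scope classical_set_scope.
Local Open Scope ring_scope.

(* The two maps of a chart are total functions: [cmap] is meaningful on [dom]
   only, and [cinv] on [cmap @` dom] only. *)
Record chart (R : realType) (n : nat) (T : topologicalType) := Chart {
  dom : set T;
  cmap :> T -> 'rV[R]_n;
  cinv : 'rV[R]_n -> T;
  dom_open : open dom;
  img_open : open (cmap @` dom);
  cinvK : forall x, dom x -> cinv (cmap x) = x;
  cmap_continuous : {within dom, continuous cmap};
  cinv_continuous : {within cmap @` dom, continuous cinv} }.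

Definition c1_on (R : realType) (m n : nat) (A : set 'rV[R]_m)
    (F : 'rV[R]_m -> 'rV[R]_n) :=
  forall p, A p -> differentiable F p /\ {for p, continuous (jacobian F)}.

Definition c1_compatible (R : realType) (n : nat) (T : topologicalType)
    (c c' : chart R n T) :=
  c1_on (c @` (dom c `&` dom c')) (c' \o cinv c) /\
  c1_on (c' @` (dom c `&` dom c')) (c \o cinv c').

(* The C^1 structure is a maximal atlas, so that [atlas] consists of all the
   C^1 charts of the manifold. *)
Record c1_manifold (R : realType) (n : nat) := C1Manifold {
  carrier :> topologicalType;
  carrier_hausdorff : hausdorff_space carrier;
  atlas : set (chart R n carrier);
  atlas_cover : forall x, exists2 c, atlas c & dom c x;
  atlas_compatible : forall c c', atlas c -> atlas c' -> c1_compatible c c';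
  atlas_maximal : forall c,
    (forall c', atlas c' -> c1_compatible c c') -> atlas c }.

Definition chart_around (R : realType) (n : nat) (M : c1_manifold R n) (x : M) :
  set (chart R n M) := [set c | atlas c /\ dom c x].

Definition chart_at (R : realType) (n : nat) (M : c1_manifold R n) (x : M) :
  chart R n M := s2val (cid2 (atlas_cover x)).

(* A tangent vector at x is the family of its components in all the charts
   around x, with the usual transformation law. The family is set to 0 at the
   other charts, so that equality of families is equality of vectors. *)
Definition tangent_family (R : realType) (n : nat) (M : c1_manifold R n)
    (x : M) : {pred chart R n M -> 'rV[R]_n} :=
  fun v => `[< (forall c c', chart_around x c -> chart_around x c' ->
                  v c' = 'd (c' \o cinv c) (c x) (v c)) /\
               (forall c, ~ chart_around x c -> v c = 0) >].

Section TangentSpace.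
Context (R : realType) (n : nat) (M : c1_manifold R n) (x : M).

Lemma tangent_family_submod : submod_closed (tangent_family x).
Proof.
split.
  apply/asboolP; split=> [c c' _ _|//].
  by rewrite -[RHS]/('d (c' \o cinv c) (c x) 0) linear0.
move=> a u v /asboolP[u1 u2] /asboolP[v1 v2]; apply/asboolP; split.
  move=> c c' cx c'x.
  rewrite -[LHS]/(a *: u c' + v c') -[X in _ = 'd _ _ X]/(a *: u c + v c).
  by rewrite linearP -u1 // -v1.
by move=> c cx; rewrite -[LHS]/(a *: u c + v c) u2 // v2 // scaler0 addr0.
Qed.

HB.instance Definition _ :=
  GRing.isSubmodClosed.Build R (chart R n M -> 'rV[R]_n) (tangent_family x)
    tangent_family_submod.

Record tangent := Tangent {
  tangent_val :> chart R n M -> 'rV[R]_n;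
  tangent_valP : tangent_val \in tangent_family x }.

HB.instance Definition _ := [isSub for tangent_val].
HB.instance Definition _ := [Choice of tangent by <:].
HB.instance Definition _ := [SubChoice_isSubLmodule of tangent by <:].

End TangentSpace.

Definition chart_diff (R : realType) (n : nat) (M : c1_manifold R n) (x : M)
  (c : chart R n M) (v : tangent x) : 'rV[R]_n := v c.

Lemma diff_near_eq (R : realType) (V W : normedModType R) (F G : V -> W)
    (p : V) :
  differentiable F p -> differentiable G p ->
  (\forall q \near p, F q = G q) -> 'd F p = 'd G p :> (V -> W).
Proof.
move=> dF dG FG; apply/funext => v; have := near_eq_derive v FG.
have := @deriveE _ _ _ F p v dF; have := @deriveE _ _ _ G p v dG.
by move=> -> ->.
Qed.

Lemma diff_comp_near_eq (R : realType) (U V W : normedModType R) (f : U -> V)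
    (g : V -> W) (h : U -> W) (x : U) (y : V) :
  f x = y -> differentiable f x -> differentiable g y -> differentiable h x ->
  (\forall q \near x, h q = g (f q)) ->
  forall w, 'd h x w = 'd g y ('d f x w).
Proof.
move=> <- df dg dh hE w.
rewrite (diff_near_eq dh (differentiable_comp df dg) hE).
by rewrite diff_comp.
Qed.

Section ChartDiffInv.
Context (R : realType) (n : nat) (M : c1_manifold R n).

Lemma transition_diff (x : M) (c c' c'' : chart R n M) (w : 'rV[R]_n) :
  chart_around x c -> chart_around x c' -> chart_around x c'' ->
  'd (c'' \o cinv c) (c x) w =
  'd (c'' \o cinv c') (c' x) ('d (c' \o cinv c) (c x) w).
Proof.
move=> [ac cx] [ac' c'x] [ac'' c''x].
have D (a b : chart R n M) : atlas a -> atlas b -> dom a x -> dom b x ->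
    differentiable (b \o cinv a) (a x).
  move=> aa ab ax bx; have [H _] := atlas_compatible aa ab.
  by case: (H (a x)) => //; exists x.
apply: (diff_comp_near_eq _ (D c c' ac ac' cx c'x) (D c' c'' ac' ac'' c'x c''x)
  (D c c'' ac ac'' cx c''x)); first by rewrite /= cinvK.
have : \forall q \near c x, dom c' (cinv c q).
  have cc : {in c @` dom c, continuous (cinv c)}.
    by rewrite -continuous_open_subspace; [exact: cinv_continuous|exact: img_open].
  apply: (cc (c x)); first by apply/mem_set; exists x.
  by rewrite /= cinvK //; apply: open_nbhs_nbhs; split=> //; exact: dom_open.
by apply: filterS => q c'q /=; rewrite (cinvK c'q).
Qed.

Definition chart_diff_inv_val (c : chart R n M) (x : M) (w : 'rV[R]_n) :
    chart R n M -> 'rV[R]_n :=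
  fun c' => if `[< chart_around x c /\ chart_around x c' >]
            then 'd (c' \o cinv c) (c x) w else 0.

Lemma chart_diff_inv_subproof c x w :
  chart_diff_inv_val c x w \in tangent_family x.
Proof.
apply/asboolP; split=> [c' c'' c'x c''x|c' c'x]; rewrite /chart_diff_inv_val.
  have [cx|ncx] := pselect (chart_around x c).
    by do 2 (case: asboolP => [_|[]//]); exact: transition_diff.
  do 2 (case: asboolP => [[]//|_]).
  by rewrite linear0.
by case: asboolP => // -[].
Qed.

(* The inverse of [chart_diff c : T_x M -> R^n]; it is 0 if [c] is not a chart
   around [x]. *)
Definition chart_diff_inv (c : chart R n M) (x : M) (w : 'rV[R]_n) :
  tangent x := Tangent (chart_diff_inv_subproof c x w).

Lemma chart_diff_invK c x : chart_around x c ->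
  cancel (chart_diff_inv c x) (@chart_diff _ _ _ x c).
Proof.
move=> cx w; rewrite /chart_diff /= /chart_diff_inv_val.
case: asboolP => [_|[]//].
have did : differentiable (@idfun 'rV[R]_n) (c x) by [].
have d : differentiable (c \o cinv c) (c x).
  case: cx => ac cx; have [H _] := atlas_compatible ac ac.
  by case: (H (c x)) => //; exists x.
suff E : \forall q \near c x, (c \o cinv c) q = idfun q.
  by rewrite (diff_near_eq d did E) diff_val.
have : nbhs (c x) (c @` dom c).
  by apply: open_nbhs_nbhs; split; [exact: img_open|exists x => //; exact: cx.2].
by apply: filterS => q [y cy <-] /=; rewrite cinvK.
Qed.

Lemma chart_diffK c x : chart_around x c ->
  cancel (@chart_diff _ _ _ x c) (chart_diff_inv c x).
Proof.
move=> cx v; apply/val_inj/funext => c' /=; rewrite /chart_diff_inv_val.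
have /asboolP[v1 v2] := tangent_valP v.
case: asboolP => [[_ c'x]|nc]; first by rewrite -v1.
by rewrite v2 // => c'x; exact: nc.
Qed.

End ChartDiffInv.

Record tangent_bundle (R : realType) (n : nat) (M : c1_manifold R n) :=
  TangentBundle { tb_base : M; tb_vec : tangent tb_base }.

Section TangentBundleTopology.
Context (R : realType) (n : nat) (M : c1_manifold R n).

HB.instance Definition _ := gen_eqMixin (tangent_bundle M).
HB.instance Definition _ := gen_choiceMixin (tangent_bundle M).

(* The topology for which the trivialisations dom c * R^n -> TM,
   (x, w) |-> (dc(x))^-1 w, are homeomorphisms onto open sets. *)
Definition tangent_bundle_open : set (set (tangent_bundle M)) :=
  [set W | forall c : chart R n M, atlas c ->
     open [set p : M * 'rV[R]_n |
             dom c p.1 /\ W (TangentBundle (chart_diff_inv c p.1 p.2))]].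

Lemma tangent_bundle_openT : tangent_bundle_open setT.
Proof.
move=> c _.
rewrite (_ : [set _ | _] = fst @^-1` dom c); last first.
  by apply/seteqP; split=> [p []|].
by apply: open_comp; [move=> p _; exact: cvg_fst|exact: dom_open].
Qed.

Lemma tangent_bundle_openI : setI_closed tangent_bundle_open.
Proof.
move=> V W oV oW c ac.
have := openI (oV c ac) (oW c ac); congr open.
by apply/seteqP; split=> [p /= [[? ?] [_ ?]]|p /= [? [? ?]]].
Qed.

Lemma tangent_bundle_open_bigU (I : Type) (F : I -> set (tangent_bundle M)) :
  (forall i, tangent_bundle_open (F i)) ->
  tangent_bundle_open (\bigcup_i F i).
Proof.
move=> oF c ac; have := bigcup_open (fun i (_ : setT i) => oF i c ac).
congr open; apply/seteqP; split=> [p [i _ /= [? ?]]|p /= [? [i _ ?]]].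
  by split=> //; exists i.
by exists i.
Qed.

HB.instance Definition _ := isOpenTopological.Build (tangent_bundle M)
  tangent_bundle_openT tangent_bundle_openI tangent_bundle_open_bigU.

End TangentBundleTopology.

Definition is_norm (R : realType) (V : lmodType R) (nu : V -> R) :=
  [/\ forall v, 0 <= nu v,
      forall v, nu v = 0 -> v = 0,
      forall (a : R) v, nu (a *: v) = `|a| * nu v &
      forall u v, nu (u + v) <= nu u + nu v].

Record finsler_manifold (R : realType) (n : nat) := FinslerManifold {
  manifold :> c1_manifold R n;
  fnorm : forall x : manifold, tangent x -> R;
  fnorm_norm : forall x : manifold, is_norm (@fnorm x);
  fnorm_continuous :
    continuous (fun p : tangent_bundle manifold => fnorm (tb_vec p)) }.

Section FinslerDistance.
Context (R : realType) (n : nat) (M : finsler_manifold R n).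

(* C^1 on the closed interval [a, b]: in charts, the path is locally the
   restriction of a C^1 map defined on an open interval. *)
Definition c1_path (a b : R) (g : R -> M) :=
  forall t, t \in `[a, b] -> exists2 c : chart R n M, chart_around (g t) c &
    exists h : R -> 'rV[R]_n,
      (\forall s \near t, derivable h s 1 /\ {for s, continuous (derive1 h)}) /\
      (\forall s \near t, s \in `[a, b] -> dom c (g s) /\ c (g s) = h s).

Definition piecewise_c1_path (a b : R) (g : R -> M) :=
  [/\ a < b,
      {within `[a, b], continuous g} &
      exists2 s : seq R, itv_partition a b s &
        forall i, (i < size s)%N ->
          c1_path (nth b (a :: s) i) (nth b (a :: s) i.+1) g].

(* Meaningful where g is differentiable, hence at all but finitely many points
   of the domain of a piecewise C^1 path. *)
Definition velocity (g : R -> M) (t : R) : tangent (g t) :=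
  let c := chart_at (g t) in chart_diff_inv c (g t) (derive1 (c \o g) t).

Definition path_length (a b : R) (g : R -> M) : \bar R :=
  (\int[lebesgue_measure]_(t in `[a, b]) (fnorm (velocity g t))%:E)%E.

(* The infimum is +oo when no path joins x to y. *)
Definition fdist (x y : M) : \bar R :=
  ereal_inf [set l | exists a b g,
    [/\ piecewise_c1_path a b g, g a = x, g b = y & l = path_length a b g]].

Definition fclosed_ball (x : M) (t : R) : set M :=
  [set y | (fdist x y <= t%:E)%E].

Definition finsler_complete :=
  forall u : nat -> M,
    (forall e : R, 0 < e -> exists K, forall i j, (K <= i)%N -> (K <= j)%N ->
       (fdist (u i) (u j) < e%:E)%E) ->
    exists x, forall e : R, 0 < e -> exists K, forall i, (K <= i)%N ->
      (fdist (u i) x < e%:E)%E.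

End FinslerDistance.

Definition clarke_limits (R : realType) (m n : nat)
    (F : 'rV[R]_m -> 'rV[R]_n) (p : 'rV[R]_m) : set 'M[R]_(m, n) :=
  [set A | exists u : nat -> 'rV[R]_m,
     [/\ u @ \oo --> p, forall i, differentiable F (u i) &
         (fun i => jacobian F (u i)) @ \oo --> A]].

(* A matrix A stands for the linear map v |-> v *m A, as in [jacobian]. *)
Definition clarke_euclidean (R : realType) (m n : nat)
    (F : 'rV[R]_m -> 'rV[R]_n) (p : 'rV[R]_m) : set 'M[R]_(m, n) :=
  smallest (@convex_set R 'M[R]_(m, n)) (clarke_limits F p).

Section Clarke.
Context (R : realType) (m n : nat) (M : c1_manifold R m) (N : c1_manifold R n).

Definition lipschitz_near (f : M -> N) (x : M) :=
  exists (phi : chart R m M) (psi : chart R n N),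
    [/\ chart_around x phi, chart_around (f x) psi, f @` dom phi `<=` dom psi &
        exists2 W : set 'rV[R]_m, nbhs (phi x) W /\ W `<=` phi @` dom phi &
          [lipschitz (psi \o f \o cinv phi) p | p in W]].

Definition locally_lipschitz (f : M -> N) := forall x, lipschitz_near f x.

Definition clarke_in_charts (phi : chart R m M) (psi : chart R n N)
    (f : M -> N) (x : M) : set {linear tangent x -> tangent (f x)} :=
  [set B | exists2 A, clarke_euclidean (psi \o f \o cinv phi) (phi x) A &
     forall v, B v = chart_diff_inv psi (f x) (chart_diff phi v *m A)].

Arguments clarke_in_charts : clear implicits.

(* For f Lipschitz near x, [clarke_in_charts phi psi f x] does not depend on
   the charts, and the union is over equal sets. *)
Definition clarke (f : M -> N) (x : M) : set {linear tangent x -> tangent (f x)}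
  := [set B | exists (phi : chart R m M) (psi : chart R n N),
       [/\ chart_around x phi, chart_around (f x) psi &
           clarke_in_charts phi psi f x B]].

End Clarke.

Arguments clarke_in_charts {R m n M N} phi psi f x _.
Arguments clarke {R m n M N} f x _.

Definition maximal_rank (R : realType) (n : nat) (M N : c1_manifold R n)
    (f : M -> N) (x : M) :=
  forall B, clarke f x B -> bijective B.

(* An infimum in the extended reals: it is +oo in dimension 0. *)
Definition conorm (R : realType) (m n : nat) (M : finsler_manifold R m)
    (N : finsler_manifold R n) (f : M -> N) (x : M) : \bar R :=
  ereal_inf [set ereal_inf [set (fnorm (B v))%:E | v in [set v | fnorm v = 1]]
            | B in clarke f x].

Definition conorm_on_ball (R : realType) (m n : nat) (M : finsler_manifold R m)
    (N : finsler_manifold R n) (f : M -> N) (x0 : M) (t : R) : \bar R :=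
  ereal_inf [set conorm f x | x in fclosed_ball x0 t].

(* Paths are functions on R of which only the restriction to [0, 1] matters;
   a homotopy class contains all the extensions of its members. *)
Section FundamentalGroup.
Context (R : realType) (T : topologicalType).

Definition is_path (x y : T) (a : R -> T) :=
  [/\ {within `[0, 1], continuous a}, a 0 = x & a 1 = y].

Definition path_connected := forall x y : T, exists a, is_path x y a.

Definition loop_homotopic (x : T) (a b : R -> T) :=
  exists H : R * R -> T,
    [/\ {within `[0, 1] `*` `[0, 1], continuous H},
        forall t, t \in `[0, 1] -> H (t, 0) = a t,
        forall t, t \in `[0, 1] -> H (t, 1) = b t,
        forall s, s \in `[0, 1] -> H (0, s) = x &
        forall s, s \in `[0, 1] -> H (1, s) = x].

Definition loop_class (x : T) (a : R -> T) : set (R -> T) :=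
  [set b | loop_homotopic x a b].

Definition pi1 (x : T) : set (set (R -> T)) :=
  [set loop_class x a | a in is_path x x].

Definition path_concat (a b : R -> T) : R -> T :=
  fun t => if t <= 2^-1 then a (2 * t) else b (2 * t - 1).

(* The group law of [pi1 x]: [a][b] = [ab]. *)
Definition pi1_mul (x : T) (A B : set (R -> T)) : set (R -> T) :=
  [set c | exists a b, [/\ A a, B b & loop_homotopic x (path_concat a b) c]].

Definition simply_connected :=
  path_connected /\
  forall x (a : R -> T), is_path x x a -> loop_homotopic x a (cst x).

End FundamentalGroup.

Arguments pi1 R {T} x _.

Definition pi1_isomorphic (R : realType) (S T : topologicalType) (x : S)
    (y : T) :=
  exists2 h : set (R -> S) -> set (R -> T), set_bij (pi1 R x) (pi1 R y) h &
    forall A B, pi1 R x A -> pi1 R x B ->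
      h (pi1_mul x A B) = pi1_mul y (h A) (h B).

Definition homeomorphism (S T : topologicalType) (f : S -> T) :=
  continuous f /\
  exists g : T -> S, [/\ continuous g, cancel f g & cancel g f].

(* Main.v *)
(** If [k] is smaller than the co-norm at [x], every matrix of the (closed)
   Clarke differential expands vectors by [k].  By Rademacher's theorem and
   Fubini, the differentials at nearby points control the increments of [f]
   along segments, so that these increments are almost images by a matrix of
   the Clarke differential; hence [f] is a homeomorphism near [x] and its
   inverse is [1/k]-Lipschitz.

   Let a segment in a chart of [N] be lifted to a path [p] of [M], and let
   [r t] be the distance from [x0] to [p t].  Then [m (r t) * r' t] is bounded
   by the speed of the segment, up to a factor 2, so the divergence of the
   integral of [m] keeps [r] bounded.  On a bounded set the co-norm is bounded
   below, so [p] is Lipschitz and completeness lets it be continued: whole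
   segments can be lifted, and the charts of [N] provide local sections of [f]
   through each point of the fibres.  Thus paths and homotopies can be lifted.

   Two points of a fibre are joined by a path of [M], whose image is a loop.
   If every loop of [N] is homotopic to the image of a loop of [M], the two
   points coincide.  This is the case if [N] is simply connected, and also in
   the finite case since [pi1 M -> pi1 N] is injective between finite sets of
   the same cardinality. *)

Require Import Defs.
From HB Require Import structures.
From mathcomp Require Import all_boot all_order all_algebra.
From mathcomp Require Import all_classical all_reals all_analysis.
From mathcomp Require Import measurable_realfun.
From mathcomp Require Import ring lra zify.

Set Implicit Arguments.
Unset Strict Implicit.
Unset Printing Implicit Defensive.

Import Order.TTheory GRing.Theory Num.Theory.
Import numFieldNormedType.Exports.

Local Open Scope classical_set_scope.
Local Open Scope ring_scope.

(** Lengths are defined for piecewise $C^1$ paths, but a lifted segment is only known to be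
    Lipschitz. Its length is therefore never formed: distances between points of a lift are
    controlled by monotonicity arguments of Dini type. The nonincreasing function $m$ may jump, so
    its integral enters only through a primitive $G$ with $G(t) - G(s) \le m(s)(t-s)$ for $s \le t$.
    The factor 2 arises because local inversion needs a constant strictly below the co-norm, for
    which half of $m$ is taken.

    That $f$ is open near a point comes from minimising a squared distance in charts. A nonzero
    residual would decrease along one direction that suits all matrices of the Clarke differential
    at once; this direction is found by projecting 0 on a compact convex set. Rows and matrices
    carry the maximum norm while projections are Euclidean, hence the powers of the dimension in the
    constants. *)

(** * Monotonicity principles and Lipschitz functions of a real variable *)

(** The local condition makes both [A] and its complement open, and the line is connected. The
    condition is symmetric in [s] and [s'], so membership travels backwards as well as forwards. *)
Lemma real_induction (R : realType) (A : set R) (a : R) :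
  A a ->
  (forall t : R, exists2 d : R, 0 < d & forall s s',
     `|s - t| < d -> `|s' - t| < d -> A s -> A s') ->
  forall t, A t.
Proof.
move=> Aa H t.
suff -> : A = setT by [].
have oA : open A.
  rewrite openE => s As; have [d d0 Hd] := H s.
  apply/nbhs_ballP; exists d => // s' /= ss'.
  by apply: (Hd s) => //; rewrite ?subrr ?normr0 // distrC.
have oCA : open (~` A).
  rewrite openE => s As; have [d d0 Hd] := H s.
  apply/nbhs_ballP; exists d => // s' /= ss' As'; apply: As.
  by apply: (Hd s') => //; rewrite ?subrr ?normr0 // distrC.
have cR : connected [set: R] by apply/connected_intervalP.
apply: cR; first by exists a.
- by exists A; rewrite ?setTI.
- by exists A; rewrite ?setTI // -openC.
Qed.

(** Consider the supremum of the times up to which [Phi] stays below [Phi a]. The condition on the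
    left shows that it is attained, the condition on the right that it cannot be smaller than [b].
    No derivative of [Phi] is involved, which suits distance functions along a lift. *)
Lemma dini_le (R : realType) (Phi : R -> R) (a b : R) : a <= b ->
  (forall t, a <= t < b -> exists2 d, 0 < d &
     forall s, t < s < t + d -> s <= b -> Phi s <= Phi t) ->
  (forall t e, a < t <= b -> 0 < e -> exists2 d, 0 < d &
     forall s, t - d < s < t -> a <= s -> Phi t <= Phi s + e) ->
  Phi b <= Phi a.
Proof.
move=> ab Hr Hl.
pose S := [set t | a <= t <= b /\ forall s, a <= s <= t -> Phi s <= Phi a].
have Sa : S a.
  by split; [rewrite lexx|move=> s /andP[h1 h2]; rewrite (@le_anti _ _ s a) // h1 h2].
have hS : has_sup S by split; [exists a|exists b => t [/andP[]]].
set c := sup S.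
have ac : a <= c by apply: sup_upper_bound.
have cb : c <= b by apply: ge_sup; [exists a|move=> t [/andP[]]].
have below s : a <= s < c -> Phi s <= Phi a.
  move=> /andP[as_ sc].
  have [t [_ St] st] := sup_adherent (eps := c - s) ltac:(by rewrite subr_gt0) hS.
  by apply: St; rewrite as_ /= ltW //; move: st; rewrite -/c opprB addrC subrK.
have Phic : Phi c <= Phi a.
  have [ca|ca] := leP c a; first by rewrite (@le_anti _ _ c a) // ca ac.
  apply/ler_addgt0Pr => e e0.
  have [d d0 Hd] := Hl c e ltac:(by rewrite ca cb) e0.
  pose s := Num.max a (c - d / 2).
  have sc : s < c by rewrite gt_max ca /= ltrBlDr ltrDl divr_gt0.
  have as_ : a <= s by rewrite le_max lexx.
  apply: le_trans (Hd s _ as_) _; last by rewrite lerD2r below // as_ sc.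
  rewrite sc andbT lt_max; apply/orP; right; lra.
have [bc|cb'] := leP b c; first by rewrite (@le_anti _ _ b c) // bc cb.
have [d d0 Hd] := Hr c ltac:(by rewrite ac cb').
pose t := Num.min b (c + d / 2).
have tb : t <= b by rewrite ge_min lexx.
have ct : c < t by rewrite lt_min cb' /= ltrDl divr_gt0.
suff : S t by move=> /(ub_le_sup hS.2); rewrite leNgt ct.
split; first by rewrite tb (le_trans ac) // ltW.
move=> s /andP[as_ st].
have [cs|sc] := ltP c s.
  apply: le_trans (Hd s _ (le_trans st tb)) Phic.
  rewrite cs /=; apply: le_lt_trans st _; rewrite gt_min; apply/orP; right; lra.
have [sc'|cs] := ltP s c; first by apply: below; rewrite as_ sc'.
by rewrite (@le_anti _ _ s c) // sc cs.
Qed.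

Section LipschitzLine.
Variables (R : realType) (g : R -> R) (K : R).
Hypothesis K0 : 0 <= K.
Hypothesis gK : forall x y, `|g x - g y| <= K * `|x - y|.
Local Notation mu := (@lebesgue_measure R).

(** Adding [K * x] makes the function nondecreasing, so that it defines a Stieltjes measure. Its
    Radon-Nikodym density will be the derivative of [g], shifted by [K]. *)
Let G (x : R) := g x + K * x.

Let G_nd : nondecreasing G.
Proof.
move=> x y xy; rewrite /G -subr_ge0.
have := gK x y; rewrite [`|x - y|]ler0_norm ?subr_le0 // => h.
have := ler_norm (g x - g y); lra.
Qed.

Let g_cont : continuous g.
Proof.
move=> x; apply/cvgrPdist_lt => e e0.
have K1 : 0 < K + 1 by rewrite ltr_wpDl.
near=> y.
apply: le_lt_trans (gK _ _) _; apply: (@le_lt_trans _ _ ((K + 1) * `|x - y|)).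
  by rewrite ler_wpM2r // lerDl.
rewrite mulrC -ltr_pdivlMr //.
near: y; apply: (@cvgr_dist_lt _ _ _ (nbhs x)); [exact: cvg_id|exact: divr_gt0].
Unshelve. all: end_near. Qed.

Let G_cont : continuous G.
Proof.
move=> x; apply: cvgD; [exact: g_cont|apply: cvgMr; exact: cvg_id].
Qed.

HB.instance Definition _ := isCumulative.Build R _ R G G_nd (right_continuousW G_cont).

Let nu0 := lebesgue_stieltjes_measure G.

(** A bounded interval makes the measure finite; it contains a neighbourhood of [0, 1], so that
    derivatives at points of ]0, 1[ do not feel the restriction. *)
Let D : set (measurableTypeR R) := `]-1, 2]%classic.
Let mD : measurable D. Proof. exact: measurable_itv. Qed.

Let nu0_oc (a b : R) : nu0 `]a, b]%classic = if a < b then (G b - G a)%:E else 0%E.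
Proof.
rewrite /nu0 /lebesgue_stieltjes_measure /measure_extension /=.
rewrite measurable_mu_extE /=; last exact: is_ocitv.
by rewrite wlength_itv /= lte_fin; case: ifP => //; rewrite EFinB.
Qed.

Let nu0_lt : (nu0 D < +oo)%E.
Proof. by rewrite nu0_oc; case: ifP => _; rewrite ltry. Qed.

Let nu : {finite_measure set (measurableTypeR R) -> \bar R} := mfrestr mD nu0_lt.

Let nuE A : nu A = nu0 (A `&` D). Proof. by []. Qed.

(** The increments of [G] are at most 2K times those of the variable, which compares the two outer
    measures cover by cover. [K + 1] replaces [K] so that the factor can be divided by. *)
Let nu_dom : nu `<< mu.
Proof.
apply/null_content_dominatesP => A mA A0.
have K1 : 0 < 2 * (K + 1) by rewrite mulr_gt0 // ltr_wpDl.
suff : (nu0 A <= (2 * (K + 1))%:E * mu A)%E.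
  rewrite A0 mule0 => h; apply/eqP; rewrite eq_le measure_ge0 andbT.
  apply: le_trans h; rewrite /nu /= /mfrestr /mrestr.
  by apply: le_measure => //; rewrite inE //; apply: measurableI.
rewrite /nu0 /mu /lebesgue_measure /lebesgue_stieltjes_measure /measure_extension.
rewrite /mu_ext -lee_pdivrMl //.
apply: le_ereal_inf_tmp => _ [F [mF AF] <-].
rewrite lee_pdivrMl // -nneseriesZl //.
apply: (@le_trans _ _ (\sum_(k <oo) wlength G (F k))%E).
  by apply: ereal_inf_lbound; exists F.
apply: lee_nneseries => [k _|k _]; first by move=> _; exact: wlength_ge0.
rewrite /=.
have /ocitvP[->|[[x y] /= xy ->]] := mF k; first by rewrite !wlength0 mule0.
rewrite !wlength_itv /= lte_fin xy -!EFinD -EFinM lee_fin /G.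
have := gK y x; rewrite (@ger0_norm _ (y - x)) => [h|]; last by rewrite subr_ge0 ltW.
have := ler_norm (g y - g x); move: xy => /=; lra.
Qed.

Lemma dens : exists f : R -> R, [/\ forall x, 0 <= f x, mu.-integrable setT (EFin \o f) &
   forall A, measurable A -> nu A = (\int[mu]_(x in A) (f x)%:E)%E].
Proof.
have [f [f0 ffin fi fE]] := radon_nikodym_sigma_finite nu_dom.
exists (fine \o f); have E : EFin \o (fine \o f) = f.
  by apply/funext => x /=; rewrite fineK.
split.
- by move=> x; apply: fine_ge0.
- by rewrite E.
- move=> A mA; rewrite fE //; apply: eq_integral => x _; by rewrite /= fineK.
Qed.

(** On ]-1, 2[ the distribution function of [nu] is [G] up to a constant, and the fundamental
    theorem of calculus gives it the derivative [f] at almost every point. *)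
Lemma lip_density : exists f : R -> R, [/\ forall x, 0 <= f x,
   mu.-integrable setT (EFin \o f),
   (\int[mu]_(x in `]0%R, 1%R]) (f x)%:E = (g 1 - g 0 + K)%:E)%E &
   {ae mu, forall x, 0 < x < 1 -> derivable g x 1 /\ derive1 g x + K = f x}].
Proof.
have [f [f0 fi fE]] := dens; exists f; split => //.
  rewrite -fE; last exact: measurable_itv.
  rewrite nuE setIidl; last first.
    by apply: subset_itv; rewrite bnd_simp; lra.
  by rewrite nu0_oc ltr01 /G; congr EFin; ring.
have fiN y : mu.-integrable `]-oo, y]%classic (EFin \o f).
  by apply: integrableS fi => //.
have lf : locally_integrable [set: R] f.
  by apply: open_integrable_locally => //; exact: openT.
have := FTC1Ny fiN lf; apply: filterS; first exact: (ae_filter_ringOfSetsType mu).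
move=> x /= [dF FE] x01.
set F := (fun x : R => _) in dF FE.
have FG y : -1 < y < 2 -> F y = G y - G (-1).
  move=> y12; rewrite /F /Rintegral -fE; last exact: measurable_itv.
  rewrite nuE.
  rewrite (_ : _ `&` D = `]-1, y]%classic); last first.
    apply/seteqP; rewrite /D; split => z /=; rewrite !in_itv /=; first by case=> zy /andP[-> _].
    move=> /andP[-> zy] /=; split => //; apply: le_trans zy _; apply: ltW.
    by case/andP: y12.
  by rewrite nu0_oc ifT //; case/andP: y12.
have gF : \forall y \near x, F y - K * y + G (-1) = g y.
  have : \forall y \near x, y \in `]-1, 2[.
    apply: near_in_itvoo; rewrite in_itv /=.
    by case/andP: x01 => ? ?; apply/andP; split; lra.
  by apply: filterS => y; rewrite in_itv /= => y12; rewrite FG // /G; ring.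
have D2 : is_derive x 1 (fun y => F y - K * y + G (-1)) (f x - K).
  have D1 : is_derive x 1 F (f x) by rewrite -FE derive1E; apply: derivableP.
  apply: is_derive_eq.
  rewrite addr0; congr (_ - _); rewrite /=; exact: mulr1.
have D3 : is_derive x 1 g (f x - K) by apply: near_eq_is_derive D2 => //.
split; first exact: ex_derive.
by rewrite derive1E derive_val subrK.
Qed.

Lemma lip_ae : mu.-negligible [set x | 0 < x < 1 /\ ~ derivable g x 1].
Proof.
have [f [_ _ _ H]] := lip_density.
apply: negligibleS H => x /= [x01 nd] h; exact: nd (h x01).1.
Qed.

End LipschitzLine.

(** Otherwise the derivative would be smaller than [g 1 - g 0 - eta] almost everywhere on ]0, 1[,
    although its integral is [g 1 - g 0]. *)
Lemma lip_mean (R : realType) (g : R -> R) (K : R) (E : set R) (eta : R) :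
  0 <= K -> (forall x y, `|g x - g y| <= K * `|x - y|) ->
  0 < eta -> (@lebesgue_measure R).-negligible E ->
  exists t, [/\ 0 < t < 1, ~ E t, derivable g t 1 & g 1 - g 0 - eta <= derive1 g t].
Proof.
move=> K0 gK0 eta0 NE; apply: contrapT => H.
(* A Lipschitz constant larger than [K], chosen so that the constant function compared with the
   density is nonnegative. *)
pose L := K + `|g 1 - g 0| + eta.
have L0 : 0 <= L by rewrite !addr_ge0 // ltW.
have gK x y : `|g x - g y| <= L * `|x - y|.
  by apply: le_trans (gK0 x y) _; rewrite ler_wpM2r // /L -addrA lerDl addr_ge0 // ltW.
have c0 : 0 <= g 1 - g 0 - eta + L.
  by have := ler_norm (- (g 1 - g 0)); rewrite normrN /L; lra.
have [f [f0 fi If H1]] := lip_density L0 gK.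
have : (\int[lebesgue_measure]_(x in `]0%R, 1%R]) (f x)%:E <=
        \int[lebesgue_measure]_(x in `]0%R, 1%R]) (g 1 - g 0 - eta + L)%:E)%E.
  apply: ae_ge0_le_integral => //=.
  - by move=> x _; rewrite lee_fin.
  - by case/integrableP: fi => mf _; apply: (measurable_funS measurableT _ mf).
  have N1 : (@lebesgue_measure R).-negligible [set 1].
    by apply/negligibleP => //; exact: lebesgue_measure_set1.
  apply: negligibleS (negligibleU N1 (negligibleU NE H1)) => x /= /not_implyP[].
  rewrite in_itv /= => /andP[x0 x1] fx.
  have [->|x1'] := eqVneq x 1; first by left.
  right; have [Ex|nEx] := pselect (E x); [by left|right => h; apply: fx].
  have xx : 0 < x < 1 by rewrite x0 lt_neqAle x1' x1.
  have [dg <-] := h xx; rewrite lee_fin lerD2r; rewrite leNgt; apply/negP => lt.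
  by apply: H; exists x; split => //; exact: ltW.
rewrite If integral_cst //= lebesgue_measure_itv /= lte_fin ltr01 oppr0 adde0 mule1 lee_fin.
by apply/negP; rewrite -ltNge; lra.
Qed.

(** * Rademacher's theorem *)

Section MatrixNorm.
Variables (R : realType) (m n : nat).
Implicit Types M : 'M[R]_(m, n).

Lemma ler_coord_norm M i j : `|M i j| <= `|M|.
Proof.
rewrite [leRHS]mx_normrE.
exact: (le_bigmax_cond _ (fun ij : 'I_m * 'I_n => `|M ij.1 ij.2|) (j := (i, j))).
Qed.

Lemma mx_norm_le M (r : R) : 0 <= r -> (forall i j, `|M i j| <= r) -> `|M| <= r.
Proof.
by move=> r0 h; rewrite [leLHS]mx_normrE; apply: bigmax_le => // -[i j] _; exact: h.
Qed.

Lemma mx_norm_lt M (r : R) : 0 < r -> (forall i j, `|M i j| < r) -> `|M| < r.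
Proof.
by move=> r0 h; rewrite [ltLHS]mx_normrE; apply: bigmax_lt => // -[i j] _; exact: h.
Qed.
End MatrixNorm.

(** * A translation-invariant measure on row vectors *)

Lemma lebesgue_measure_shift (R : realType) (v : R) (A : set (measurableTypeR R)) :
  measurable A ->
  lebesgue_measure ((fun x : measurableTypeR R => (x + v : measurableTypeR R)) @^-1` A) = lebesgue_measure A.
Proof.
move=> mA.
have mf : measurable_fun [set: measurableTypeR R] (fun x : measurableTypeR R => (x + v : measurableTypeR R)).
  by apply: measurable_funD => //.
rewrite -[LHS]/(pushforward lebesgue_measure (fun x : measurableTypeR R => (x + v : measurableTypeR R)) A).
apply/esym; apply: (lebesgue_measure_unique (mu := pushforward _ _)) => //= X /ocitvP[->|[[a b] /= ab ->]].
  by rewrite !measure0.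
rewrite /pushforward (_ : _ @^-1` _ = `]a - v, b - v]%classic); last first.
  by apply/seteqP; split => x /=; rewrite !in_itv /= ltrBlDr lerBrDr.
rewrite !lebesgue_measure_itv /= !lte_fin ltrD2r -!EFinB; case: ifP => // _.
by congr EFin; lra.
Qed.

Section ProductSigmaFinite.
Context (d1 d2 : measure_display) (T1 : measurableType d1) (T2 : measurableType d2)
  (R : realType).
Variables (m1 : {sigma_finite_measure set T1 -> \bar R})
  (m2 : {sigma_finite_measure set T2 -> \bar R}).

(* A fresh constant: on [m1 \x m2] itself, the instance of the library for
   probability measures shadows the one for sigma-finite measures. *)
Definition sigma_finite_prod : set (T1 * T2) -> \bar R := (m1 \x m2)%E.

HB.instance Definition _ := Measure.on sigma_finite_prod.

Let sigma_finite_prodT : sigma_finite setT sigma_finite_prod.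
Proof.
have [F FT Ffin] := sigma_finiteT m1.
have [G GT Gfin] := sigma_finiteT m2.
exists (fun k => if unpickle k is Some (i, j) then F i `*` G j else set0).
  apply/esym; rewrite -subTset => -[x y] _.
  have : (\bigcup_i F i) x by rewrite -FT.
  have : (\bigcup_i G i) y by rewrite -GT.
  move=> [j _ Gjy] [i _ Fix]; exists (pickle (i, j)) => //.
  by rewrite pickleK.
move=> k; case: unpickle => [[i j]|]; last by rewrite measure0.
have [mF oF] := Ffin i; have [mG oG] := Gfin j; split; first exact: measurableX.
by rewrite /sigma_finite_prod product_measure1E // lte_mul_pinfty // ge0_fin_numE.
Qed.

HB.instance Definition _ :=
  Measure_isSigmaFinite.Build _ _ _ sigma_finite_prod sigma_finite_prodT.

End ProductSigmaFinite.

(** All that is retained of Lebesgue measure on R^n. The measure lives on an auxiliary space [T], an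
    iterated product of lines, and a set of rows is measured through its preimage by [phi]. Positive
    measure of boxes turns statements about almost every point into statements about some point near
    a given one. *)
Definition euclidean_measure (R : realType) (n : nat) (d : measure_display)
    (T : measurableType d) (mu : {sigma_finite_measure set T -> \bar R})
    (phi : T -> 'rV[R]_n) (psi : 'rV[R]_n -> T) :=
  [/\ cancel psi phi,
      forall i, measurable_fun [set: T] (fun x => phi x ord0 i : measurableTypeR R),
      forall d' (X : measurableType d') (h : X -> 'rV[R]_n),
        (forall i, measurable_fun [set: X] (fun x => h x ord0 i : measurableTypeR R)) ->
        measurable_fun [set: X] (psi \o h),
      forall (v : 'rV[R]_n) A, measurable A ->
        mu ((fun x => psi (phi x + v)) @^-1` A) = mu A &
      forall (y : 'rV[R]_n) (r : R), 0 < r ->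
        (0 < mu [set x | (forall i, `|phi x ord0 i - y ord0 i| < r)%R])%E].

(** Induction on the dimension: a point mass in dimension 0, then a product with the line.
    Translations act on the sections, where the induction hypothesis applies, and then on the first
    coordinate, where Lebesgue measure is invariant. *)
Lemma exists_euclidean_measure (R : realType) (n : nat) :
  exists d (T : measurableType d) (mu : {sigma_finite_measure set T -> \bar R})
    phi psi, @euclidean_measure R n d T mu phi psi.
Proof.
elim: n => [|n [d [T [mu [phi [psi [pK phim psim shift pos]]]]]]].
  exists _, unit, (dirac tt : {sigma_finite_measure set unit -> \bar R}), (fun=> 0), (fun=> tt).
  split.
  - by move=> x; apply/rowP => -[].
  - by move=> [].
  - by move=> d' X h _; exact: measurable_cst.
  - by move=> v A _; rewrite (_ : _ @^-1` A = A) //; apply/seteqP; split => -[].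
  - move=> y r r0; rewrite (_ : mkset _ = setT).
      by rewrite -[X in (_ < X)%E]/(\d_tt setT : \bar R) diracE in_setT.
    by apply/seteqP; split => // -[] _ [].
pose T' : measurableType _ := (measurableTypeR R * T)%type.
pose mu' : {sigma_finite_measure set T' -> \bar R} := sigma_finite_prod lebesgue_measure mu.
pose phi' (x : T') : 'rV[R]_n.+1 := row_mx (x.1%:M : 'rV[R]_1) (phi x.2).
pose psi' (w : 'rV[R]_n.+1) : T' := (w ord0 ord0, psi (rsubmx (w : 'rV_(1 + n)))).
have phi0 x : phi' x ord0 ord0 = x.1.
  rewrite /phi' (_ : @ord0 n = @lshift 1 n ord0); last exact: val_inj.
  by rewrite [LHS](row_mxEl (x.1%:M : 'rV[R]_1) (phi x.2) ord0 ord0) mxE eqxx mulr1n.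
have phiS x i : phi' x ord0 (rshift 1 i) = phi x.2 ord0 i.
  exact: (row_mxEr (x.1%:M : 'rV[R]_1) (phi x.2) ord0 i).
have ordE (i : 'I_n.+1) : i = ord0 \/ exists j : 'I_n, i = rshift 1 j.
  by case: (unliftP ord0 i) => [j ->|->]; [right; exists j; apply: val_inj|left].
exists _, T', mu', phi', psi'; split.
- move=> w; apply/rowP => i; have [->|[j ->]] := ordE i; first by rewrite phi0.
  by rewrite phiS /= pK mxE.
- move=> i; have [->|[j ->]] := ordE i.
    rewrite (_ : (fun x => _) = fst); first exact: measurable_fst.
    by apply/funext => x; rewrite phi0.
  rewrite (_ : (fun x => _) = (fun x => phi x ord0 j) \o snd).
    by apply: measurableT_comp => //; exact: measurable_snd.
  by apply/funext => x; exact: phiS.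
- move=> d' X h hm; apply: measurable_fun_pair; first exact: hm.
  apply: (psim _ _ (fun x => rsubmx (h x : 'rV_(1 + n)))) => i.
  rewrite (_ : (fun x => _) = (fun x => h x ord0 (rshift 1 i))); first exact: hm.
  by apply/funext => x; rewrite mxE.
- move=> v A mA.
  pose v0 := v ord0 ord0; pose v' := rsubmx (v : 'rV_(1 + n)).
  have E x : psi' (phi' x + v) = (x.1 + v0, psi (phi x.2 + v')).
    rewrite /psi' mxE phi0; congr (_, psi _); apply/rowP => i.
    by rewrite [LHS]mxE [LHS]mxE [RHS]mxE /v' [in RHS]mxE -phiS.
  rewrite /mu' /= /sigma_finite_prod /product_measure1 /=.
  pose g t := mu (xsection A t).
  have mg : measurable_fun setT g by exact: measurable_fun_xsection.
  have mf : measurable_fun [set: measurableTypeR R]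
      (fun x : measurableTypeR R => (x + v0 : measurableTypeR R)).
    exact: measurable_funD.
  transitivity (\int[lebesgue_measure]_t (g (t + v0)%R))%E.
    apply: eq_integral => t _; rewrite /= /g -[RHS](shift v'); last exact: measurable_xsection.
    congr (mu _); apply/seteqP; split => x.
      by rewrite /xsection /= inE /= E inE.
    by rewrite /xsection /= !inE /= E.
  rewrite -[LHS]/(\int[lebesgue_measure]_(t in (fun x : measurableTypeR R => (x + v0 : measurableTypeR R)%R) @^-1` setT) (g \o (fun x : measurableTypeR R => (x + v0 : measurableTypeR R)%R)) t)%E.
  rewrite -ge0_integral_pushforward //.
  by apply: eq_measure_integral => B mB _; exact: lebesgue_measure_shift.
- move=> y r r0.
  pose y' := rsubmx (y : 'rV_(1 + n)).
  have mB i : measurable [set x : T | `|phi x ord0 i - y' ord0 i| < r].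
    rewrite (_ : [set _ | _] = setT `&` (fun x => phi x ord0 i : measurableTypeR R) @^-1` ball (y' ord0 i) r).
      by apply: phim => //; exact: measurable_ball.
    by rewrite setTI; apply/seteqP; split => x /=; rewrite /ball /= distrC.
  rewrite (_ : [set _ | _] = ball (y ord0 ord0) r `*` [set x | forall i, `|phi x ord0 i - y' ord0 i| < r]).
    rewrite /mu' /= /sigma_finite_prod product_measure1E //; last 2 first.
    - exact: measurable_ball.
    - rewrite (_ : [set _ | _] = \bigcap_(i in [set: 'I_n]) [set x : T | `|phi x ord0 i - y' ord0 i| < r]).
        by apply: fin_bigcap_measurable => //; exact: finite_finset.
      by apply/seteqP; split => x /= h i => [_|]; exact: h.
    apply: mule_gt0; last exact: pos.
    apply: (@lt_le_trans _ _ (r *+ 2)%:E); first by rewrite lte_fin mulrn_wgt0.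
    by rewrite -(lebesgue_measure_ball (y ord0 ord0) (ltW r0)).
  apply/seteqP; split => x /=.
    move=> h; split; first by have := h ord0; rewrite phi0 /ball /= distrC.
    by move=> i; have := h (rshift 1 i); rewrite phiS mxE.
  move=> [h0 h] i; have [->|[j ->]] := ordE i.
    by rewrite phi0 distrC.
  by rewrite phiS; have := h j; rewrite mxE.
Qed.

Lemma exists_natSinv_lt (R : realType) (e : R) : 0 < e -> exists j : nat, j.+1%:R^-1 < e.
Proof.
by move=> e0; have [j _ /(_ j (leqnn _))] := near_infty_natSinv_lt (PosNum e0); exists j.
Qed.

Lemma ballE (R : realType) m n (x : 'M[R]_(m, n)) (r : R) y :
  ball x r y = (`|y - x| < r) :> Prop.
Proof. by rewrite mx_norm_ball /= distrC. Qed.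

Lemma mx_ballP (R : realType) m n (x : 'M[R]_(m, n)) (r : R) y :
  ball x r y <-> `|y - x| < r.
Proof. by rewrite ballE. Qed.

Section EuclideanMeasure.
Context (R : realType) (n : nat) (d : measure_display)
    (T : measurableType d) (mu : {sigma_finite_measure set T -> \bar R})
    (phi : T -> 'rV[R]_n) (psi : 'rV[R]_n -> T).
Hypothesis H : euclidean_measure mu phi psi.

Let measurable_box (y : 'rV[R]_n) (r : R) :
  measurable [set x : T | forall i, `|phi x ord0 i - y ord0 i| < r].
Proof.
have [_ phim _ _ _] := H.
rewrite (_ : mkset _ = \bigcap_(i in [set: 'I_n]) [set x : T | `|phi x ord0 i - y ord0 i| < r]).
  apply: fin_bigcap_measurable => [|i _]; first exact: finite_finset.
  rewrite (_ : mkset _ = setT `&` (fun x => phi x ord0 i : measurableTypeR R) @^-1` ball (y ord0 i) r).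
    by apply: phim => //; exact: measurable_ball.
  by rewrite setTI; apply/seteqP; split => x /=; rewrite /ball /= distrC.
by apply/seteqP; split => x /= h i => [_|]; exact: h.
Qed.

(** An open set is the union of the countably many rational boxes that it contains, and boxes are
    measurable coordinate by coordinate. *)
Lemma measurable_preimage_open (U : set 'rV[R]_n) : open U -> measurable (phi @^-1` U).
Proof.
move=> oU.
pose box (q : 'rV[rat]_n) (j : nat) := [set y : 'rV[R]_n | forall i, `|y ord0 i - ratr (q ord0 i)| < j.+1%:R^-1].
pose F k := if unpickle k is Some (q, j) then (if `[< box q j `<=` U >] then phi @^-1` box q j else set0) else set0.
rewrite (_ : _ @^-1` _ = \bigcup_k F k).
  apply: bigcupT_measurable => k; rewrite /F; case: unpickle => [[q j]|] //.
  case: ifP => // _; have := measurable_box (map_mx ratr q) j.+1%:R^-1.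
  congr measurable; apply/seteqP; split => x /= h i.
    by have := h i; rewrite mxE.
  by rewrite mxE; exact: h.
apply/seteqP; split => [x /= Ux|x [k _]]; last first.
  by rewrite /F; case: unpickle => [[q j]|] //; case: ifP => // /asboolP h; exact: h.
have /nbhs_ballP[e /= e0 eU] : nbhs (phi x) U by apply: open_nbhs_nbhs.
have [j je] := exists_natSinv_lt (divr_gt0 e0 (ltr0n _ 2)).
have j0 : 0 < j.+1%:R^-1 :> R by rewrite invr_gt0.
have qE i : exists q : rat, `|phi x ord0 i - ratr q| < j.+1%:R^-1.
  have [q] := rat_in_itvoo (ltr_pwDr j0 (lexx (phi x ord0 i))).
  rewrite in_itv /= => /andP[h1 h2]; exists q.
  by move: (j.+1%:R^-1) j0 h2 => a a0 h2; rewrite ltr_norml; apply/andP; split; lra.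
have [q qP] := choice qE.
exists (pickle (\row_i q i : 'rV[rat]_n, j)) => //; rewrite /F pickleK.
case: asboolP => [_|abs]; first by move=> i; rewrite mxE; exact: qP.
exfalso; apply: abs => y yb; apply: eU; rewrite ballE; apply: mx_norm_lt => // i0 i.
rewrite (ord1 i0) !mxE; have := yb i; rewrite mxE; have := qP i.
rewrite !ltr_norml; move: (j.+1%:R^-1) je => a ae /andP[? ?] /andP[? ?]; apply/andP; split; lra.
Qed.

Lemma measurable_preimage_closed (U : set 'rV[R]_n) : closed U -> measurable (phi @^-1` U).
Proof.
move=> cU; have -> : phi @^-1` U = ~` (phi @^-1` (~` U)) by rewrite preimage_setC setCK.
apply: measurableC; apply: (measurable_preimage_open (U := ~` U)).
exact: closed_openC.
Qed.

Definition line_set (E : set 'rV[R]_n) (u x : 'rV[R]_n) : set (measurableTypeR R) :=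
  [set t | `[0, 1]%classic t /\ E (x + t *: u)].

Let line_prod (E : set 'rV[R]_n) (u : 'rV[R]_n) : set (measurableTypeR R * T) :=
  [set z | `[0, 1]%classic z.1 /\ E (phi z.2 + z.1 *: u)].

Section Fubini.
Variables (E : set 'rV[R]_n) (u : 'rV[R]_n).
Hypothesis mE : measurable (phi @^-1` E).

Let mLP : measurable (line_prod E u).
Proof.
have [pK phim psim _ _] := H.
rewrite (_ : line_prod E u = (fst @^-1` `[0, 1]%classic) `&` ((fun z => psi (phi z.2 + z.1 *: u)) @^-1` (phi @^-1` E))); last first.
  by apply/seteqP; split => z /=; rewrite /line_prod /= pK.
apply: measurableI.
  by rewrite -[X in measurable X]setTI; apply: measurable_fst => //; exact: measurable_itv.
rewrite -[X in measurable X]setTI.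
apply: (psim _ _ (fun z : measurableTypeR R * T => phi z.2 + z.1 *: u)) => // i.
rewrite (_ : (fun z => _) = (fun z => phi z.2 ord0 i + z.1 * u ord0 i)); last first.
  by apply/funext => z; rewrite !mxE.
apply: measurable_funD.
  by apply: (measurableT_comp (f := fun x => phi x ord0 i : measurableTypeR R)) => //; exact: measurable_snd.
apply: measurable_funM; last exact: measurable_cst.
exact: measurable_fst.
Qed.

Let ysecE x : ysection (line_prod E u) x = line_set E u (phi x).
Proof. by apply/seteqP; split => t; rewrite /ysection /= inE. Qed.

Let xsecE t : mu (xsection (line_prod E u) t) = ((\1_(`[0, 1]%classic : set R) t)%:E * mu (phi @^-1` E))%E.
Proof.
have [pK phim psim shift _] := H.
rewrite indicE; case: (boolP (t \in _)) => [|] t01.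
  rewrite mul1e -[RHS](shift (t *: u)) //; congr (mu _); apply/seteqP; split => x.
    by rewrite /xsection /= inE /line_prod /= pK => -[].
  by rewrite /xsection /= inE /line_prod /= pK => ?; split => //; rewrite inE in t01.
rewrite mul0e (_ : xsection _ _ = set0) ?measure0 //.
apply/seteqP; split => x //; rewrite /xsection /= inE => -[/= h _].
by move: t01; rewrite notin_setE; apply.
Qed.

Lemma measurable_line_set x : measurable (line_set E u (phi x)).
Proof. by rewrite -ysecE; exact: measurable_ysection. Qed.

(** For each [t] in [0, 1] the points [x] with [x + t *: u] in [E] form a translate of [E].
    Integrating their measure over [t] thus gives back the measure of [E], while integrating over
    [x] last gives the left-hand side. *)
Lemma fubini_line :
  (\int[mu]_x lebesgue_measure (line_set E u (phi x)) = mu (phi @^-1` E))%E.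
Proof.
transitivity (\int[mu]_x fubini_G lebesgue_measure (EFin \o \1_(line_prod E u)) x)%E.
  by rewrite indic_fubini_tonelli_GE //; apply: eq_integral => x _ /=; rewrite ysecE.
rewrite -(indic_fubini_tonelli lebesgue_measure mu mLP) indic_fubini_tonelli_FE //.
under eq_integral do rewrite /= xsecE.
rewrite ge0_integralZr //; last first.
  by apply/measurable_EFinP; apply: measurable_indic; exact: measurable_itv.
rewrite integral_indic // setIT /=.
by rewrite lebesgue_measure_itv /= lte_fin ltr01 oppr0 adde0 mul1e.
Qed.

Lemma line_null_null :
  (forall x, lebesgue_measure (line_set E u x) = 0%E) -> mu (phi @^-1` E) = 0%E.
Proof.
by move=> h; rewrite -fubini_line integral0_eq // => x _; rewrite h.
Qed.

(** By [fubini_line] the segments from almost all starting points meet [E] in a null set of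
    parameters, and the box of radius [r] about [y] has positive measure. *)
Lemma null_line_null (y : 'rV[R]_n) (r : R) : 0 < r -> mu (phi @^-1` E) = 0%E ->
  exists x, `|x - y| < r /\ lebesgue_measure (line_set E u x) = 0%E.
Proof.
move=> r0 E0; apply: contrapT => nex.
have [_ _ _ _ pos] := H.
have := pos y r r0; apply/negP; rewrite -leNgt.
pose f x := lebesgue_measure (line_set E u (phi x)).
have mf : measurable_fun setT f.
  rewrite (_ : f = lebesgue_measure \o ysection (line_prod E u)).
    by apply: measurable_fun_ysection.
  by apply/funext => x; rewrite /f /= ysecE.
have : (\int[mu]_x `|f x|)%E = 0%E.
  by rewrite -E0 -fubini_line; apply: eq_integral => x _; rewrite gee0_abs.
move/ae_eq_integral_abs => /(_ measurableT mf) [N [mN N0 hN]].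
rewrite -N0; apply: le_measure; rewrite ?inE //.
move=> x /= hx; apply: hN => /= h; apply: nex; exists (phi x); split.
  by apply: mx_norm_lt => // i0 i; rewrite (ord1 i0) !mxE; exact: hx.
exact: h.
Qed.

End Fubini.
End EuclideanMeasure.

(** * Directional derivatives and their additivity *)

Section LinearApprox.
Variables (R : realType).

Lemma lipschitz_cont (V W : normedModType R) (F : V -> W) (K : R) : 0 <= K ->
  (forall x y, `|F x - F y| <= K * `|x - y|) -> continuous F.
Proof.
move=> K0 FK x; apply/cvgrPdist_lt => e e0.
have K1 : 0 < K + 1 by rewrite ltr_wpDl.
near=> y.
apply: le_lt_trans (FK _ _) _; apply: (@le_lt_trans _ _ ((K + 1) * `|x - y|)).
  by rewrite ler_wpM2r // lerDl.
rewrite mulrC -ltr_pdivlMr //.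
near: y; apply: (@cvgr_dist_lt _ _ _ (nbhs x)); [exact: cvg_id|exact: divr_gt0].
Unshelve. all: end_near. Qed.

Lemma mulmx_norm_le (m n : nat) (w : 'rV[R]_m) (A : 'M[R]_(m, n)) :
  `|w *m A| <= m%:R * `|A| * `|w|.
Proof.
apply: mx_norm_le => [|i0 j]; first by rewrite !mulr_ge0.
rewrite mxE; apply: le_trans (ler_norm_sum _ _ _) _.
rewrite -mulrA -[m in m%:R]card_ord -sumr_const mulr_suml.
apply: ler_sum => i _; rewrite mul1r normrM mulrC.
by apply: ler_pM => //; apply: ler_coord_norm.
Qed.

Lemma continuous_mulmxr (m n : nat) (A : 'M[R]_(m, n)) :
  continuous (fun w : 'rV[R]_m => w *m A).
Proof.
apply: (@lipschitz_cont _ _ _ (m%:R * `|A|)); first by rewrite mulr_ge0.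
by move=> x y; rewrite -mulmxBl mulmx_norm_le.
Qed.

Definition linear_approx (m n : nat) (F : 'rV[R]_m -> 'rV[R]_n) (x : 'rV[R]_m)
    (A : 'M[R]_(m, n)) :=
  forall e, 0 < e -> \forall h \near (0 : 'rV[R]_m), `|F (x + h) - F x - h *m A| <= e * `|h|.

Lemma linear_approx_differentiable (m n : nat) (F : 'rV[R]_m -> 'rV[R]_n) x A :
  linear_approx F x A -> differentiable F x /\ jacobian F x = A.
Proof.
move=> FA.
have cA : continuous (mulmxr A : 'rV[R]_m -> 'rV[R]_n) by exact: continuous_mulmxr.
have E : F \o shift x = cst (F x) + (mulmxr A : 'rV[R]_m -> 'rV[R]_n) +o_ (0 : 'rV[R]_m) id.
  apply/eqaddoP => e e0; have := FA e e0; apply: filterS => h.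
  rewrite (_ : (_ - _) h = F (x + h) - F x - h *m A) //.
  rewrite -[LHS]/(F (h + x) - (F x + h *m A)) [h + x]addrC.
  by rewrite opprD addrA.
have D := diff_unique cA E.
have dF : differentiable F x.
  by apply/diff_locallyP; rewrite D; split.
split=> //; apply/row_matrixP => i; rewrite !rowE /jacobian mul_rV_lin1.
by rewrite D.
Qed.

Lemma differentiable_linear_approx (m n : nat) (F : 'rV[R]_m -> 'rV[R]_n) x :
  differentiable F x -> linear_approx F x (jacobian F x).
Proof.
move=> /diff_locally /eqaddoP dF e e0; have := dF e e0; apply: filterS => h.
rewrite (_ : (_ - _) h = F (x + h) - F x - h *m jacobian F x) //.
rewrite -[LHS]/(F (h + x) - (F x + 'd F x h)) [h + x]addrC /jacobian mul_rV_lin1.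
by rewrite opprD addrA.
Qed.

Lemma derivable1_near (g : R -> R) (t e : R) : derivable g t 1 -> 0 < e ->
  \forall s \near (0 : R), `|g (t + s) - g t - s * derive1 g t| <= e * `|s|.
Proof.
move=> /derivable_nbhsP /eqaddoP dg e0; have := dg e e0; apply: filterS => s.
rewrite /= [`|s|]/= => h; apply: le_trans h.
rewrite -[X in _ <= `|X|]/((g \o shift t) (s *: 1) - (g t + s *: 'D_1 g t)) /=.
by rewrite [s *: 1]mulr1 [s *: _]/(_ * _) -derive1E [s + t]addrC opprD addrA.
Qed.

End LinearApprox.

Ltac vring := by apply/matrixP => ? ?; rewrite !mxE; ring.

Section Rademacher.
Variables (R : realType) (n m : nat) (F : 'rV[R]_n -> 'rV[R]_m) (K : R).
Hypothesis K0 : 0 <= K.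
Hypothesis FK : forall x y, `|F x - F y| <= K * `|x - y|.

Let F_cont : continuous F. Proof. exact: lipschitz_cont FK. Qed.

Definition has_dir (x u : 'rV[R]_n) (a : 'rV[R]_m) :=
  forall e, 0 < e -> \forall t \near (0 : R),
    `|F (x + t *: u) - F x - t *: a| <= e * `|t|.

(** Tolerance and radius are indexed by natural numbers: each of these sets is closed, and countable
    unions and intersections of them describe the points where [F] is derivable in the direction
    [u]. *)
Definition near_dir (u : 'rV[R]_n) (a : 'rV[R]_m) (k j : nat) : set 'rV[R]_n :=
  [set x | forall t, `|t| < j.+1%:R^-1 ->
     `|F (x + t *: u) - F x - t *: a| <= k.+1%:R^-1 * `|t|].

Lemma closed_near_dir u a k j : closed (near_dir u a k j).
Proof.
rewrite (_ : near_dir u a k j = \bigcap_(t in [set t : R | `|t| < j.+1%:R^-1])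
   ((fun x => `|F (x + t *: u) - F x - t *: a|) @^-1` [set r | r <= k.+1%:R^-1 * `|t|])) //.
apply: closed_bigI => t _; apply: preimage_closed; [move=> x _|exact: closed_le].
 apply: continuous_comp; [|exact: norm_continuous].
apply: (@lipschitz_cont _ _ _ (fun x => F (x + t *: u) - F x - t *: a) (K + K)).
  exact: addr_ge0.
move=> y z; rewrite [X in `|X|](_ : _ = (F (y + t *: u) - F (z + t *: u)) + (F z - F y)); last first.
  vring.
rewrite mulrDl; apply: le_trans (ler_normD _ _) _; apply: lerD; last by rewrite [`|y - z|]distrC.
by apply: le_trans (FK _ _) _; rewrite opprD addrACA subrr addr0.
Qed.

(** Existence of the directional derivative as a Cauchy condition. The slopes are rational so that
    the union over them is countable. *)
Definition dir_set (u : 'rV[R]_n) : set 'rV[R]_n :=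
  [set x | forall k, exists a : 'rV[rat]_m, exists j, near_dir u (map_mx ratr a) k j x].

Lemma has_dir_near x u a : has_dir x u a ->
  forall k, exists j, near_dir u a k j x.
Proof.
move=> xa k; have /nbhs_ballP[d /= d0 dP] := xa k.+1%:R^-1 ltac:(by rewrite invr_gt0).
have [j jd] := exists_natSinv_lt d0; exists j => t tj.
by apply: dP; rewrite /ball /= sub0r normrN (lt_trans tj).
Qed.

Lemma rat_row_approx p (a : 'rV[R]_p) (e : R) : 0 < e ->
  exists b : 'rV[rat]_p, `|a - map_mx ratr b| < e.
Proof.
move=> e0.
have qE i : exists q : rat, `|a ord0 i - ratr q| < e.
  have [q] := rat_in_itvoo (ltr_pwDr e0 (lexx (a ord0 i))).
  rewrite in_itv /= => /andP[h1 h2]; exists q.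
  by rewrite ltr_norml; apply/andP; split; lra.
have [q qP] := choice qE; exists (\row_i q i).
by apply: mx_norm_lt => // i0 i; rewrite (ord1 i0) !mxE.
Qed.

Lemma natSinv_double k : (2 * k.+1).-1.+1%:R^-1 + (2 * k.+1).-1.+1%:R^-1 = k.+1%:R^-1 :> R.
Proof. by rewrite prednK // natrM invfM -mulrDl -mulr2n -[_ *+ _]mulr_natl mulfV // mul1r. Qed.

Lemma has_dir_dir_set x u a : has_dir x u a -> dir_set u x.
Proof.
move=> xa k.
(* Then 1/(l+1) is half of 1/(k+1): one half for the difference quotient, the other for rounding [a]
   to a rational row. *)
pose l := (2 * k.+1).-1.
have [j jP] := has_dir_near xa l.
have [b bP] := rat_row_approx a (e := l.+1%:R^-1) ltac:(by rewrite invr_gt0).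
exists b, j => t tj; rewrite -natSinv_double mulrDl -/l.
rewrite (_ : _ - _ = (F (x + t *: u) - F x - t *: a) + t *: (a - map_mx ratr b)); last first.
  by rewrite scalerBr addrA subrK.
apply: le_trans (ler_normD _ _) _; apply: lerD; first exact: jP.
by rewrite normrZ mulrC ler_wpM2r // ltW.
Qed.

Lemma near_dir_dist x u a b k l i j : near_dir u a k i x -> near_dir u b l j x ->
  `|a - b| <= k.+1%:R^-1 + l.+1%:R^-1.
Proof.
move=> xa xb.
have [p pP] : exists p : nat, p.+1%:R^-1 < Num.min i.+1%:R^-1 j.+1%:R^-1 :> R.
  by apply: exists_natSinv_lt; rewrite lt_min !invr_gt0 !ltr0n.
pose t : R := p.+1%:R^-1.
have t0 : 0 < t by rewrite invr_gt0.
move: pP; rewrite lt_min -/t => /andP[ti tj].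
have h1 := xa t ltac:(by rewrite gtr0_norm); have h2 := xb t ltac:(by rewrite gtr0_norm).
rewrite -(ler_pM2r (_ : 0 < `|t|)); last by rewrite normr_gt0 gt_eqF.
rewrite mulrDl; apply: le_trans (lerD h1 h2).
rewrite mulrC -normrZ -[X in _ <= X + _]normrN; apply: le_trans (ler_normD _ _).
rewrite le_eqVlt; apply/orP; left; apply/eqP; congr (`|_|); vring.
Qed.

(** By [near_dir_dist] the approximate slopes form a Cauchy sequence, and its limit is the
    derivative. *)
Lemma dir_set_has_dir x u : dir_set u x -> exists a, has_dir x u a.
Proof.
move=> xu; have [a aP] := choice xu; have [j jP] := choice aP.
pose s k : 'rV[R]_m := map_mx ratr (a k).
have sd k l : `|s k - s l| <= k.+1%:R^-1 + l.+1%:R^-1 := near_dir_dist (jP k) (jP l).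
have cs : cvg (s @ \oo).
  apply/cauchy_cvgP/cauchy_exP => e e0.
  have [k ke] := exists_natSinv_lt (divr_gt0 e0 (ltr0n _ 2)).
  exists (s k); suff : \forall l \near \oo, ball (s k) e (s l) by [].
  near=> l; apply/mx_ballP.
  rewrite distrC.
  have lk : l.+1%:R^-1 <= k.+1%:R^-1 :> R.
    by rewrite lef_pV2 ?posrE ?ltr0n // ler_nat ltnS; near: l; exact: nbhs_infty_ge.
  apply: le_lt_trans (sd _ _) _; move: (l.+1%:R^-1) (k.+1%:R^-1) lk ke => *; lra.
have sl k : `|s k - lim (s @ \oo)| <= k.+1%:R^-1 *+ 2.
  apply/ler_addgt0Pr => e e0.
  have /cvgrPdist_lt /(_ e e0) h := cs.
  near \oo => l.
  have hl : `|lim (s @ \oo) - s l| < e by near: l.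
  have lk : l.+1%:R^-1 <= k.+1%:R^-1 :> R.
    by rewrite lef_pV2 ?posrE ?ltr0n // ler_nat ltnS; near: l; exact: nbhs_infty_ge.
  rewrite -(subrK (s l) (s k)) -addrA; apply: le_trans (ler_normD _ _) _.
  rewrite [`|s l - _|]distrC mulr2n; apply: lerD (ltW hl).
  by apply: le_trans (sd _ _) _; rewrite lerD2l.
exists (lim (s @ \oo)) => e e0.
have [k ke] := exists_natSinv_lt (divr_gt0 e0 (ltr0n _ 3)).
apply/nbhs_ballP; exists (j k).+1%:R^-1; first by rewrite /= invr_gt0.
move=> t; rewrite /ball /= sub0r normrN => tj.
have := jP k t tj; rewrite -/(s k) => h.
rewrite (_ : _ - _ = (F (x + t *: u) - F x - t *: s k) + t *: (s k - lim (s @ \oo))); last first.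
  by rewrite scalerBr addrA subrK.
apply: le_trans (ler_normD _ _) _.
apply: (@le_trans _ _ (k.+1%:R^-1 * `|t| + `|t| * (k.+1%:R^-1 *+ 2))).
  by apply: lerD => //; rewrite normrZ; apply: ler_wpM2l.
rewrite (_ : _ + _ = (k.+1%:R^-1 * 3) * `|t|); last by ring.
by apply: ler_wpM2r => //; move: (k.+1%:R^-1) ke => c ce; lra.
Unshelve. all: end_near. Qed.

Lemma has_dirZ x u a c : has_dir x u a -> has_dir x (c *: u) (c *: a).
Proof.
move=> xa e e0; have c0 : 0 < `|c| + 1 by rewrite ltr_wpDl.
have /nbhs_ballP[d /= d0 dP] := xa (e / (`|c| + 1)) ltac:(by rewrite divr_gt0).
apply/nbhs_ballP; exists (d / (`|c| + 1)); first by rewrite /= divr_gt0.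
move=> t; rewrite /ball /= sub0r normrN ltr_pdivlMr // => td.
have := dP (t * c); rewrite /ball /= sub0r normrN !scalerA => h.
apply: le_trans (h _) _.
  by rewrite normrM (le_lt_trans _ td) // ler_wpM2l // lerDl.
rewrite normrM mulrA mulrAC ler_wpM2r // -mulrA ger_pMr //.
by rewrite mulrC ler_pdivrMr // mul1r lerDl.
Qed.

Lemma has_dir_line (x u : 'rV[R]_n) (t : R) :
  (forall i, derivable (fun s : R => F (x + s *: u) ord0 i) t 1) ->
  exists a, has_dir (x + t *: u) u a.
Proof.
move=> dF; exists (\row_i derive1 (fun s : R => F (x + s *: u) ord0 i) t) => e e0.
pose P i (s : R) := `|F (x + (t + s) *: u) ord0 i -
    F (x + t *: u) ord0 i - s * derive1 (fun s : R => F (x + s *: u) ord0 i) t| <= e * `|s|.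
have H : \forall s \near nbhs (0 : R), forall i, P i s.
  by apply: (@filter_forall _ _ P) => i; exact: (derivable1_near (dF i) e0).
apply: filterS H => s h; apply: mx_norm_le => [|i0 i]; first by rewrite mulr_ge0 // ltW.
by rewrite (ord1 i0) !mxE -[x + _ + _]addrA -scalerDl; exact: h.
Qed.

(* The points of this set on a line of direction [u] are at mutual distance at least
   [j.+1%:R^-1], because [F] has increments of slope close to [a], [b] and [c] in the
   directions [u], [v] and [u + v] at each of them. *)
Definition nonadditive_set (u v : 'rV[R]_n) (a b c : 'rV[R]_m) (k j : nat) : set 'rV[R]_n :=
  [set x | [/\ 3 * k.+1%:R^-1 < `|c - a - b|, near_dir u a k j x, near_dir v b k j x &
     near_dir (u + v) c k j x]].

Lemma closed_nonadditive_set u v a b c k j : closed (nonadditive_set u v a b c k j).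
Proof.
have [h|h] := pselect (3 * k.+1%:R^-1 < `|c - a - b|); last first.
  rewrite (_ : nonadditive_set _ _ _ _ _ _ _ = set0); first exact: closed0.
  by apply/seteqP; split => x // -[].
rewrite (_ : nonadditive_set _ _ _ _ _ _ _ = near_dir u a k j `&` near_dir v b k j `&` near_dir (u + v) c k j).
  by do 2 (apply: closedI; last exact: closed_near_dir); exact: closed_near_dir.
by apply/seteqP; split => [x [_ ? ? ?]|x [[? ?] ?]].
Qed.

(** For small nonzero [t], the increment of [F] from [x] to [x + t *: (u + v)] has slope close to
    [c] when taken directly, and close to [a + b] when taken through [x + t *: u]. Three errors of
    1/(k+1) do not fill the gap between the two slopes. *)
Lemma nonadditive_separated u v a b c k j x t : nonadditive_set u v a b c k j x ->
  nonadditive_set u v a b c k j (x + t *: u) -> `|t| < j.+1%:R^-1 -> t = 0.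
Proof.
move=> [h xa _ xc] [_ _ xb _] tj; apply/eqP; apply: contraTT h => t0.
rewrite -leNgt -(ler_pM2r (_ : 0 < `|t|)) ?normr_gt0 // mulrC -normrZ.
have h1 := xa t tj; have h2 := xb t tj; have h3 := xc t tj.
rewrite (_ : 3 * _ * _ = k.+1%:R^-1 * `|t| + k.+1%:R^-1 * `|t| + k.+1%:R^-1 * `|t|); last by ring.
apply: le_trans (lerD (lerD h1 h2) h3).
rewrite -[X in _ <= _ + X]normrN; apply: le_trans (lerD (ler_normD _ _) (lexx _)).
apply: le_trans (ler_normD _ _).
rewrite le_eqVlt; apply/orP; left; apply/eqP; congr (`|_|).
rewrite (_ : x + t *: (u + v) = x + t *: u + t *: v); last by rewrite scalerDr addrA.
vring.
Qed.

(** Two points with the same integer part of [s / d] are at distance less than [d]. *)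
Lemma separated_countable (S : set R) (d : R) : 0 < d ->
  (forall s t, S s -> S t -> `|s - t| < d -> s = t) -> countable S.
Proof.
move=> d0 h; apply/countable_injP; exists (fun s => pickle (Num.floor (s / d))).
move=> s t; rewrite !inE => Ss St /(pcan_inj (@pickleK _)) E.
apply: h => //.
have /andP[h1 h2] := floor_itv (s / d); have /andP[h3 h4] := floor_itv (t / d).
move: h1 h2; rewrite E => h1 h2.
have h5 : `|s / d - t / d| < 1.
  by rewrite ltr_norml; move: h2 h4; rewrite intrD => h2 h4; apply/andP; split; lra.
by move: h5; rewrite -mulrBl normrM [`|d^-1|]gtr0_norm ?invr_gt0 // ltr_pdivrMr // mul1r.
Qed.

Definition int_row (u : 'rV[int]_n) : 'rV[R]_n := map_mx intr u.

Lemma int_rowD u v : int_row (u + v) = int_row u + int_row v.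
Proof. by apply/rowP => i; rewrite !mxE intrD. Qed.

(** Directions are restricted to integer rows: there are countably many, so the exceptional null
    sets can be united, and rescaled integer rows approximate every direction. *)
Definition good_point (x : 'rV[R]_n) :=
  (forall u, exists a, has_dir x (int_row u) a) /\
  (forall u v a b, has_dir x (int_row u) a -> has_dir x (int_row v) b ->
     has_dir x (int_row (u + v)) (a + b)).

Lemma near_dirW u a k i j : (i <= j)%N -> near_dir u a k i `<=` near_dir u a k j.
Proof.
move=> ij x h t tj; apply: h; apply: lt_le_trans tj _.
by rewrite lef_pV2 ?posrE ?ltr0n // ler_nat.
Qed.

Lemma good_pointP x :
  (forall u, dir_set (int_row u) x) ->
  (forall u v (a b c : 'rV[rat]_m) k j,
     ~ nonadditive_set (int_row u) (int_row v) (map_mx ratr a) (map_mx ratr b) (map_mx ratr c) k j x) ->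
  good_point x.
Proof.
move=> h1 h2; split; first by move=> u; exact: dir_set_has_dir.
move=> u v a b xa xb.
have [c xc] := dir_set_has_dir (h1 (u + v)).
suff -> : a + b = c by [].
apply/eqP; rewrite -subr_eq0 -normr_le0 leNgt; apply/negP => abc.
(* Each of the three slopes is within 2/(k+1) of its rational approximation. Of the gap, larger than
   12/(k+1), more than 6/(k+1) remains, and 3/(k+1) is required. *)
have [k kP] := exists_natSinv_lt (divr_gt0 abc (ltr0n _ 12)).
have [a' [i1 i1P]] := has_dir_dir_set xa k.
have [b' [i2 i2P]] := has_dir_dir_set xb k.
have [c' [i3 i3P]] := has_dir_dir_set xc k.
have [j1 j1P] := has_dir_near xa k; have [j2 j2P] := has_dir_near xb k.
have [j3 j3P] := has_dir_near xc k.
pose j := (i1 + i2 + i3)%N.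
apply: (h2 u v a' b' c' k j); split.
- have d1 := near_dir_dist i1P j1P; have d2 := near_dir_dist i2P j2P.
  have d3 := near_dir_dist i3P j3P.
  have : `|a + b - c| <= `|map_mx ratr c' - map_mx ratr a' - map_mx ratr b'| +
     (`|map_mx ratr a' - a| + `|map_mx ratr b' - b| + `|map_mx ratr c' - c|).
    rewrite -[leLHS]normrN -[X in _ <= _ + (_ + X)]normrN.
    apply: le_trans (lerD (lexx _) (lerD (ler_normD _ _) (lexx _))).
    apply: le_trans (lerD (lexx _) (ler_normD _ _)); apply: le_trans (ler_normD _ _).
    rewrite le_eqVlt; apply/orP; left; apply/eqP; congr (`|_|).
    move: (map_mx _ a') (map_mx _ b') (map_mx _ c') => A B C; vring.
  move: (k.+1%:R^-1) kP d1 d2 d3 => *; lra.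
- by apply: near_dirW i1P; rewrite /j -addnA leq_addr.
- by apply: near_dirW i2P; rewrite /j addnAC leq_addl.
- by rewrite -int_rowD; apply: near_dirW i3P; rewrite /j leq_addl.
Qed.

End Rademacher.

Section Dot.
Variables (R : realType) (n : nat).
Implicit Types u v w : 'rV[R]_n.

(** The Euclidean product serves for projections and minimisation, while the norm of a row is the
    maximum norm. The comparison [dot_le] costs a factor [n]. *)
Definition dot u v : R := (u *m v^T) ord0 ord0.

Lemma dotE u v : dot u v = \sum_i u ord0 i * v ord0 i.
Proof. by rewrite /dot mxE; apply: eq_bigr => i _; rewrite mxE. Qed.

Lemma dotC u v : dot u v = dot v u.
Proof. by rewrite !dotE; apply: eq_bigr => i _; rewrite mulrC. Qed.

Lemma dotDl u v w : dot (u + v) w = dot u w + dot v w.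
Proof. by rewrite /dot mulmxDl mxE. Qed.

Lemma dotZl a u v : dot (a *: u) v = a * dot u v.
Proof. by rewrite /dot -scalemxAl mxE. Qed.

Lemma dotDr u v w : dot u (v + w) = dot u v + dot u w.
Proof. by rewrite dotC dotDl !(dotC u). Qed.

Lemma dotZr a u v : dot u (a *: v) = a * dot u v.
Proof. by rewrite dotC dotZl dotC. Qed.

Lemma dotNl u v : dot (- u) v = - dot u v.
Proof. by rewrite -scaleN1r dotZl mulN1r. Qed.

Lemma dotNr u v : dot u (- v) = - dot u v.
Proof. by rewrite -scaleN1r dotZr mulN1r. Qed.

Lemma dotBl u v w : dot (u - v) w = dot u w - dot v w.
Proof. by rewrite dotDl dotNl. Qed.

Lemma dotBr u v w : dot u (v - w) = dot u v - dot u w.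
Proof. by rewrite dotDr dotNr. Qed.

Lemma dot_ge0 u : 0 <= dot u u.
Proof. by rewrite dotE; apply: sumr_ge0 => i _; rewrite -expr2 sqr_ge0. Qed.

Lemma norm_sqr_le_dot u : `|u| ^+ 2 <= dot u u.
Proof.
have h i : `|u ord0 i| <= Num.sqrt (dot u u).
  rewrite -sqrtr_sqr ler_wsqrtr // dotE (bigD1 i) //= -expr2 lerDl.
  by apply: sumr_ge0 => j _; rewrite -expr2 sqr_ge0.
rewrite -[leRHS]sqr_sqrtr ?dot_ge0 // ler_pXn2r ?nnegrE // ?sqrtr_ge0 //.
by apply: mx_norm_le => [|i0 i]; rewrite ?sqrtr_ge0 // (ord1 i0).
Qed.

Lemma dot_le u v : `|dot u v| <= n%:R * `|u| * `|v|.
Proof.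
rewrite dotE; apply: le_trans (ler_norm_sum _ _ _) _.
rewrite -mulrA -[n in n%:R]card_ord -sumr_const mulr_suml.
by apply: ler_sum => i _; rewrite mul1r normrM ler_pM // ler_coord_norm.
Qed.

End Dot.

Section RademacherMeasure.
Variables (R : realType) (n m : nat) (F : 'rV[R]_n -> 'rV[R]_m) (K : R).
Hypothesis K0 : 0 <= K.
Hypothesis FK : forall x y, `|F x - F y| <= K * `|x - y|.

(** Derivatives in integer directions are given by one matrix [A]. A small [h] is rounded to
    [t *: W] with [W] an integer row of bounded size and [t] equal to [|h|] divided by k+1. Finitely
    many rows [W] occur, so the directional estimates hold uniformly, and the Lipschitz condition
    pays for the rounding error, which is at most [t]. *)
Lemma good_point_differentiable x : good_point F x -> differentiable F x.
Proof.
move=> [g1 g2].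
have [a aP] := choice (fun i : 'I_n => g1 (delta_mx ord0 i)).
have dE i : int_row R (delta_mx ord0 i) = delta_mx ord0 i :> 'rV[R]_n.
  by rewrite /int_row map_delta_mx.
pose A := \matrix_i a i.
have lin u : has_dir F x (int_row R u) (int_row R u *m A).
  rewrite mulmx_sum_row {1}(row_sum_delta u).
  elim: (index_enum _) => [|i r IH].
    rewrite !big_nil => e e0; apply/nbhs_ballP; exists 1 => //= t _.
    rewrite (_ : int_row R 0 = 0); last by apply/rowP => j; rewrite !mxE.
    by rewrite !scaler0 addr0 subrr subr0 normr0 mulr_ge0 // ltW.
  rewrite !big_cons addrC [X in has_dir _ _ _ X]addrC; apply: g2 => //.
  rewrite rowK [int_row R u ord0 i]mxE.
  rewrite (_ : int_row _ _ = (u ord0 i)%:~R *: delta_mx ord0 i).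
    by apply: has_dirZ; rewrite -dE.
  by rewrite -dE; apply/rowP => j; rewrite !mxE intrM.
apply: (@linear_approx_differentiable _ _ _ _ _ A _).1 => e e0.
(* The three terms bound, in units of [t], the rounding of [h] under [F], the rounding under [A],
   and the error of the directional derivative. *)
pose C := K + n%:R * `|A| + 1.
have C0 : 0 < C by rewrite ltr_wpDl // addr_ge0 // mulr_ge0.
have [k ke] := exists_natSinv_lt (divr_gt0 e0 C0).
(* An enumeration by a finite type of the integer rows with coordinates between -(k+1) and k+1. *)
pose w (f : {ffun 'I_n -> 'I_(2 * k.+1).+1}) : 'rV[int]_n := \row_i ((f i)%:Z - k.+1%:Z).
pose P f (t : R) := `|F (x + t *: int_row R (w f)) - F x - t *: (int_row R (w f) *m A)| <= 1 * `|t|.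
have /nbhs_ballP[d /= d0 dP] : \forall t \near nbhs (0 : R), forall f, P f t.
  by apply: (@filter_forall _ _ P) => f; exact: (lin (w f) 1 ltr01).
apply/nbhs_ballP; exists d => // h /mx_ballP; rewrite subr0 => hd.
have [->|h0] := eqVneq h 0.
  by rewrite mul0mx addr0 subrr subr0 normr0 mulr_ge0 // ltW.
pose t := `|h| / k.+1%:R.
have r0 : 0 < `|h| by rewrite normr_gt0.
have t0 : 0 < t by rewrite divr_gt0.
have tk : t * k.+1%:R = `|h| by rewrite /t divfK // pnatr_eq0.
have td : ball (0 : R) d t.
  rewrite /ball /= sub0r normrN gtr0_norm //; apply: le_lt_trans hd.
  by rewrite ler_pdivrMr ?ltr0n // ler_peMr // ler1n.
have [f fP] : exists f, forall i, (w f) ord0 i = Num.floor (h ord0 i / t).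
  have hi i : (- k.+1%:Z <= Num.floor (h ord0 i / t) <= k.+1%:Z)%R.
    have : `|h ord0 i / t| <= k.+1%:R.
      rewrite normrM [`|t^-1|]gtr0_norm ?invr_gt0 // ler_pdivrMr // mulrC tk.
      exact: ler_coord_norm.
    rewrite ler_norml => /andP[h1 h2]; apply/andP; split.
      by rewrite floor_ge_int intrN.
    by rewrite -(@ler_int R); apply: le_trans (floor_le_tmp _) h2.
  have lt i : (absz (Num.floor (h ord0 i / t) + k.+1%:Z)%R < (2 * k.+1).+1)%N.
    by have := hi i; move: (Num.floor _) => z zk; lia.
  exists [ffun i => Ordinal (lt i)] => i; rewrite mxE ffunE /=.
  by have := hi i; move: (Num.floor _) => z zk; lia.
set W := int_row R (w f).
have hW : `|h - t *: W| <= t.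
  apply: mx_norm_le => [|i0 i]; first exact: ltW.
  have := fP i; rewrite mxE => fPi; rewrite (ord1 i0) !mxE fPi.
  have /andP[h1 h2] := floor_itv (h ord0 i / t).
  move: h1 h2; rewrite intrD ler_pdivlMr // ltr_pdivrMr //.
  move: (_%:~R) => z h1 h2; rewrite ler_norml; apply/andP; split; nra.
rewrite (_ : F (x + h) - _ - _ = (F (x + h) - F (x + t *: W)) +
   (F (x + t *: W) - F x - t *: (W *m A)) + (t *: W - h) *m A); last first.
  by rewrite mulmxBl -scalemxAl; move: (W *m A) (h *m A) => X Y; vring.
have h1 : `|F (x + h) - F (x + t *: W)| <= K * t.
  apply: le_trans (FK _ _) _; rewrite opprD addrACA subrr add0r.
  exact: ler_wpM2l.
have h2 := dP t td f; rewrite /P -/W mul1r gtr0_norm // in h2.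
have h3 : `|(t *: W - h) *m A| <= n%:R * `|A| * t.
  apply: le_trans (mulmx_norm_le _ _) _; rewrite distrC.
  by apply: ler_wpM2l => //; rewrite mulr_ge0.
apply: (@le_trans _ _ (C * t)).
  apply: le_trans (ler_normD _ _) _; apply: le_trans (lerD (ler_normD _ _) (lexx _)) _.
  by rewrite /C; move: (n%:R * `|A|) h3 => N; nra.
rewrite /t mulrCA mulrC ler_wpM2r // -ler_pdivlMl // mulrC; exact: ltW.
Qed.

End RademacherMeasure.

Lemma negligible_bigcup_count (R : realType) (d : measure_display) (T : measurableType d)
    (mu : {measure set T -> \bar R}) (I : countType) (E : I -> set T) :
  (forall i, mu.-negligible (E i)) -> mu.-negligible (\bigcup_i E i).
Proof.
move=> h; pose G k := if unpickle k is Some i then E i else set0.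
apply: negligibleS (_ : mu.-negligible (\bigcup_k G k)).
  by move=> x [i _ Ex]; exists (pickle i) => //; rewrite /G pickleK.
by apply: negligible_bigcup => k; rewrite /G; case: unpickle => // *; exact: negligible_set0.
Qed.

Lemma measurable_bigcup_count (d : measure_display) (T : measurableType d)
    (I : countType) (E : I -> set T) :
  (forall i, measurable (E i)) -> measurable (\bigcup_i E i).
Proof.
move=> h; pose G k := if unpickle k is Some i then E i else set0.
rewrite (_ : \bigcup_i E i = \bigcup_k G k).
  by apply: bigcupT_measurable => k; rewrite /G; case: unpickle.
apply/seteqP; split => [x [i _ Ex]|x [k _]].
  by exists (pickle i) => //; rewrite /G pickleK.
by rewrite /G; case: unpickle => // i Ei; exists i.
Qed.

Section RademacherNull.
Variables (R : realType) (n m : nat) (F : 'rV[R]_n -> 'rV[R]_m) (K : R).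
Hypothesis K0 : 0 <= K.
Hypothesis FK : forall x y, `|F x - F y| <= K * `|x - y|.
Context (d : measure_display)
    (T : measurableType d) (mu : {sigma_finite_measure set T -> \bar R})
    (phi : T -> 'rV[R]_n) (psi : 'rV[R]_n -> T).
Hypothesis H : euclidean_measure mu phi psi.

Lemma measurable_dir_set u : measurable (phi @^-1` dir_set F u).
Proof.
rewrite (_ : _ @^-1` _ = \bigcap_k \bigcup_(aj : 'rV[rat]_m * nat)
    (phi @^-1` near_dir F u (map_mx ratr aj.1) k aj.2)).
  apply: bigcapT_measurable => k; apply: measurable_bigcup_count => -[a j] /=.
  by apply: (measurable_preimage_closed H); exact: (closed_near_dir K0 FK).
apply/seteqP; split => x /= h k.
  by move=> _; have [a [j xj]] := h k; exists (a, j).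
by have [[a j] _ xj] := h k I; exists a, j.
Qed.

(** Along the line each coordinate of [F] is a Lipschitz function of one variable, to which [lip_ae]
    applies. That lemma concerns ]0, 1[, so the two ends are added to the null set. *)
Lemma line_set_dir_set_negligible u x :
  (@lebesgue_measure R).-negligible (line_set (~` dir_set F u) u x).
Proof.
have lip i s t : `|F (x + s *: u) ord0 i - F (x + t *: u) ord0 i| <= K * `|u| * `|s - t|.
  have -> : F (x + s *: u) ord0 i - F (x + t *: u) ord0 i = (F (x + s *: u) - F (x + t *: u)) ord0 i.
    by rewrite !mxE.
  apply: le_trans (ler_coord_norm _ _ _) _; apply: le_trans (FK _ _) _.
  by rewrite opprD addrACA subrr add0r -scalerBl normrZ -mulrA [_ * `|u|]mulrC.
have Ku : 0 <= K * `|u| by rewrite mulr_ge0.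
have N1 (r : R) : (@lebesgue_measure R).-negligible [set r].
  by apply/negligibleP => //; exact: lebesgue_measure_set1.
apply: negligibleS (negligibleU (N1 0) (negligibleU (N1 1)
  (negligible_bigcup_count (fun i => lip_ae Ku (lip i))))).
move=> t [/=]; rewrite in_itv /= => /andP[t0 t1] nd.
have [->|t0'] := eqVneq t 0; first by left.
have [->|t1'] := eqVneq t 1; first by right; left.
right; right; apply: contrapT => h; apply: nd.
have [a /has_dir_dir_set] : exists a, has_dir F (x + t *: u) u a; last by [].
apply: has_dir_line => i; apply: contrapT => nd; apply: h; exists i => //; split => //.
by rewrite !lt_neqAle t0 t1 t1' eq_sym t0'.
Qed.

Lemma dir_set_null u : mu (phi @^-1` ~` dir_set F u) = 0%E.
Proof.
have mE : measurable (phi @^-1` ~` dir_set F u).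
  by rewrite -preimage_setC; apply/measurableC/measurable_dir_set.
apply: (line_null_null H (u := u) mE) => x; apply/negligibleP.
  by have [pK _ _ _ _] := H; rewrite -(pK x); exact: (measurable_line_set H).
exact: line_set_dir_set_negligible.
Qed.

(** By [nonadditive_separated] the set meets each segment of direction [u] in a countable set of
    parameters. *)
Lemma nonadditive_set_null u v a b c k j :
  mu (phi @^-1` nonadditive_set F u v a b c k j) = 0%E.
Proof.
have mE : measurable (phi @^-1` nonadditive_set F u v a b c k j).
  by apply: (measurable_preimage_closed H); exact: (closed_nonadditive_set K0 FK).
apply: (line_null_null H (u := u) mE) => x; apply: countable_lebesgue_measure0.
apply: (@separated_countable _ _ j.+1%:R^-1); first by rewrite invr_gt0.
move=> s t [_ xs] [_ xt] st; apply/eqP; rewrite -subr_eq0; apply/eqP.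
apply: (nonadditive_separated xt) => //.
by rewrite scalerBl [_ *: u - _]addrC addrA addrK.
Qed.

Lemma bad_point_negligible : mu.-negligible (phi @^-1` ~` good_point F).
Proof.
have N1 (u : 'rV[int]_n) : mu.-negligible (phi @^-1` ~` dir_set F (int_row R u)).
  apply/negligibleP; last exact: dir_set_null.
  by rewrite -preimage_setC; apply/measurableC/measurable_dir_set.
pose E (p : 'rV[int]_n * 'rV[int]_n * ('rV[rat]_m * 'rV[rat]_m * 'rV[rat]_m) * (nat * nat)) :=
  nonadditive_set F (int_row R p.1.1.1) (int_row R p.1.1.2) (map_mx ratr p.1.2.1.1)
    (map_mx ratr p.1.2.1.2) (map_mx ratr p.1.2.2) p.2.1 p.2.2.
have N2 p : mu.-negligible (phi @^-1` E p).
  apply/negligibleP; last exact: nonadditive_set_null.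
  by apply: (measurable_preimage_closed H); exact: (closed_nonadditive_set K0 FK).
apply: negligibleS (negligibleU (negligible_bigcup_count N1) (negligible_bigcup_count N2)).
move=> x /= nx; apply: contrapT => h; apply: nx; apply: good_pointP => [u|u v a b c k j xE].
  by apply: contrapT => nd; apply: h; left; exists u.
by apply: h; right; exists (u, v, (a, b, c), (k, j)).
Qed.

End RademacherNull.

Lemma derive1_unique (R : realType) (g : R -> R) (t l : R) : derivable g t 1 ->
  (forall e, 0 < e -> \forall s \near (0 : R), `|g (t + s) - g t - s * l| <= e * `|s|) ->
  derive1 g t = l.
Proof.
move=> dg h; apply/eqP; rewrite -subr_eq0 -normr_le0; apply/ler_addgt0Pr => e e0.
have e2 : 0 < e / 2 by rewrite divr_gt0.
have /nbhs_ballP[d1 /= d10 h1] := derivable1_near dg e2.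
have /nbhs_ballP[d2 /= d20 h2] := h _ e2.
pose s := Num.min d1 d2 / 2.
have s0 : 0 < s by rewrite divr_gt0 // lt_min d10.
have sb r : Num.min d1 d2 <= r -> ball (0 : R) r s.
  move=> hr; rewrite /ball /= sub0r normrN gtr0_norm //; apply: lt_le_trans hr.
  by move: s0; rewrite /s; lra.
have sb1 : ball (0 : R) d1 s by apply: sb; rewrite ge_min lexx.
have sb2 : ball (0 : R) d2 s by apply: sb; rewrite ge_min lexx orbT.
have := h1 s sb1; have := h2 s sb2.
rewrite (gtr0_norm s0) => k1 k2; rewrite add0r -(ler_pM2r s0).
rewrite -{1}(gtr0_norm s0) -normrM (_ : _ * s = (g (t + s) - g t - s * l) - (g (t + s) - g t - s * derive1 g t)); last by ring.
by apply: le_trans (ler_normB _ _) _; move: k1 k2; lra.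
Qed.

(** The segment from [y] to [y + w] may consist of bad points. A parallel segment starting nearby
    meets them only in a null set of parameters, and [lip_mean] applies there to the component of
    [F] along [e]. *)
Theorem lipschitz_mean_value (R : realType) (n m : nat) (F : 'rV[R]_n -> 'rV[R]_m) (K : R)
    (e : 'rV[R]_m) (y w : 'rV[R]_n) (delta eta : R) :
  0 <= K -> (forall x y, `|F x - F y| <= K * `|x - y|) -> 0 < delta -> 0 < eta ->
  exists q t, [/\ 0 <= t <= 1, `|q - (y + t *: w)| < delta, differentiable F q &
     dot e (F (y + w) - F y) - eta <= dot e (w *m jacobian F q)].
Proof.
move=> K0 FK delta0 eta0.
have [d [T [mu [phi [psi H]]]]] := exists_euclidean_measure R n.
have [B [mB B0 hB]] := bad_point_negligible K0 FK H.
pose C := m%:R * `|e| * K; have C0 : 0 <= C by rewrite !mulr_ge0.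
have C1 : 0 < 2 * C + 1 by rewrite ltr_wpDl // mulr_ge0.
(* A displacement of the segment smaller than [r] changes the increment of [dot e (F _)] by at most
   [eta / 2]. The other half of [eta] is spent in [lip_mean]. *)
pose r := Num.min delta (eta / 2 / (2 * C + 1)).
have r0 : 0 < r by rewrite lt_min delta0 !divr_gt0.
have [pK _ psim _ _] := H.
pose E := [set x | B (psi x)].
(* The composite of [phi] followed by [psi] is the translation by 0 of [T], so it preserves the
   measure. *)
have EE : phi @^-1` E = (fun x => psi (phi x + 0)) @^-1` B.
  by apply/seteqP; split => x; rewrite /E /= addr0.
have [_ phim _ shift _] := H.
have mE : measurable (phi @^-1` E).
  rewrite EE -[X in measurable X]setTI; apply: (psim _ _ (fun x => phi x + 0)) => // i.
  by rewrite (_ : (fun x => _) = (fun x => phi x ord0 i)) //; apply/funext => x; rewrite addr0.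
have E0 : mu (phi @^-1` E) = 0%E by rewrite EE shift.
have goodE q : ~ E q -> good_point F q.
  by move=> nq; apply: contrapT => ng; apply: nq; apply: hB; rewrite /= pK.
have [x [xy x0]] := null_line_null H w mE y r0 E0.
have := xy; rewrite lt_min => /andP[xyd xye].
pose g (t : R) := dot e (F (x + t *: w)).
have eF u v : `|dot e (F u) - dot e (F v)| <= C * `|u - v|.
  rewrite -dotBr; apply: le_trans (dot_le _ _) _; rewrite /C -[_ * K * _]mulrA.
  by apply: ler_wpM2l => //; rewrite mulr_ge0.
have gL s t : `|g s - g t| <= C * `|w| * `|s - t|.
  apply: le_trans (eF _ _) _.
  by rewrite opprD addrACA subrr add0r -scalerBl normrZ -mulrA [_ * `|w|]mulrC.
have Cw : 0 <= C * `|w| by rewrite mulr_ge0.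
have N : (@lebesgue_measure R).-negligible (line_set E w x).
  by apply/negligibleP => //; rewrite -(pK x); exact: (measurable_line_set H).
have [t [t01 nEt dg gt]] := lip_mean Cw gL (divr_gt0 eta0 (ltr0n _ 2)) N.
have /andP[t0 t1] := t01.
have Gq : good_point F (x + t *: w).
  apply: goodE => Eq; apply: nEt; split => //=.
  by rewrite in_itv /= !ltW.
have dF := good_point_differentiable K0 FK Gq.
exists (x + t *: w), t; split => //.
- by rewrite !ltW.
- by rewrite opprD addrACA subrr addr0.
have <- : derive1 g t = dot e (w *m jacobian F (x + t *: w)).
  apply: derive1_unique dg _ => e1 e10.
  pose D := m%:R * `|e| * `|w| + 1.
  have D0 : 0 < D by rewrite ltr_wpDl // !mulr_ge0.
  have /nbhs_ballP[d1 /= d10 h] := differentiable_linear_approx dF (divr_gt0 e10 D0).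
  have w1 : 0 < `|w| + 1 by rewrite ltr_wpDl.
  apply/nbhs_ballP; exists (d1 / (`|w| + 1)); first by rewrite /= divr_gt0.
  move=> s; rewrite /ball /= sub0r normrN ltr_pdivlMr // => sd.
  have : ball 0 d1 (s *: w).
    apply/mx_ballP; rewrite subr0 normrZ; apply: le_lt_trans sd.
    by rewrite ler_wpM2l // lerDl.
  move/h; rewrite -scalemxAl -[x + _ + _]addrA -scalerDl => h1.
  rewrite /g -dotZr -!dotBr; apply: le_trans (dot_le _ _) _.
  apply: le_trans (ler_wpM2l _ h1) _; first by rewrite mulr_ge0.
  rewrite normrZ; have := normr_ge0 s.
  rewrite (_ : _ * (_ * _) = (m%:R * `|e| * `|w| / D) * (e1 * `|s|)); last by ring.
  move=> s0; apply: ler_piMl; first by rewrite mulr_ge0 // ltW.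
  by rewrite ler_pdivrMr // mul1r lerDl.
apply: le_trans gt.
have := eF (x + w) (y + w); have := eF y x.
rewrite opprD addrACA subrr addr0 [`|y - x|]distrC /g !scale1r scale0r addr0 dotBr.
have h1 : 2 * (C * `|x - y|) <= eta / 2.
  rewrite mulrA; apply: le_trans (_ : (2 * C + 1) * `|x - y| <= _).
    by rewrite ler_wpM2r // lerDl.
  by rewrite -ler_pdivlMl // mulrC ltW.
rewrite !ler_norml => /andP[? ?] /andP[? ?]; lra.
Qed.

(** * Clarke's generalized differential *)

Lemma convex_comb_le (R : realDomainType) (t a b c : R) :
  0 <= t <= 1 -> a <= c -> b <= c -> t * a + (1 - t) * b <= c.
Proof.
move=> /andP[t0 t1] ac bc.
have h1 : 0 <= t * (c - a) by rewrite mulr_ge0 // subr_ge0.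
have h2 : 0 <= (1 - t) * (c - b) by rewrite mulr_ge0 // subr_ge0.
lra.
Qed.

Lemma convex_comb_lt (R : realDomainType) (t a b c : R) :
  0 <= t <= 1 -> a < c -> b < c -> t * a + (1 - t) * b < c.
Proof.
move=> t01 ac bc; apply: le_lt_trans (_ : Num.max a b < c); last by rewrite gt_max ac.
by apply: convex_comb_le => //; rewrite le_max lexx ?orbT.
Qed.

Section Convex.
Variables (R : realType) (m n : nat).
Implicit Types A : set 'M[R]_(m, n).

Definition segment_closed A := forall x y t, A x -> A y -> 0 <= t <= 1 ->
  A (t *: x + (1 - t) *: y).

Lemma convex_setP A : @convex_set R 'M[R]_(m, n) A <-> segment_closed A.
Proof.
split=> [cA x y t Ax Ay /andP[t0 t1]|cA x y t]; last first.
  by rewrite !inE => Ax Ay; apply: cA => //; apply/andP; split.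
by have := cA x y (Itv01 t0 t1); rewrite !inE; exact.
Qed.

Lemma segment_closed_closure A : segment_closed A -> segment_closed (closure A).
Proof.
move=> cA x y t clx cly t01; have /andP[t0 t1] := t01.
move=> B /nbhs_ballP[e /= e0 eB].
have [x' [Ax' /mx_ballP xx']] := clx _ (nbhsx_ballx x e e0).
have [y' [Ay' /mx_ballP yy']] := cly _ (nbhsx_ballx y e e0).
exists (t *: x' + (1 - t) *: y'); split; first exact: cA.
apply/eB/mx_ballP.
rewrite (_ : _ - _ = t *: (x' - x) + (1 - t) *: (y' - y)); last by vring.
apply: le_lt_trans (ler_normD _ _) _.
rewrite !normrZ (ger0_norm t0) (@ger0_norm _ (1 - t)) ?subr_ge0 //.
exact: convex_comb_lt.
Qed.

Lemma smallest_segment_closed A : segment_closed (smallest (@convex_set R 'M[R]_(m, n)) A).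
Proof.
move=> x y t hx hy t01 B [cB AB].
by have /convex_setP := cB; apply => //; [apply: hx|apply: hy].
Qed.

Lemma closed_ball_compact (r : R) : compact [set A : 'M[R]_(m, n) | `|A| <= r].
Proof.
have cv : continuous (vec_mx : 'rV[R]_(m * n) -> 'M[R]_(m, n)).
  apply: (@lipschitz_cont _ _ _ _ 1) => // x y; rewrite mul1r -linearB.
  by apply: mx_norm_le => // i j; rewrite mxE; exact: ler_coord_norm.
rewrite (_ : mkset _ = vec_mx @` [set v : 'rV[R]_(m * n) | `|v| <= r]).
  apply: continuous_compact; first by apply: continuous_subspaceT => x; exact: cv.
  apply: bounded_closed_compact.
    by exists r; split; [exact: num_real|move=> M rM v /= h; rewrite (le_trans h) // ltW].
  apply: (@preimage_closed _ _ _ [set s : R | s <= r]); last exact: closed_le.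
  by move=> x _; exact: norm_continuous.
apply/seteqP; split => [A /= Ar|_ [v /= vr <-]].
  exists (mxvec A); last exact: mxvecK.
  rewrite /=; have r0 : 0 <= r by exact: le_trans Ar.
  apply: mx_norm_le => // i0 k; rewrite (ord1 i0).
  case/mxvec_indexP: k => i j; rewrite mxvecE.
  exact: le_trans (ler_coord_norm _ _ _) Ar.
have r0 : 0 <= r by exact: le_trans vr.
by apply: mx_norm_le => // i j; rewrite mxE; exact: le_trans (ler_coord_norm _ _ _) vr.
Qed.

End Convex.

Variant clamp_spec (R : realDomainType) (a b x : R) : R -> Prop :=
  | ClampLow of x <= a : clamp_spec a b x a
  | ClampIn of a <= x <= b : clamp_spec a b x x
  | ClampHigh of b <= x : clamp_spec a b x b.

Lemma clampP (R : realDomainType) (a b x : R) : a <= b ->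
  clamp_spec a b x (Num.max a (Num.min b x)).
Proof.
move=> ab; have [bx|xb] := leP b x.
  by have [_|/(le_lt_trans ab)] := leP a b; [exact: ClampHigh|rewrite ltxx].
have [ax|xa] := leP a x; first by apply: ClampIn; rewrite ax ltW.
by apply: ClampLow; exact: ltW.
Qed.

Lemma clamp_dist (R : realDomainType) (a b x y : R) : a <= b ->
  `|Num.max a (Num.min b x) - Num.max a (Num.min b y)| <= `|x - y|.
Proof.
move=> ab; have /andP[] : - `|x - y| <= x - y <= `|x - y| by rewrite -ler_norml.
move: (`|x - y|) => d h1 h2.
rewrite ler_norml.
by case: (clampP x ab) => [?|/andP[? ?]|?]; case: (clampP y ab) => [?|/andP[? ?]|?];
  apply/andP; split; lra.
Qed.

Section ClarkeEuclidean.
Variables (R : realType) (m n : nat) (F : 'rV[R]_m -> 'rV[R]_n) (p : 'rV[R]_m) (r K : R).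
Hypothesis r0 : 0 < r.
Hypothesis K0 : 0 <= K.
Hypothesis FK : forall x y, `|x - p| < r -> `|y - p| < r -> `|F x - F y| <= K * `|x - y|.

Lemma jacobian_le q : `|q - p| < r -> differentiable F q -> `|jacobian F q| <= K.
Proof.
move=> qr dF; apply: mx_norm_le => // i j.
have := ler_coord_norm (row i (jacobian F q)) ord0 j.
rewrite mxE => /le_trans; apply.
rewrite rowE; set w := delta_mx _ i.
have w1 : `|w| <= 1.
  by apply: mx_norm_le => // i0 k; rewrite mxE; case: (_ && _); rewrite ?normr1 ?normr0.
apply/ler_addgt0Pr => e e0.
have /nbhs_ballP[d /= d0 h] := differentiable_linear_approx dF e0.
pose t := Num.min d (r - `|q - p|) / 2.
have t0 : 0 < t by rewrite divr_gt0 // lt_min d0 subr_gt0.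
have [td tr] : t < d /\ t < r - `|q - p|.
  have : t < Num.min d (r - `|q - p|) by move: t0; rewrite /t; lra.
  by rewrite lt_min => /andP.
have tw : `|t *: w| <= t by rewrite normrZ gtr0_norm // ger_pMr.
have h1 := h (t *: w) ltac:(by apply/mx_ballP; rewrite subr0 (le_lt_trans tw)).
have h2 : `|F (q + t *: w) - F q| <= K * t.
  apply: le_trans (FK _ qr) _; last by rewrite addrC addKr ler_wpM2l.
  rewrite addrAC; apply: le_lt_trans (ler_normD _ _) _; move: tw tr; lra.
rewrite -(ler_pM2l t0) -{1}(gtr0_norm t0) -normrZ scalemxAl.
rewrite -(subKr (F (q + t *: w) - F q) (t *: w *m jacobian F q)).
apply: le_trans (ler_normB _ _) _; rewrite mulrDr mulrC lerD //.
by apply: le_trans h1 _; rewrite mulrC ler_wpM2r // ltW.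
Qed.

Lemma clarke_limits_le A : clarke_limits F p A -> `|A| <= K.
Proof.
move=> [u [up du JA]]; apply/ler_addgt0Pr => e e0.
have /cvgrPdist_lt /(_ e e0) hA := JA.
have /cvgrPdist_lt /(_ r r0) hp := up.
near \oo => k.
have h1 : `|A - jacobian F (u k)| < e by near: k.
have h2 : `|p - u k| < r by near: k.
rewrite -(subrK (jacobian F (u k)) A) addrC; apply: le_trans (ler_normD _ _) _.
apply: lerD; last exact: ltW.
by apply: jacobian_le => //; rewrite distrC.
Unshelve. all: end_near. Qed.

(** The closure yields a compact convex set at once, and the lower bounds given by the co-norm pass
    to it by continuity. *)
Definition clarke_hull : set 'M[R]_(m, n) := closure (clarke_euclidean F p).

Lemma clarke_limits_hull A : clarke_limits F p A -> clarke_hull A.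
Proof. by move=> h; apply: subset_closure; exact: sub_gen_smallest. Qed.

Lemma clarke_hull_convex : segment_closed clarke_hull.
Proof. by apply: segment_closed_closure; exact: smallest_segment_closed. Qed.

Lemma clarke_hull_le A : clarke_hull A -> `|A| <= K.
Proof.
suff H : clarke_hull `<=` [set A | `|A| <= K] by move=> /H.
have cl : closed [set A : 'M[R]_(m, n) | `|A| <= K].
  apply: (@preimage_closed _ _ _ [set s : R | s <= K]); last exact: closed_le.
  by move=> x _; exact: norm_continuous.
rewrite /clarke_hull closureE; apply: smallest_sub => //; apply: smallest_sub; last exact: clarke_limits_le.
apply/convex_setP => x y t /= xK yK /andP[t0 t1].
apply: le_trans (ler_normD _ _) _.
rewrite !normrZ (ger0_norm t0) (@ger0_norm _ (1 - t)) ?subr_ge0 //.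
by apply: convex_comb_le => //; apply/andP.
Qed.

Lemma clarke_hull_compact : compact clarke_hull.
Proof.
apply: (subclosed_compact _ (closed_ball_compact (r := K))).
  exact: closed_closure.
by move=> A; exact: clarke_hull_le.
Qed.

(** The 1-Lipschitz retraction on the cube of radius [r / 2] about [p]. Composed with it, [F]
    becomes Lipschitz on the whole space, as [lipschitz_mean_value] requires, and is unchanged on
    the cube. *)
Let clamp (x : 'rV[R]_m) : 'rV[R]_m :=
  \row_i Num.max (p ord0 i - r / 2) (Num.min (p ord0 i + r / 2) (x ord0 i)).

Let clamp_in x : `|clamp x - p| < r.
Proof.
apply: le_lt_trans (_ : r / 2 < r); last by move: r0; lra.
apply: mx_norm_le => [|i0 i]; first by rewrite divr_ge0 // ltW.
rewrite (ord1 i0) !mxE ler_norml; have r2 : 0 < r / 2 by rewrite divr_gt0.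
case: clampP => [|?|/andP[? ?]|?]; first lra; apply/andP; split; lra.
Qed.

Let clamp_id x : `|x - p| <= r / 2 -> clamp x = x.
Proof.
move=> xp; apply/rowP => i; rewrite mxE.
have := le_trans (ler_coord_norm (x - p) ord0 i) xp; rewrite !mxE ler_norml => /andP[h1 h2].
case: clampP => // [|?|?]; lra.
Qed.

Let clamp_lip x y : `|clamp x - clamp y| <= `|x - y|.
Proof.
apply: mx_norm_le => // i0 i; rewrite (ord1 i0) !mxE.
apply: le_trans (clamp_dist _ _ _) _; first by move: r0; lra.
by have := ler_coord_norm (x - y) ord0 i; rewrite !mxE.
Qed.

Lemma clarke_mean_value (e : 'rV[R]_n) (y w : 'rV[R]_m) (rho eta : R) :
  rho <= r / 2 -> 0 < eta -> `|y - p| < rho -> `|y + w - p| < rho ->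
  exists q, [/\ `|q - p| < rho, differentiable F q &
     dot e (F (y + w) - F y) - eta <= dot e (w *m jacobian F q)].
Proof.
move=> rr eta0 yr ywr.
(* By convexity the segment stays within [mx] of [p]. A point at distance less than [rho - mx] from
   it is still in the ball of radius [rho]. *)
pose mx := Num.max `|y - p| `|y + w - p|.
have mr : mx < rho by rewrite gt_max yr ywr.
have Fc a b : `|(F \o clamp) a - (F \o clamp) b| <= K * `|a - b|.
  by apply: le_trans (FK (clamp_in _) (clamp_in _)) _; rewrite ler_wpM2l.
have dpos : 0 < rho - mx by rewrite subr_gt0.
have [q [t [/andP[t0 t1] qd dq h]]] := lipschitz_mean_value e y w K0 Fc dpos eta0.
have qr : `|q - p| < rho.
  rewrite (_ : q - p = (q - (y + t *: w)) + ((1 - t) *: (y - p) + t *: (y + w - p))); last by vring.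
  apply: le_lt_trans (ler_normD _ _) _.
  apply: (@lt_le_trans _ _ (rho - mx + mx)); last by rewrite subrK.
  apply: ltr_leD => //; apply: le_trans (ler_normD _ _) _.
  rewrite !normrZ (ger0_norm t0) (@ger0_norm _ (1 - t)) ?subr_ge0 //.
  have a1 : `|y - p| <= mx by rewrite le_max lexx.
  have a2 : `|y + w - p| <= mx by rewrite le_max lexx orbT.
  by rewrite addrC; apply: convex_comb_le => //; apply/andP.
have qrr : `|q - p| < r / 2 by exact: lt_le_trans qr rr.
have E A : linear_approx (F \o clamp) q A -> linear_approx F q A.
  move=> hA e1 e10; have := hA e1 e10.
  have : \forall h \near (0 : 'rV[R]_m), `|h| < r / 2 - `|q - p|.
    apply/nbhs_ballP; exists (r / 2 - `|q - p|); first by rewrite /= subr_gt0.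
    by move=> z /mx_ballP; rewrite subr0.
  apply: filterS2 => z hz; rewrite /= !clamp_id //; first exact: ltW.
  rewrite addrAC; apply: le_trans (ler_normD _ _) _; move: hz; lra.
have [dF J] := linear_approx_differentiable (E _ (differentiable_linear_approx dq)).
have Fy z : `|z - p| < rho -> (F \o clamp) z = F z.
  move=> zr; have zr' : `|z - p| <= r / 2 by exact/ltW/(lt_le_trans zr).
  exact: (congr1 F (clamp_id zr')).
exists q; split; [exact: qr|exact: dF|].
by rewrite -(Fy _ yr) -(Fy _ ywr) J.
Qed.

(** Otherwise some sequence tends to [p] with jacobians at distance at least [e] from all the
    limits. The jacobians are bounded by [K], so a subsequence converges, and what it converges to
    is one of these limits. *)
Lemma clarke_near_limits (e : R) : 0 < e -> exists2 d, 0 < d &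
  forall q, `|q - p| < d -> differentiable F q ->
    exists2 A, clarke_limits F p A & `|jacobian F q - A| < e.
Proof.
move=> e0; apply: contrapT => nex.
have bad k : exists q, [/\ `|q - p| < Num.min r k.+1%:R^-1, differentiable F q &
    forall A, clarke_limits F p A -> e <= `|jacobian F q - A|].
  apply: contrapT => nq; apply: nex; exists (Num.min r k.+1%:R^-1).
    by rewrite lt_min r0 invr_gt0 ltr0n.
  move=> q qk dq; apply: contrapT => h; apply: nq; exists q; split => // A cA.
  by rewrite leNgt; apply/negP => lt; apply: h; exists A.
have [q qP] := choice bad.
have cB := closed_ball_compact (m := m) (n := n) (r := K).
have [|A [AK clA]] := cB ((fun k => jacobian F (q k)) @ \oo) _.
  exists 0%N => // k _ /=; have [qk dq _] := qP k; apply: jacobian_le => //.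
  by apply: lt_le_trans qk _; rewrite ge_min lexx.
have sub k : exists l, (k <= l)%N /\ `|jacobian F (q l) - A| < k.+1%:R^-1.
  have k0 : 0 < k.+1%:R^-1 :> R by rewrite invr_gt0.
  have [_ [[l kl <-] /mx_ballP hA]] := clA ((fun l => jacobian F (q l)) @` [set l | (k <= l)%N])
     (ball A k.+1%:R^-1) ltac:(by exists k => // l kl; exists l) (nbhsx_ballx A _ k0).
  by exists l.
have [s sP] := choice sub.
have cvg0 : forall (V : normedModType R) (u : nat -> V) (l : V),
    (forall k, `|u k - l| < k.+1%:R^-1) -> u @ \oo --> l.
  move=> V u l h; apply/cvgrPdist_lt => e1 e10; have [k ke] := exists_natSinv_lt e10.
  near=> j; rewrite distrC; apply: lt_trans (h j) _; apply: le_lt_trans ke.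
  rewrite lef_pV2 ?posrE ?ltr0n // ler_nat ltnS; near: j; exact: nbhs_infty_ge.
have limA : clarke_limits F p A.
  exists (q \o s); split.
  - apply: cvg0 => k /=; have [qk _ _] := qP (s k); apply: lt_le_trans qk _.
    rewrite ge_min; apply/orP; right.
    by rewrite lef_pV2 ?posrE ?ltr0n // ler_nat ltnS; case: (sP k).
  - by move=> k; case: (qP (s k)).
  - by apply: cvg0 => k /=; case: (sP k).
have [k ke] := exists_natSinv_lt e0.
have [_ _ /(_ _ limA)] := qP (s k); apply/negP; rewrite -ltNge.
by apply: lt_trans ke; case: (sP k).
Unshelve. all: end_near. Qed.

Lemma clarke_limits_nonempty : exists A, clarke_limits F p A.
Proof.
have [d d0 h] := clarke_near_limits ltr01.
pose rho := Num.min (r / 2) d.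
have rho0 : 0 < rho by rewrite lt_min divr_gt0.
have rr : rho <= r / 2 by rewrite ge_min lexx.
(* With [e] and the increment both zero, only the existence of a point of differentiability near [p]
   is extracted from the mean value inequality. *)
have [||q [qr dq _]] := @clarke_mean_value 0 p 0 rho 1 rr ltr01.
- by rewrite subrr normr0.
- by rewrite addr0 subrr normr0.
have [|A ? _] := h q _ dq; last by exists A.
by apply: lt_le_trans qr _; rewrite ge_min lexx orbT.
Qed.

End ClarkeEuclidean.

Lemma dot_addZ (R : realType) n (u v : 'rV[R]_n) t :
  dot (u + t *: v) (u + t *: v) = dot u u + 2 * t * dot u v + t ^+ 2 * dot v v.
Proof. by rewrite !(dotDl, dotDr, dotZl, dotZr) (dotC v u); ring. Qed.

Lemma eps_continuous_at (R : realType) (V W : normedModType R) (F : V -> W) x :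
  (forall e, 0 < e -> exists2 d, 0 < d & forall y, `|x - y| < d -> `|F x - F y| < e) ->
  {for x, continuous F}.
Proof.
move=> h; apply/cvgrPdist_lt => e e0; have [d d0 hd] := h e e0.
by apply/nbhs_ballP; exists d => // y; rewrite -ball_normE /= => /hd.
Qed.

Lemma eps_continuous (R : realType) (V W : normedModType R) (F : V -> W) :
  (forall x e, 0 < e -> exists2 d, 0 < d & forall y, `|x - y| < d -> `|F x - F y| < e) ->
  continuous F.
Proof. by move=> h x; apply: eps_continuous_at; exact: h. Qed.

Lemma lipschitz_near_cont (R : realType) (V W : normedModType R) (F : V -> W) (p : V) (r K : R) :
  0 <= K ->
  (forall x y, `|x - p| < r -> `|y - p| < r -> `|F x - F y| <= K * `|x - y|) ->
  forall x, `|x - p| < r -> {for x, continuous F}.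
Proof.
move=> K0 FK x xr; apply: eps_continuous_at => e e0.
have K1 : 0 < K + 1 by rewrite ltr_wpDl.
exists (Num.min (r - `|x - p|) (e / (K + 1))); first by rewrite lt_min subr_gt0 xr divr_gt0.
move=> y; rewrite lt_min => /andP[y1 y2].
have yr : `|y - p| < r.
  rewrite -(subrKA x) -[y - x]opprB; apply: le_lt_trans (ler_normD _ _) _.
  by rewrite normrN -ltrBrDr.
apply: le_lt_trans (FK x y xr yr) _.
apply: (@le_lt_trans _ _ ((K + 1) * `|x - y|)); first by rewrite ler_wpM2r // lerDl.
by rewrite mulrC -ltr_pdivlMr.
Qed.

Lemma dot_continuous (R : realType) n : continuous (fun u : 'rV[R]_n => dot u u).
Proof.
apply: eps_continuous => u e e0.
pose c := n%:R * (2 * `|u| + 1); have c0 : 0 < c + 1 by rewrite ltr_wpDl // mulr_ge0 // addr_ge0 // mulr_ge0.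
exists (Num.min 1 (e / (c + 1))); first by rewrite lt_min ltr01 divr_gt0.
move=> v; rewrite distrC lt_min => /andP[v1 ve].
rewrite (_ : _ - _ = dot (u - v) (u + v)); last first.
  by rewrite dotBl !dotDr (dotC v u); ring.
apply: le_lt_trans (dot_le _ _) _.
have h : `|u + v| <= 2 * `|u| + 1.
  rewrite (_ : u + v = 2 *: u + (v - u)); last by vring.
  by apply: le_trans (ler_normD _ _) _; rewrite normrZ ger0_norm // lerD2l ltW.
have h2 : n%:R * `|u - v| * `|u + v| <= (c + 1) * `|v - u|.
  rewrite distrC mulrAC /c; apply: ler_wpM2r => //.
  by apply: (@le_trans _ _ (n%:R * (2 * `|u| + 1))); [exact: ler_wpM2l|rewrite lerDl].
by apply: le_lt_trans h2 _; rewrite mulrC -ltr_pdivlMr.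
Qed.

(** [a] is the point of [C] closest to [d] for the Euclidean distance; the inequality says that
    moving from [a] towards another point of [C] does not come closer to [d]. *)
Lemma convex_projection (R : realType) n (C : set 'rV[R]_n) (d : 'rV[R]_n) :
  C !=set0 -> compact C -> segment_closed C ->
  exists2 a, C a & forall c, C c -> dot (d - a) (c - a) <= 0.
Proof.
move=> C0 cC sC.
have cf : continuous (fun u : 'rV[R]_n => dot (d - u) (d - u)).
  have h1 : continuous (fun u : 'rV[R]_n => d - u).
    apply: (@lipschitz_cont _ _ _ _ 1) => // x y; rewrite mul1r (_ : _ - _ = y - x) 1?distrC //; vring.
  by move=> u; exact: (continuous_comp (h1 u) (@dot_continuous R n (d - u))).
have [a aC amin] := EVT_min_rV C0 cC (continuous_subspaceT cf).
rewrite inE in aC; exists a => // c Cc; set e := d - a; set w := c - a.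
rewrite leNgt; apply/negP => ew.
have ww := dot_ge0 w.
(* So short a step makes the gain [2 * t * dot e w] exceed the second-order term
   [t ^+ 2 * dot w w]. *)
pose t := Num.min 1 (dot e w / (dot w w + 1)).
have w1 : 0 < dot w w + 1 by rewrite ltr_wpDl.
have t0 : 0 < t by rewrite lt_min ltr01 divr_gt0.
have t1 : t <= 1 by rewrite ge_min lexx.
have te : t * (dot w w + 1) <= dot e w by rewrite -ler_pdivlMr // ge_min lexx orbT.
have Cx : C (t *: c + (1 - t) *: a) by apply: sC => //; rewrite ltW.
have := amin _ (mem_set Cx).
rewrite (_ : d - (t *: c + (1 - t) *: a) = e + (- t) *: w); last by rewrite /e /w; vring.
rewrite -/e dot_addZ; nra.
Qed.

Lemma image_segment_closed (R : realType) m n k (C : set 'M[R]_(m, n)) (g : 'M[R]_(m, n) -> 'rV[R]_k) :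
  (forall t A B, g (t *: A + (1 - t) *: B) = t *: g A + (1 - t) *: g B) ->
  segment_closed C -> segment_closed (g @` C).
Proof.
move=> gE sC _ _ t [A CA <-] [B CB <-] t01.
by exists (t *: A + (1 - t) *: B); [exact: sC|exact: gE].
Qed.

Section ClarkeInclusion.
Variables (R : realType) (m n : nat) (F : 'rV[R]_m -> 'rV[R]_n) (p : 'rV[R]_m) (r K : R).
Hypothesis r0 : 0 < r.
Hypothesis K0 : 0 <= K.
Hypothesis FK : forall x y, `|x - p| < r -> `|y - p| < r -> `|F x - F y| <= K * `|x - y|.

(** Project the increment on the compact convex set of the [w *m A], and let [e] be the remainder.
    The mean value inequality in the direction [e] provides a jacobian, hence a nearby [A] of the
    hull, whose component along [e] is at least that of the increment up to a small error. By the
    projection inequality it is at most that of the projection, so [dot e e] is small. *)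
Lemma clarke_inclusion (eps : R) : 0 < eps -> exists2 d, 0 < d <= r / 2 &
  forall y w, `|y - p| < d -> `|y + w - p| < d ->
    exists2 A, clarke_hull F p A & `|F (y + w) - F y - w *m A| <= eps * `|w|.
Proof.
move=> eps0.
(* The loss in [dot_le] times the loss in [mulmx_norm_le]. *)
pose N : R := n%:R * m%:R; have N0 : 0 <= N by rewrite mulr_ge0.
have N1 : 0 < N + 1 by rewrite ltr_wpDl.
have [d' d'0 hd'] := clarke_near_limits r0 K0 FK (divr_gt0 eps0 N1).
pose d := Num.min (r / 2) d'.
have dr : d <= r / 2 by rewrite ge_min lexx.
have d0 : 0 < d by rewrite lt_min d'0 divr_gt0.
exists d; first by rewrite d0.
move=> y w yd ywd.
have [A1 hA1] := clarke_limits_nonempty r0 K0 FK.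
have cw : continuous (fun A : 'M[R]_(m, n) => w *m A).
  apply: (@lipschitz_cont _ _ _ _ (m%:R * `|w|)); first by rewrite mulr_ge0.
  by move=> A B; rewrite -mulmxBr mulrAC; exact: mulmx_norm_le.
have [|||_ [A0 hA0 <-] sep] := @convex_projection R n
    [set w *m A | A in clarke_hull F p] (F (y + w) - F y).
- by exists (w *m A1), A1 => //; exact: clarke_limits_hull.
- apply: continuous_compact; last exact: (clarke_hull_compact r0 K0 FK).
  by apply: continuous_subspaceT.
- apply: (@image_segment_closed R m n n _ (fun A => w *m A)); last exact: clarke_hull_convex.
  move=> t A B.
  by rewrite mulmxDr -!scalemxAr.
exists A0 => //; move: sep; set e := _ - _ - _ => sep.
have key : dot e e <= N * (eps / (N + 1)) * `|e| * `|w|.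
  apply/ler_addgt0Pr => eta eta0.
  have [q [qd dq hq]] := clarke_mean_value r0 K0 FK e dr eta0 yd ywd.
  have qd' : `|q - p| < d' by apply: lt_le_trans qd _; rewrite ge_min lexx orbT.
  have [A lA JA] := hd' q qd' dq.
  have hA := clarke_limits_hull lA.
  have s1 : dot e (w *m A - w *m A0) <= 0 by apply: sep; exists A.
  have s2 : dot e (w *m (jacobian F q - A)) <= N * (eps / (N + 1)) * `|e| * `|w|.
    apply: le_trans (ler_norm _) _; apply: le_trans (dot_le _ _) _.
    apply: (@le_trans _ _ (n%:R * `|e| * (m%:R * `|jacobian F q - A| * `|w|))).
      by apply: ler_wpM2l; [rewrite mulr_ge0|exact: mulmx_norm_le].
    rewrite (_ : n%:R * _ * _ = N * `|jacobian F q - A| * `|e| * `|w|); last by rewrite /N; ring.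
    apply: ler_wpM2r => //; apply: ler_wpM2r => //.
    by apply: ler_wpM2l => //; exact: ltW.
  have E1 : dot e e = dot e (F (y + w) - F y) - dot e (w *m A0) by rewrite -dotBr.
  have E2 : dot e (w *m jacobian F q) = dot e (w *m A - w *m A0) + dot e (w *m A0) + dot e (w *m (jacobian F q - A)).
    by rewrite mulmxBr !dotBr; ring.
  by move: hq s1 s2; rewrite E1 E2; lra.
have [->|e1] := eqVneq e 0; first by rewrite normr0 mulr_ge0 // ltW.
have e2 : 0 < `|e| by rewrite normr_gt0.
rewrite -(ler_pM2l e2) -expr2; apply: le_trans (norm_sqr_le_dot e) _.
apply: le_trans key _; rewrite -mulrA mulrCA; apply: ler_wpM2l => //.
apply: ler_wpM2r => //; rewrite mulrCA ger_pMr //.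
by rewrite ler_pdivrMr // mul1r lerDl.
Qed.

End ClarkeInclusion.

(** * Inverse function theorem for Lipschitz maps *)

Lemma coercive_unitmx (R : realType) n (A : 'M[R]_n) (k : R) : 0 < k ->
  (forall w : 'rV[R]_n, k * `|w| <= `|w *m A|) -> A \in unitmx.
Proof.
move=> k0 h; rewrite -row_free_unit -kermx_eq0; apply/eqP/row_matrixP => i.
rewrite row0; apply/eqP; rewrite -normr_le0 -(pmulr_rle0 _ k0).
apply: le_trans (h _) _; rewrite normr_le0; apply/eqP.
by apply/sub_kermxP; exact: row_sub.
Qed.

(** With [u = w *m A] one has [dot u u = dot w (u *m A^T)], and [|w|] is at most [|u| / k]. The
    transpose is what occurs in the gradient of a squared distance. The denominator n+1 stays
    positive in dimension 0. *)
Lemma coercive_trmx (R : realType) n (A : 'M[R]_n) (k : R) : 0 < k ->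
  (forall w : 'rV[R]_n, k * `|w| <= `|w *m A|) ->
  forall u : 'rV[R]_n, k / n.+1%:R * `|u| <= `|u *m A^T|.
Proof.
move=> k0 h u; have uA := coercive_unitmx k0 h.
pose w := u *m invmx A.
have wA : w *m A = u by rewrite mulmxKV.
have wu : k * `|w| <= `|u| by rewrite -{1}wA.
have uu : dot u u <= n%:R * `|w| * `|u *m A^T|.
  apply: le_trans (ler_norm _) _; rewrite -{1}wA.
  rewrite (_ : dot (w *m A) u = dot w (u *m A^T)); first exact: dot_le.
  by rewrite /dot trmx_mul trmxK mulmxA.
have [->|u0] := eqVneq u 0; first by rewrite normr0 mulr0.
have u1 : 0 < `|u| by rewrite normr_gt0.
have n1 : 0 < n.+1%:R :> R by rewrite ltr0n.
have uu2 := le_trans (norm_sqr_le_dot u) uu.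
rewrite mulrAC ler_pdivrMr // mulrC -(ler_pM2l u1) (_ : `|u| * (`|u| * k) = k * `|u| ^+ 2); last by ring.
apply: le_trans (ler_wpM2l (ltW k0) uu2) _.
rewrite (_ : k * _ = n%:R * `|u *m A^T| * (k * `|w|)); last by ring.
apply: (@le_trans _ _ (n%:R * `|u *m A^T| * `|u|)); first by rewrite ler_wpM2l // mulr_ge0.
rewrite mulrC ler_wpM2l // mulrC ler_wpM2l // ler_nat //.
Qed.

Section LocalInverse.
Variables (R : realType) (n : nat) (F : 'rV[R]_n -> 'rV[R]_n) (p : 'rV[R]_n) (r K : R).
Hypothesis r0 : 0 < r.
Hypothesis K0 : 0 <= K.
Hypothesis FK : forall x y, `|x - p| < r -> `|y - p| < r -> `|F x - F y| <= K * `|x - y|.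
Variable k : R.
Hypothesis k0 : 0 < k.
Hypothesis hull_k : forall A (w : 'rV[R]_n), clarke_hull F p A -> k * `|w| <= `|w *m A|.

Let N : R := n.+1%:R.
Let N0 : 0 < N. Proof. by rewrite ltr0n. Qed.
(** One factor [N] compensates the loss in [coercive_trmx] and the other the loss in [dot_le]; the 4
    leaves the error term below half of the decrease that it perturbs. Moreover [eps] is at most
    [k / 2], as the expansion estimate requires. *)
Let eps := k / (4 * N ^+ 2).
Let eps0 : 0 < eps. Proof. by rewrite divr_gt0 // mulr_gt0 // exprn_gt0. Qed.

Lemma locally_expanding d :
  (forall y w, `|y - p| < d -> `|y + w - p| < d ->
    exists2 A, clarke_hull F p A & `|F (y + w) - F y - w *m A| <= eps * `|w|) ->
  forall x y, `|x - p| < d -> `|y - p| < d -> k / 2 * `|x - y| <= `|F x - F y|.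
Proof.
move=> hd x y xd yd.
have [|A hA FA] := hd y (x - y) yd; first by rewrite [y + _]addrC subrK.
rewrite [y + _]addrC subrK in FA.
have := hull_k (x - y) hA.
have : `|(x - y) *m A| <= `|F x - F y| + `|F x - F y - (x - y) *m A|.
  by rewrite -{1}(subKr (F x - F y) ((x - y) *m A)); exact: ler_normB.
have : eps * `|x - y| <= k / 2 * `|x - y|.
  apply: ler_wpM2r => //; rewrite /eps ler_pM2l // lef_pV2 ?posrE //; last by rewrite mulr_gt0 // exprn_gt0.
  have : 1 <= N ^+ 2 by rewrite exprn_ege1 // ler1n.
  lra.
move: FA; lra.
Qed.

(** To reach [z], minimise the Euclidean distance from [F x] to [z] over a closed ball about [p].
    Expansion keeps the minimiser off the boundary when [z] is close to [F p]. If the residual [u]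
    at the minimiser were nonzero, a step along the opposite of a well chosen row [a] would reduce
    the distance, whichever matrix of the hull describes the increment. *)
Lemma clarke_local_inverse : exists2 d, 0 < d <= r / 2 &
  (forall x y, `|x - p| < d -> `|y - p| < d -> k / 2 * `|x - y| <= `|F x - F y|) /\
  forall rho, 0 < rho -> exists2 eta, 0 < eta &
    forall z, `|z - F p| < eta -> exists2 x, `|x - p| < rho & F x = z.
Proof.
have [d /andP[d0 dr] hd] := clarke_inclusion r0 K0 FK eps0.
have ex := locally_expanding hd.
exists d; first by rewrite d0 dr.
split=> // rho rho0.
pose s := Num.min rho d / 2.
have s0 : 0 < s by rewrite divr_gt0 // lt_min rho0.
have [srho sd] : s < rho /\ s < d.
  by have : s < Num.min rho d; [move: s0; rewrite /s; lra|rewrite lt_min => /andP].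
(* On the boundary the expansion gives [|F x - F p|] at least [2 * N * eta], so [|F x - z|] exceeds
   [N * eta]. At the centre the squared distance is at most n times the square of [eta], which is
   smaller. *)
pose eta := k / 2 * s / (2 * N).
have k2 : 0 < k / 2 by rewrite divr_gt0.
have eta0 : 0 < eta by rewrite divr_gt0 // mulr_gt0.
exists eta => // z zeta.
pose B := [set x : 'rV[R]_n | `|x - p| <= s].
have cB : compact B.
  rewrite (_ : B = (fun x => x + p) @` [set x : 'rV[R]_n | `|x| <= s]).
    apply: continuous_compact; last exact: (closed_ball_compact (m := 1)).
    apply: continuous_subspaceT; apply: (@lipschitz_cont _ _ _ _ 1) => // x y.
    by rewrite opprD addrACA subrr addr0 mul1r.
  apply/seteqP; split => [x /= xs|_ [x /= xs <-]]; last by rewrite /B /= addrK.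
  by exists (x - p); rewrite ?subrK.
have B0 : B !=set0 by exists p; rewrite /B /= subrr normr0 ltW.
have Bd x : B x -> `|x - p| < d by move=> /le_lt_trans; apply.
have Br x : B x -> `|x - p| < r.
  by move=> /Bd /lt_le_trans; apply; apply: le_trans dr _; move: r0; lra.
pose g x := dot (F x - z) (F x - z).
have cg : {within B, continuous g}.
  apply: continuous_in_subspaceT => x; rewrite inE => /Br xr.
  have cF := lipschitz_near_cont K0 FK xr.
  have cz : continuous (fun y : 'rV[R]_n => y - z).
    by apply: (@lipschitz_cont _ _ _ _ 1) => // y y'; rewrite opprB addrA subrK mul1r.
  exact: (continuous_comp (continuous_comp cF (cz (F x))) (@dot_continuous R n (F x - z))).
have [x xB xmin] := EVT_min_rV B0 cB cg.
rewrite inE in xB.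
have gp : g p <= n%:R * eta ^+ 2.
  apply: le_trans (ler_norm _) _; apply: le_trans (dot_le _ _) _.
  have zeta' : `|F p - z| <= eta by rewrite distrC ltW.
  rewrite -mulrA -expr2; apply: ler_wpM2l => //.
  by rewrite !expr2; apply: ler_pM.
have xs : `|x - p| < s.
  rewrite lt_neqAle xB andbT; apply/negP => /eqP xs.
  have pB : B p by rewrite /B /= subrr normr0 ltW.
  have := xmin _ (mem_set pB); apply/negP; rewrite -ltNge.
  apply: le_lt_trans gp _; apply: lt_le_trans (norm_sqr_le_dot _).
  have h1 := ex x p (Bd _ xB) (Bd _ pB); rewrite xs in h1.
  have h2 : `|F x - F p| <= `|F x - z| + `|z - F p|.
    by rewrite -[X in `|X| <= _](subrKA z); apply: le_trans (ler_normD _ _) _.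
  have h3 : 2 * N * eta = k / 2 * s by rewrite /eta mulrC divfK // gt_eqF // mulr_gt0.
  have h4 : N * eta < `|F x - z|.
    have N1 : 1 <= N by rewrite ler1n.
    have : eta <= N * eta by rewrite ler_peMl // ltW.
    move: h1 h2 h3 zeta; lra.
  apply: (@lt_le_trans _ _ ((N * eta) ^+ 2)); last first.
    by rewrite !expr2; apply: ler_pM; rewrite // ?(ltW h4) // ltW // mulr_gt0.
  rewrite (exprMn 2 N eta); rewrite ltr_pM2r ?exprn_gt0 //.
  by rewrite /N -natrX ltr_nat -mulnn mulSn leq_addr.
exists x; first exact: lt_trans xs srho.
apply/eqP; rewrite -subr_eq0; apply/eqP; apply: contrapT => /eqP u0.
set u := F x - z in u0.
have [A1 hA1] := clarke_limits_nonempty r0 K0 FK.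
have cT : continuous (fun A : 'M[R]_n => u *m A^T).
  apply: (@lipschitz_cont _ _ _ _ (n%:R * `|u|)); first by rewrite mulr_ge0.
  move=> A A'; rewrite -mulmxBr -linearB mulrAC; apply: le_trans (mulmx_norm_le _ _) _.
  apply: ler_wpM2r => //; apply: ler_wpM2l => //.
  by apply: mx_norm_le => // i j; rewrite mxE; exact: ler_coord_norm.
(* The rows [u *m A^T] are the candidate gradients of half the squared distance. The shortest one,
   [a], satisfies [dot a a <= dot u (a *m A)] for every [A] of the hull, so a single direction suits
   all of them. *)
have [|||_ [A0 hA0 <-] sep] := @convex_projection R n
    [set u *m A^T | A in clarke_hull F p] 0.
- by exists (u *m A1^T), A1 => //; exact: clarke_limits_hull.
- apply: continuous_compact; last exact: (clarke_hull_compact r0 K0 FK).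
  by apply: continuous_subspaceT.
- apply: (@image_segment_closed R n n n _ (fun A => u *m A^T)); last exact: clarke_hull_convex.
  by move=> t A B'; rewrite linearD !linearZ /= mulmxDr -!scalemxAr.
set a := u *m A0^T in sep.
have sep' A : clarke_hull F p A -> dot a a <= dot u (a *m A).
  move=> hA; have -> : dot u (a *m A) = dot a (u *m A^T).
    by rewrite dotC /dot trmx_mul trmxK mulmxA.
  have : dot (0 - a) (u *m A^T - a) <= 0 by apply: sep; exists A.
  by rewrite sub0r dotNl dotBr; lra.
have au : k / N * `|u| <= `|a| := coercive_trmx k0 (fun w => hull_k w hA0) u.
have u1 : 0 < `|u| by rewrite normr_gt0.
have a1 : 0 < `|a| by apply: lt_le_trans au; rewrite mulr_gt0 // divr_gt0.
pose M := n%:R * (K * `|a|) ^+ 2.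
have M0 : 0 <= M by rewrite mulr_ge0 // exprn_ge0 // mulr_ge0.
(* The first bound keeps the new point in the ball. By the second, the quadratic term, at most
   [t * (t * M)], is smaller than the linear decrease. *)
pose t := Num.min ((s - `|x - p|) / (2 * `|a|)) (`|a| ^+ 2 / (2 * (M + 1))).
have t0 : 0 < t.
  by rewrite lt_min !divr_gt0 ?subr_gt0 ?mulr_gt0 ?exprn_gt0 // ltr_wpDl.
have ta : t * `|a| < s - `|x - p|.
  apply: (@le_lt_trans _ _ ((s - `|x - p|) / 2)); last by move: xs; lra.
  apply: (@le_trans _ _ ((s - `|x - p|) / (2 * `|a|) * `|a|)).
    by rewrite ler_wpM2r // ge_min lexx.
  by rewrite invfM mulrA divfK // gt_eqF.
have tM : t * (2 * (M + 1)) <= `|a| ^+ 2.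
  by rewrite -ler_pdivlMr ?ge_min ?lexx ?orbT // mulr_gt0 // ltr_wpDl.
pose w := (- t) *: a.
have w1 : `|w| = t * `|a| by rewrite normrZ normrN gtr0_norm.
have xwB : B (x + w).
  rewrite /B /= addrAC; apply: le_trans (ler_normD _ _) _; rewrite w1; move: ta; lra.
have [A hA FA] := hd x w (Bd _ xB) (Bd _ xwB).
set D := F (x + w) - F x in FA.
have h1 : dot u D <= - t * dot a a / 2.
  have -> : D = w *m A + (D - w *m A) by rewrite addrC subrK.
  have wE : dot u (w *m A) = - t * dot u (a *m A) by rewrite /w -scalemxAl dotZr.
  rewrite dotDr wE.
  have := sep' A hA => h2.
  have h3 : dot u (D - w *m A) <= t * `|a| ^+ 2 / 2.
    apply: le_trans (ler_norm _) _; apply: le_trans (dot_le _ _) _.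
    apply: (@le_trans _ _ (N * `|u| * (eps * (t * `|a|)))).
      apply: ler_pM => //; first by rewrite ler_wpM2r // ler_nat.
      by rewrite -w1.
    have h4 : N * eps * `|u| <= `|a| / 2.
      rewrite (_ : N * eps * `|u| = (k / N * `|u|) / 4).
        by move: au (normr_ge0 a); move: (k / N * `|u|) (`|a|) => X Y; lra.
      by rewrite /eps; field; rewrite gt_eqF.
    rewrite (_ : N * `|u| * _ = N * eps * `|u| * (t * `|a|)); last by ring.
    rewrite (_ : t * _ / 2 = `|a| / 2 * (t * `|a|)); last by ring.
    by rewrite ler_wpM2r // mulr_ge0 // ltW.
  have h5 := norm_sqr_le_dot a.
  have h6 : t * `|a| ^+ 2 <= t * dot a a by rewrite ler_wpM2l // ltW.
  have h7 : t * dot a a <= t * dot u (a *m A) by rewrite ler_wpM2l // ltW.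
  move: h3 h6 h7; lra.
have h2 : dot D D <= t * (t * M).
  apply: le_trans (ler_norm _) _; apply: le_trans (dot_le _ _) _.
  have DK : `|D| <= K * (t * `|a|).
    by rewrite /D -w1; apply: le_trans (FK (Br _ xwB) (Br _ xB)) _; rewrite addrAC subrr add0r.
  rewrite (_ : t * (t * M) = n%:R * (K * (t * `|a|)) * (K * (t * `|a|))); last by rewrite /M; ring.
  by apply: ler_pM => //; rewrite ler_wpM2l.
have := xmin _ (mem_set xwB); apply/negP; rewrite -ltNge /g.
rewrite (_ : F (x + w) - z = u + 1 *: D); last by rewrite scale1r /u /D; vring.
rewrite dot_addZ -/u.
have h5 := norm_sqr_le_dot a.
have h6 : t * (t * (2 * (M + 1))) <= t * `|a| ^+ 2 by rewrite ler_wpM2l // ltW.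
have h7 : t * `|a| ^+ 2 <= t * dot a a by rewrite ler_wpM2l // ltW.
have h8 : 0 < t * t by rewrite mulr_gt0.
have h9 : 0 <= t * (t * M) by rewrite !mulr_ge0 // ltW.
move: h1 h2 h6 h7 h8 h9; rewrite expr1n mulr1 mul1r; lra.
Qed.

End LocalInverse.

(** * Lifting along a local homeomorphism *)

(** The orbit of [b] repeats itself because [B] is finite, and injectivity moves the repetition back
    to [b], which is therefore the image of one of its iterates. *)
Lemma finite_inj_surj (T : Type) (B : set T) (g : T -> T) : finite_set B ->
  (forall b, B b -> B (g b)) -> {in B &, injective g} ->
  forall b, B b -> exists2 a, B a & g a = b.
Proof.
move=> fB gB gi b Bb.
have Bi k : B (iter k g b) by elim: k => // k; exact: gB.
have [|inj] := pselect (exists i j, (i < j)%N /\ iter i g b = iter j g b).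
  move=> [i [j [ij]]]; rewrite -(subnKC ij) => {ij}; move: (j - _)%N => l.
  elim: i => [|i IH]; first by move=> E; exists (iter l g b) => //; exact/esym.
  rewrite addSn !iterS => E; apply: IH; apply: gi => //; rewrite inE; exact: Bi.
exfalso; apply: infinite_nat.
have ii : {in [set: nat] &, injective (fun k => iter k g b)}.
  move=> i j _ _ E; case: (ltngtP i j) => // ij; exfalso; apply: inj.
    by exists i, j; split; [exact: ij|exact: E].
  by exists j, i; split; [exact: ij|exact: (esym E)].
rewrite -(eq_finite_set (inj_card_eq ii)).
by apply: sub_finite_set fB => _ [k _ <-]; exact: Bi.
Qed.

Lemma glue_continuous (R : realType) (X T : topologicalType) (h : X -> R) (c : R)
    (g1 g2 : X -> T) :
  continuous h -> continuous g1 -> continuous g2 ->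
  (forall x, h x = c -> g1 x = g2 x) ->
  continuous (fun x => if h x <= c then g1 x else g2 x).
Proof.
move=> ch c1 c2 E x A nA.
change (\forall y \near x, A (if h y <= c then g1 y else g2 y)).
have [hx|hx|hx] := ltgtP (h x) c.
- have nh : \forall y \near x, h y < c.
    by apply: (ch x [set r | r < c]); apply: open_nbhs_nbhs; split => //; exact: open_lt.
  move: nA; rewrite /= ltW // => nA.
  have n1 : \forall y \near x, A (g1 y) := c1 x A nA.
  by apply: filterS2 n1 nh => y /= Ay hy; rewrite ltW.
- have nh : \forall y \near x, c < h y.
    by apply: (ch x [set r | c < r]); apply: open_nbhs_nbhs; split => //; exact: open_gt.
  move: nA; rewrite /= leNgt hx /= => nA.
  have n1 : \forall y \near x, A (g2 y) := c2 x A nA.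
  by apply: filterS2 n1 nh => y /= Ay hy; rewrite leNgt hy.
- move: nA; rewrite /= hx lexx => nA; have nA2 : nbhs (g2 x) A by rewrite -E.
  have n1 : \forall y \near x, A (g1 y) := c1 x A nA.
  have n2 : \forall y \near x, A (g2 y) := c2 x A nA2.
  by apply: filterS2 n1 n2 => y /= A1 A2; case: ifP.
Qed.

Lemma clamp_continuous (R : realType) (a b : R) : a <= b ->
  continuous (fun x : R => Num.max a (Num.min b x)).
Proof.
move=> ab; apply: (@lipschitz_cont _ R R _ 1) => // x y; rewrite mul1r.
exact: clamp_dist.
Qed.

Section LocalHomeomorphism.
Variables (R : realType) (M N : topologicalType) (f : M -> N).
Hypothesis M_hausdorff : hausdorff_space M.
Hypothesis f_cont : continuous f.
Hypothesis f_open : forall O, open O -> open (f @` O).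
Hypothesis f_inj : forall x, exists2 U, open_nbhs x U & forall a b, U a -> U b -> f a = f b -> a = b.

(** Since [f] is open, the inverse of its restriction to a set [U] of injectivity is defined on an
    open set and continuous there. Elsewhere [sigma] has the default value [x]. *)
Lemma local_section x : exists U V (sigma : N -> M),
  [/\ open_nbhs x U, open_nbhs (f x) V, forall a, U a -> sigma (f a) = a &
      forall y, V y -> [/\ U (sigma y), f (sigma y) = y & {for y, continuous sigma}]].
Proof.
have [U [oU Ux] Ui] := f_inj x.
pose sigma y := if pselect (exists2 a, U a & f a = y) is left h then projT1 (cid2 h) else x.
have sE a : U a -> sigma (f a) = a.
  move=> Ua; rewrite /sigma; case: pselect => [h|[]]; last by exists a.
  by case: (cid2 h) => b Ub fb /=; exact: Ui.
exists U, (f @` U), sigma; split => //; first by split; [exact: f_open|exists x].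
move=> _ [a Ua <-]; rewrite sE //; split => // A; rewrite /= sE // => nA.
have : nbhs (f a) (f @` (U `&` A^°)).
  apply: open_nbhs_nbhs; split; first by apply/f_open/openI => //; exact: open_interior.
  by exists a.
apply: filterS => _ [b [Ub Ab] <-]; rewrite /= sE //; exact: interior_subset.
Qed.

(** Local injectivity propagates agreement of the two lifts, and separation of points propagates
    disagreement. *)
Lemma lift_unique (p q : R -> M) (t0 : R) : continuous p -> continuous q ->
  (forall t, f (p t) = f (q t)) -> p t0 = q t0 -> forall t, p t = q t.
Proof.
move=> cp cq E E0; apply: (real_induction (A := fun t => p t = q t) E0) => t.
have [pq|pq] := eqVneq (p t) (q t).
  have [U nU Ui] := f_inj (p t).
  have nU1 : nbhs (p t) U by exact: open_nbhs_nbhs.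
  have nU2 : nbhs (q t) U by rewrite -pq.
  have n1 : nbhs t (p @^-1` U) := cp t _ nU1.
  have n2 : nbhs t (q @^-1` U) := cq t _ nU2.
  have /nbhs_ballP[d /= d0 hd] : nbhs t (p @^-1` U `&` q @^-1` U) by exact: filterI.
  exists d => // s s' _ s't _; apply: Ui => //.
    by case: (hd s') => //; rewrite /ball /= distrC.
  by case: (hd s') => //; rewrite /ball /= distrC.
move: M_hausdorff; rewrite open_hausdorff => /(_ _ _ pq) [[A B] /= [pA qB] [oA oB AB]].
rewrite !inE in pA qB.
have nA : nbhs (p t) A by apply: open_nbhs_nbhs.
have nB : nbhs (q t) B by apply: open_nbhs_nbhs.
have n1 : nbhs t (p @^-1` A) := cp t _ nA.
have n2 : nbhs t (q @^-1` B) := cq t _ nB.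
have /nbhs_ballP[d /= d0 hd] : nbhs t (p @^-1` A `&` q @^-1` B) by exact: filterI.
exists d => // s s' st _ ps; exfalso.
have [h1 h2] : A (p s) /\ B (q s) by apply: hd; rewrite /ball /= distrC.
have : (A `&` B) (p s) by split => //; rewrite ps.
by rewrite (eqP AB).
Qed.

(** Continuity in [z] spreads from [t0] along the line. Near a time [t], once [z] is close to [z0],
    the path [G z] coincides with one local section applied to its image, by uniqueness of lifts.
    This provides both the lifting of homotopies and the continuity of the sections over chart
    balls. *)
Lemma lift_family_continuous (X : topologicalType) (G : X -> R -> M) (z0 : X) (t0 : R) :
  (forall t, {for (z0, t), continuous (fun u : X * R => f (G u.1 u.2))}) ->
  (forall z, continuous (G z)) ->
  {for z0, continuous (fun z => G z t0)} ->
  forall t, {for (z0, t), continuous (fun u : X * R => G u.1 u.2)}.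
Proof.
move=> Qc Gc G0.
have loc t : exists2 d, 0 < d & forall s, `|s - t| < d ->
    {for z0, continuous (fun z => G z s)} ->
    exists (sigma : N -> M), [/\ {for f (G z0 t), continuous sigma},
      forall s', `|s' - t| < d -> {for f (G z0 s'), continuous sigma} &
      \forall z \near z0, forall s', `|s' - t| < d -> G z s' = sigma (f (G z s'))].
  have [U [V [sigma [nU nV sU sV]]]] := local_section (G z0 t).
  have nV' : nbhs (f (G z0 t)) V by exact: open_nbhs_nbhs.
  have nU' : nbhs (G z0 t) U by exact: open_nbhs_nbhs.
  have [[Z I] /= [nZ /nbhs_ballP[d1 /= d10 hd1]] ZI] := Qc t _ nV'.
  have nGt : nbhs t (G z0 @^-1` U) := Gc z0 t _ nU'.
  have /nbhs_ballP[d2 /= d20 hd2] := nGt.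
  exists (Num.min d1 d2); first by rewrite lt_min d10.
  move=> s; rewrite lt_min => /andP[s1 s2] Gs.
  exists sigma; split.
  - by have [] := sV _ (nbhs_singleton nV').
  - move=> s'; rewrite lt_min => /andP[s'1 s'2].
    have : V (f (G z0 s')).
      apply: (ZI (z0, s')); split; first exact: nbhs_singleton.
      by apply: hd1; rewrite /ball /= distrC.
    by move/sV => [].
  have nUs : nbhs (G z0 s) U.
    by apply: open_nbhs_nbhs; split; [case: nU|apply: hd2; rewrite /ball /= distrC].
  have nGs : \forall z \near z0, U (G z s) := Gs _ nUs.
  apply: filterS2 nZ nGs => z Zz /= Uz s'; rewrite lt_min => /andP[s'1 s'2].
  (* Time is clamped to the interval of radius [e] about [t], which contains [s] and [s'], because
     [lift_unique] compares lifts defined on the whole line. *)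
  pose e := Num.max `|s - t| `|s' - t|.
  have ed : e < d1 by rewrite gt_max s1.
  have e0 : 0 <= e by rewrite le_max normr_ge0.
  have ab : t - e <= t + e by lra.
  pose c x := Num.max (t - e) (Num.min (t + e) x).
  have ce x : V (f (G z (c x))).
    apply: (ZI (z, c x)); split => //; apply: hd1; rewrite /ball /= distrC.
    apply: le_lt_trans ed; rewrite ler_norml /c.
    by case: (clampP x ab) => [_|/andP[? ?]|_]; apply/andP; split; lra.
  have cid x : `|x - t| <= e -> c x = x.
    rewrite ler_norml /c => /andP[? ?].
    by case: (clampP x ab) => // ?; lra.
  have ct : continuous c by exact: clamp_continuous.
  have cs : c s = s by apply: cid; rewrite le_max lexx.
  have cs' : c s' = s' by apply: cid; rewrite le_max lexx orbT.
  have c1 : continuous (fun x => G z (c x)).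
    by move=> x; apply: (continuous_comp (ct x)); exact: Gc.
  have c2 : continuous (fun x => sigma (f (G z (c x)))).
    move=> x; have [_ _ hs] := sV _ (ce x).
    exact: (@continuous_comp _ _ _ (fun x => f (G z (c x))) sigma x
      (continuous_comp (c1 x) (@f_cont _)) hs).
  have := @lift_unique _ _ s c1 c2 _ _ s'; rewrite cs'; apply.
    by move=> x; have [_ -> _] := sV _ (ce x).
  by rewrite cs sU.
have all t : {for z0, continuous (fun z => G z t)}.
  apply: (real_induction (A := fun t => {for z0, continuous (fun z => G z t)}) G0) => {}t.
  have [d d0 hd] := loc t; exists d => // s s' st s't /(hd s st) [sigma [_ cs nz]].
  move=> A /= nA; have := Qc s' _ (cs s' s't A _).
  rewrite /= -(nbhs_singleton nz s' s't) => /(_ nA) [[Z I] /= [nZ nI] ZI].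
  change (\forall z \near z0, A (G z s')).
  apply: filterS2 nZ nz => z Zz -> //.
  by apply: (ZI (z, s')); split => //; exact: nbhs_singleton.
move=> t; have [d d0 hd] := loc t.
have tt : `|t - t| < d by rewrite subrr normr0.
have [sigma [_ cs nz]] := hd t tt (all t).
move=> A /= nA; have := Qc t _ (cs t tt A _).
rewrite /= -(nbhs_singleton nz t tt) => /(_ nA) [[Z I] /= [nZ nI] ZI].
exists (Z `&` [set z | forall s', `|s' - t| < d -> G z s' = sigma (f (G z s'))], I `&` ball t d).
  split; first exact: filterI.
  by apply: filterI => //; exact: nbhsx_ballx.
move=> [z s] /= [[Zz hz] [Is sd]]; rewrite hz; last by rewrite distrC.
exact: (ZI (z, s)).
Qed.

End LocalHomeomorphism.

(** * Paths and homotopies of loops *)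

Section Continuity.
Variables (X Y Z : topologicalType).

Lemma cont_comp (g : X -> Y) (h : Y -> Z) :
  continuous g -> continuous h -> continuous (fun x => h (g x)).
Proof. by move=> cg ch x; apply: continuous_comp; [exact: cg|exact: ch]. Qed.

Lemma cont_pair (g : X -> Y) (h : X -> Z) :
  continuous g -> continuous h -> continuous (fun x => (g x, h x)).
Proof. by move=> cg ch x; apply: cvg_pair; [exact: cg|exact: ch]. Qed.

Lemma cont_fst : continuous (fst : X * Y -> X).
Proof. by move=> x; exact: cvg_fst. Qed.

Lemma cont_snd : continuous (snd : X * Y -> Y).
Proof. by move=> x; exact: cvg_snd. Qed.

Lemma cont_id : continuous (fun x : X => x).
Proof. by move=> x; exact: cvg_id. Qed.

Lemma cont_cst (y : Y) : continuous (fun _ : X => y).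
Proof. by move=> x; exact: cvg_cst. Qed.

End Continuity.

Lemma cont_affine (R : realType) (X : topologicalType) (g : X -> R) (a b : R) :
  continuous g -> continuous (fun x => a * g x + b).
Proof.
move=> cg; apply: (cont_comp (h := fun r : R => a * r + b) cg).
apply: (@lipschitz_cont _ R R _ `|a|) => // x y.
by rewrite opprD addrACA subrr addr0 -mulrBr normrM.
Qed.

(** Composition with this retraction of the line on [0, 1] turns a path that is continuous within
    [0, 1] into a globally continuous function, to which induction along the line applies. *)
Definition unit_clamp (R : realType) (t : R) : R := Num.max 0 (Num.min 1 t).

Section UnitClamp.
Variable R : realType.

Lemma unit_clamp_continuous : continuous (@unit_clamp R).
Proof. exact: clamp_continuous. Qed.

Lemma unit_clamp_in (t : R) : unit_clamp t \in `[0, 1].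
Proof.
rewrite in_itv /= /unit_clamp; case: (clampP t (@ler01 R)) => [_|//|_];
by rewrite ?lexx ?ler01.
Qed.

Lemma unit_clamp_id (t : R) : t \in `[0, 1] -> unit_clamp t = t.
Proof.
rewrite in_itv /= => /andP[t0 t1]; rewrite /unit_clamp; case: (clampP t (@ler01 R)) => // h.
  by apply/eqP; rewrite eq_le t0 h.
by apply/eqP; rewrite eq_le t1 h.
Qed.

Lemma unit_clamp_le0 (t : R) : t <= 0 -> unit_clamp t = 0.
Proof.
move=> t0; rewrite /unit_clamp; case: (clampP t (@ler01 R)) => // [/andP[h _]|h].
  by apply/eqP; rewrite eq_le t0 h.
by have := le_trans h t0; rewrite ler10.
Qed.

Lemma unit_clamp_ge1 (t : R) : 1 <= t -> unit_clamp t = 1.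
Proof.
move=> t1; rewrite /unit_clamp; case: (clampP t (@ler01 R)) => // [h|/andP[_ h]].
  by have := le_trans t1 h; rewrite ler10.
by apply/eqP; rewrite eq_le t1 h.
Qed.

Lemma unit0 : (0 : R) \in `[0, 1]. Proof. by rewrite in_itv /= lexx ler01. Qed.
Lemma unit1 : (1 : R) \in `[0, 1]. Proof. by rewrite in_itv /= lexx ler01. Qed.

End UnitClamp.

Lemma within_comp_continuous (X S T : topologicalType) (A : set S) (g : S -> T) (c : X -> S) :
  {within A, continuous g} -> continuous c -> (forall x, A (c x)) -> continuous (g \o c).
Proof.
move=> /subspace_continuousP cg cc Ac x B nB.
have h : nbhs (c x) (fun y => A y -> B (g y)) := cg (c x) (Ac x) B nB.
have n : \forall y \near x, A (c y) -> B (g (c y)) := cc x _ h.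
change (\forall y \near x, B (g (c y))).
by apply: filterS n => y; apply; exact: Ac.
Qed.

Section Homotopy.
Variables (R : realType) (T : topologicalType).
Implicit Types (a b : R -> T) (x : T).

Lemma path_clamp_continuous x y a : is_path x y a -> continuous (a \o @unit_clamp R).
Proof.
case=> ca _ _; apply: (within_comp_continuous ca) => [t|t]; first exact: unit_clamp_continuous.
exact: unit_clamp_in.
Qed.

Lemma path_of_continuous a : continuous a -> is_path (a 0) (a 1) a.
Proof. by move=> ca; split => //; exact: continuous_subspaceT. Qed.

Definition total_homotopy x a b (H : R * R -> T) :=
  [/\ continuous H,
      forall t s, H (t, s) = H (unit_clamp t, unit_clamp s),
      forall t, H (t, 0) = a (unit_clamp t),
      forall t, H (t, 1) = b (unit_clamp t) &
      (forall s, H (0, s) = x) /\ (forall s, H (1, s) = x)].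

Lemma loop_homotopicP x a b :
  loop_homotopic x a b <-> exists H, total_homotopy x a b H.
Proof.
split=> [[H [cH H0 H1 Hx Hy]]|[H [cH HE H0 H1 [Hx Hy]]]].
  exists (fun u => H (unit_clamp u.1, unit_clamp u.2)); split => /=.
  - apply: (within_comp_continuous (c := fun u : R * R => (unit_clamp u.1, unit_clamp u.2)) cH).
      apply: (cont_pair (g := fun u : R * R => unit_clamp u.1) (h := fun u : R * R => unit_clamp u.2)).
        by apply: cont_comp (@unit_clamp_continuous R); exact: cont_fst.
      by apply: cont_comp (@unit_clamp_continuous R); exact: cont_snd.
    by move=> u; split; exact: unit_clamp_in.
  - by move=> t s; rewrite !(unit_clamp_id (unit_clamp_in _)).
  - by move=> t; rewrite (unit_clamp_id (unit0 R)) H0 // unit_clamp_in.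
  - by move=> t; rewrite (unit_clamp_id (unit1 R)) H1 // unit_clamp_in.
  - split=> s.
      by rewrite (unit_clamp_id (unit0 R)) Hx // unit_clamp_in.
    by rewrite (unit_clamp_id (unit1 R)) Hy // unit_clamp_in.
exists H; split => //.
- exact: continuous_subspaceT.
- by move=> t t01; rewrite H0 unit_clamp_id.
- by move=> t t01; rewrite H1 unit_clamp_id.
Qed.

Lemma loop_homotopic_refl x a : is_path x x a -> loop_homotopic x a a.
Proof.
move=> pa; have ca := path_clamp_continuous pa; have [_ a0 a1] := pa.
apply/loop_homotopicP; exists (fun u => a (unit_clamp u.1)); split => //=.
- exact: (cont_comp (@cont_fst R R) ca).
- by move=> t s; rewrite (unit_clamp_id (unit_clamp_in _)).
- by rewrite (unit_clamp_id (unit0 R)) (unit_clamp_id (unit1 R)).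
Qed.

Lemma loop_homotopic_sym x a b : loop_homotopic x a b -> loop_homotopic x b a.
Proof.
move=> /loop_homotopicP [H [cH HE H0 H1 [Hx Hy]]].
exists (fun u => H (u.1, 1 - u.2)); split => //=.
- apply: continuous_subspaceT.
  apply: (cont_comp (g := fun u : R * R => (u.1, 1 - u.2)) _ cH).
  apply: cont_pair; first exact: cont_fst.
  rewrite (_ : (fun u : R * R => _) = (fun u => -1 * u.2 + 1)); first exact/cont_affine/cont_snd.
  by apply/funext => u; rewrite mulN1r addrC.
- by move=> t t01; rewrite subr0 H1 unit_clamp_id.
- by move=> t t01; rewrite subrr H0 unit_clamp_id.
Qed.

Lemma loop_homotopic_trans x a b c :
  loop_homotopic x a b -> loop_homotopic x b c -> loop_homotopic x a c.
Proof.
move=> /loop_homotopicP [H [cH HE H0 H1 [Hx Hy]]] /loop_homotopicP [G [cG GE G0 G1 [Gx Gy]]].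
exists (fun u => if u.2 <= 1 / 2 then H (u.1, 2 * u.2) else G (u.1, 2 * u.2 - 1)); split => /=.
- apply: continuous_subspaceT.
  apply: (glue_continuous (h := snd)).
  + exact: cont_snd.
  + apply: (cont_comp (g := fun u : R * R => (u.1, 2 * u.2)) _ cH).
    apply: cont_pair; first exact: cont_fst.
    rewrite (_ : (fun u : R * R => _) = (fun u => 2 * u.2 + 0)); first exact/cont_affine/cont_snd.
    by apply/funext => u; rewrite addr0.
  + apply: (cont_comp (g := fun u : R * R => (u.1, 2 * u.2 - 1)) _ cG).
    by apply: cont_pair; [exact: cont_fst|exact/cont_affine/cont_snd].
  + by move=> [t s] /= ->; rewrite mulrCA mulfV // mulr1 subrr H1 G0.
- by move=> t t01; rewrite divr_ge0 // mulr0 H0 unit_clamp_id.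
- move=> t t01; rewrite ifF; last by apply/negbTE; rewrite -ltNge; lra.
  by rewrite mulr1 (_ : 2 - 1 = 1) ?G1 ?unit_clamp_id //; lra.
- by move=> s _; rewrite Hx Gx if_same.
- by move=> s _; rewrite Hy Gy if_same.
Qed.

Lemma loop_class_eq x a b : is_path x x b ->
  loop_class x a = loop_class x b -> loop_homotopic x a b.
Proof.
move=> pb E; suff : loop_class x a b by [].
by rewrite E; exact: loop_homotopic_refl.
Qed.

Lemma eq_loop_class x a b : loop_homotopic x a b -> loop_class x a = loop_class x b.
Proof.
move=> ab; apply/seteqP; split => c /=.
  by apply: loop_homotopic_trans; exact: loop_homotopic_sym.
exact: loop_homotopic_trans.
Qed.

End Homotopy.

(** * Lifting of paths and homotopies, and fundamental groups *)

Section Covering.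
Variables (R : realType) (M N : topologicalType) (f : M -> N).
Hypothesis M_hausdorff : hausdorff_space M.
Hypothesis f_cont : continuous f.
Hypothesis f_open : forall O, open O -> open (f @` O).
Hypothesis f_inj : forall x, exists2 U, open_nbhs x U & forall a b, U a -> U b -> f a = f b -> a = b.
Hypothesis f_section : forall y, exists2 V, open_nbhs y V & forall x, V (f x) ->
  exists2 s : N -> M, s (f x) = x & forall z, V z -> f (s z) = z /\ {for z, continuous s}.

Let lift_unique := @lift_unique R M N f M_hausdorff f_inj.

(** [L T] says that the path stopped at time [T] has a lift. A lift up to a later time is stopped
    earlier, and a lift up to [s] is prolonged by the section through its last point. One
    neighbourhood serves all points above it, so the length of the prolongation is known in advance
    and [real_induction] applies. *)
Lemma path_lift (a : R -> N) x : continuous a -> (forall t, a t = a (unit_clamp t)) ->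
  a 0 = f x -> exists p : R -> M, [/\ continuous p, p 0 = x & forall t, f (p t) = a t].
Proof.
move=> ca aE a0.
have aneg t : t <= 0 -> a t = f x by move=> t0; rewrite aE unit_clamp_le0.
pose L T := exists p : R -> M, [/\ continuous p, forall t, t <= 0 -> p t = x &
  forall t, f (p t) = a (Num.min t T)].
have L0 : L 0.
  exists (fun=> x); split => //; first by move=> t; exact: cvg_cst.
  by move=> t; rewrite aneg // ge_min lexx orbT.
have cmin (T : R) : continuous (fun t : R => Num.min t T).
  apply: (@lipschitz_cont _ R R _ 1) => // t s; rewrite mul1r.
  have := ler_norm (t - s); have := ler_norm (s - t); rewrite [`|s - t|]distrC.
  by move=> h1 h2; rewrite ler_norml; have [?|?] := leP t T; have [?|?] := leP s T; apply/andP; split; lra.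
suff : L 1.
  move=> [p [cp p0 pE]]; exists p; split => //; first exact: p0.
  move=> t; rewrite pE [RHS]aE aE; congr a.
  have [t1|t1] := leP t 1; first by [].
  by rewrite (unit_clamp_ge1 (ltW t1)) unit_clamp_ge1.
apply: (real_induction (A := L) L0) => T.
have [V [oV VT] secV] := f_section (a T).
have nV : nbhs (a T) V by exact: open_nbhs_nbhs.
have na : nbhs T (a @^-1` V) := ca T _ nV.
have /nbhs_ballP[d /= d0 hd] := na.
exists d => // s s' sT s'T [p [cp p0 pE]].
have [s's|ss'] := leP s' s.
  exists (fun t => p (Num.min t s')); split.
  - exact: (cont_comp (cmin s') cp).
  - by move=> t t0; rewrite p0 // ge_min t0.
  - by move=> t; rewrite pE -minA; congr a; congr (Num.min t _); exact: min_l.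
have Vps : V (f (p s)).
  by rewrite pE minxx; apply: hd; rewrite /ball /= distrC.
have [sg sgx sgV] := secV _ Vps.
have ab : s <= s' by exact: ltW.
pose c t := Num.max s (Num.min s' t).
have cV t : V (a (c t)).
  apply: hd; rewrite /ball /= distrC /c; move: sT s'T; rewrite !ltr_norml => /andP[? ?] /andP[? ?].
  by case: (clampP t ab) => [?|/andP[? ?]|?]; apply/andP; split; lra.
exists (fun t => if t <= s then p t else sg (a (c t))); split.
- apply: (glue_continuous (h := fun t => t)) => //.
  + by move=> t; exact: cvg_id.
  + move=> t; have [_ hs] := sgV _ (cV t).
    have ct := clamp_continuous ab (x := t).
    exact: (@continuous_comp _ _ _ (fun t => a (c t)) sg t
      (continuous_comp ct (ca _)) hs).
  + move=> t ->; rewrite -[LHS]sgx pE minxx; congr (sg (a _)).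
    by rewrite /c; case: (clampP s ab) => // *; lra.
- move=> t t0; case: ifP => [_|/negbT]; first exact: p0.
  rewrite -ltNge => st; have s0 : s <= 0 by lra.
  have ps : p s = x by apply: p0.
  rewrite -[RHS]ps -[RHS]sgx ps; congr sg.
  have ct : c t <= 0 by rewrite /c; case: (clampP t ab) => [?|/andP[? ?]|?]; lra.
  exact: aneg.
- move=> t; case: ifP => [ts|/negbT].
    by rewrite pE !min_l // (le_trans ts).
  rewrite -ltNge => st; have [-> _] := sgV _ (cV t); congr a.
  rewrite /c; case: (clampP t ab) => [?|/andP[? ?]|?]; first lra.
    by rewrite min_l.
  by rewrite min_r.
Qed.

(** The paths [H (_, s)] are lifted separately, and [lift_family_continuous] makes the lifts jointly
    continuous. Their end points form a lift of a constant path, hence a constant. *)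
Lemma homotopy_lift x y (a b : R -> M) : f x = y ->
  continuous a -> a 0 = x -> continuous b -> b 0 = x ->
  (forall t, a t = a (unit_clamp t)) -> (forall t, b t = b (unit_clamp t)) ->
  forall H, total_homotopy y (f \o a) (f \o b) H ->
  a 1 = b 1 /\ (a 1 = x -> loop_homotopic x a b).
Proof.
move=> fx ca a0 cb b0 aE bE H [cH HE H0 H1 [Hx Hy]].
have lift s : exists p : R -> M, [/\ continuous p, p 0 = x & forall t, f (p t) = H (t, s)].
  apply: path_lift; last by rewrite Hx.
    apply: (cont_comp (g := fun t : R => (t, s)) _ cH).
    by apply: cont_pair; [exact: cont_id|exact: cont_cst].
  by move=> t; rewrite HE [RHS]HE (unit_clamp_id (unit_clamp_in _)).
have [G GP] := choice lift.
have cG s t : {for (s, t), continuous (fun u : R * R => G u.1 u.2)}.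
  apply: (lift_family_continuous M_hausdorff f_cont f_open f_inj (t0 := 0)).
  - move=> {}t; have -> : (fun u : R * R => f (G u.1 u.2)) = (fun u => H (u.2, u.1)).
      by apply/funext => u; have [_ _ ->] := GP u.1.
    have cs : continuous (fun u : R * R => (u.2, u.1)).
      by apply: cont_pair; [exact: cont_snd|exact: cont_fst].
    exact: (cont_comp cs cH).
  - by move=> z; have [] := GP z.
  - have -> : (fun z => G z 0) = (fun=> x) by apply/funext => z; have [_ -> _] := GP z.
    exact: cvg_cst.
have cG1 : continuous (fun s => G s 1).
  have c1 : continuous (fun s : R => (s, (1 : R))).
    by apply: cont_pair; [exact: cont_id|exact: cont_cst].
  move=> s; exact: (continuous_comp (c1 s) (@cG s 1)).
have G1 s : G s 1 = G 0 1.
  apply: (lift_unique (p := fun s => G s 1) (q := fun=> G 0 1) (t0 := 0)) => //.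
    by move=> t; exact: cvg_cst.
  by move=> t; have [_ _ ->] := GP t; have [_ _ ->] := GP 0; rewrite !Hy.
have Ga : forall t, G 0 t = a t.
  have [c0 p0 E] := GP 0.
  apply: (lift_unique (t0 := 0)) => //; last by rewrite p0.
  by move=> t; rewrite E H0 /= -aE.
have Gb : forall t, G 1 t = b t.
  have [c0 p0 E] := GP 1.
  apply: (lift_unique (t0 := 0)) => //; last by rewrite p0.
  by move=> t; rewrite E H1 /= -bE.
split; first by rewrite -Ga -Gb G1.
move=> a1; exists (fun u => G u.2 u.1); split.
- apply: continuous_subspaceT.
  have c1 : continuous (fun u : R * R => (u.2, u.1)).
    by apply: cont_pair; [exact: cont_snd|exact: cont_fst].
  move=> u; exact: (continuous_comp (c1 u) (@cG u.2 u.1)).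
- by move=> t _; exact: Ga.
- by move=> t _; exact: Gb.
- by move=> s _ /=; have [] := GP s.
- by move=> s _ /=; rewrite G1 Ga.
Qed.

End Covering.

Section CoveringHomeomorphism.
Variables (R : realType) (M N : topologicalType) (f : M -> N).
Hypothesis M_hausdorff : hausdorff_space M.
Hypothesis f_cont : continuous f.
Hypothesis f_open : forall O, open O -> open (f @` O).
Hypothesis f_inj : forall x, exists2 U, open_nbhs x U & forall a b, U a -> U b -> f a = f b -> a = b.
Hypothesis f_section : forall y, exists2 V, open_nbhs y V & forall x, V (f x) ->
  exists2 s : N -> M, s (f x) = x & forall z, V z -> f (s z) = z /\ {for z, continuous s}.
Hypothesis M_path : path_connected R M.
Variable x0 : M.

Lemma is_path_comp (x y : M) (a : R -> M) : is_path x y a -> is_path (f x) (f y) (f \o a).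
Proof.
move=> [ca <- <-]; split => //.
by move=> t; apply: (continuous_comp (ca t)); exact: f_cont.
Qed.

Lemma loop_lift_eq (x y : M) (a b : R -> M) :
  is_path x0 x a -> is_path x0 y b -> f x = f x0 -> f y = f x0 ->
  loop_homotopic (f x0) (f \o a) (f \o b) -> x = y /\ (x = x0 -> loop_homotopic x0 a b).
Proof.
move=> pa pb fx fy /loop_homotopicP [H [cH HE H0 H1 Hxy]].
have ca := path_clamp_continuous pa; have cb := path_clamp_continuous pb.
have [_ a0 a1] := pa; have [_ b0 b1] := pb.
pose a' := a \o @unit_clamp R; pose b' := b \o @unit_clamp R.
have a'0 : a' 0 = x0 by rewrite /a' /= unit_clamp_id ?unit0.
have b'0 : b' 0 = x0 by rewrite /b' /= unit_clamp_id ?unit0.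
have a'E t : a' t = a' (unit_clamp t) by rewrite /a' /= (unit_clamp_id (unit_clamp_in _)).
have b'E t : b' t = b' (unit_clamp t) by rewrite /b' /= (unit_clamp_id (unit_clamp_in _)).
have TH : total_homotopy (f x0) (f \o a') (f \o b') H.
  split => //.
  + by move=> t; rewrite H0 /= -a'E.
  + by move=> t; rewrite H1 /= -b'E.
have [H' E] := homotopy_lift M_hausdorff f_cont f_open f_inj f_section erefl ca a'0 cb b'0 a'E b'E TH.
move: H' E; rewrite /= (unit_clamp_id (unit1 R)) a1 b1 => -> E; split=> // /E.
move=> /loop_homotopicP [G [cG GE G0 G1 Gxy]]; exists G; split.
- exact: continuous_subspaceT.
- by move=> t t01; rewrite G0 /= !unit_clamp_id ?unit_clamp_in.
- by move=> t t01; rewrite G1 /= !unit_clamp_id ?unit_clamp_in.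
- by move=> s _; case: Gxy.
- by move=> s _; case: Gxy.
Qed.

Lemma pi1_surjective_injective :
  (forall b : R -> N, is_path (f x0) (f x0) b ->
    exists2 a : R -> M, is_path x0 x0 a & loop_homotopic (f x0) b (f \o a)) ->
  injective f.
Proof.
move=> surj.
have inj0 x : f x = f x0 -> x = x0.
  move=> fx; have [a pa] := M_path x0 x.
  have [b pb ab] := surj (f \o a) ltac:(by rewrite -{2}fx; exact: is_path_comp).
  by have [-> _] := loop_lift_eq pa pb fx erefl ab.
move=> x y fxy.
(* The hypothesis only concerns loops at [f x0]. For another fibre, the image of a path from [x] to
   [x0] is lifted from [y]; this lift ends over [f x0], hence at [x0], and uniqueness read from the
   end gives [x = y]. *)
have [a pa] := M_path x x0.
have ca := path_clamp_continuous pa; have [_ a0 a1] := pa.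
pose b t := f (a (unit_clamp t)).
have cb : continuous b := cont_comp ca f_cont.
have [p [cp p0 pE]] : exists p : R -> M, [/\ continuous p, p 0 = y & forall t, f (p t) = b t].
  apply: (path_lift f_section cb); last by rewrite /b unit_clamp_id ?unit0 // a0.
  by move=> t; rewrite /b (unit_clamp_id (unit_clamp_in _)).
have p1 : p 1 = x0.
  by apply: inj0; rewrite pE /b unit_clamp_id ?unit1 // a1.
have h : forall t, p t = a (unit_clamp t).
  apply: (lift_unique M_hausdorff f_inj (t0 := 1)) => //.
  by rewrite p1 unit_clamp_id ?unit1.
by rewrite -p0 h unit_clamp_id ?unit0.
Qed.

(** The range is open because [f] is, and closed because a section through one point above a
    neighbourhood [V] covers all of [V]. *)
Lemma covering_surjective : connected [set: N] -> forall y, exists x, f x = y.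
Proof.
move=> cN; suff E : range f = setT.
  by move=> y; have : range f y; [rewrite E|case=> x _ <-; exists x].
have oR : open (range f) by apply: f_open; exact: openT.
apply: cN; first by exists (f x0), x0.
- by exists (range f); rewrite ?setTI.
- exists (range f); last by rewrite setTI.
  rewrite -openC openE => y ny.
  have [V nV secV] := f_section y.
  apply: filterS (open_nbhs_nbhs nV) => z Vz [x _ fx]; apply: ny.
  have [|s _ sV] := secV x; first by rewrite fx.
  by exists (s y) => //; have [] := sV y (nbhs_singleton (open_nbhs_nbhs nV)).
Qed.

Lemma pi1_loop_surjective :
  simply_connected R N \/
    [/\ pi1_isomorphic R x0 (f x0), finite_set (pi1 R x0) & finite_set (pi1 R (f x0))] ->
  forall b : R -> N, is_path (f x0) (f x0) b ->
    exists2 a : R -> M, is_path x0 x0 a & loop_homotopic (f x0) b (f \o a).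
Proof.
have cx : is_path x0 x0 (fun _ : R => x0) by exact: (path_of_continuous (@cont_cst R M x0)).
move=> [[_ sc] b pb|[[h [hfun hinj hsurj] _] fM fN] b pb].
  by exists (fun=> x0) => //; exact: sc.
have repP (C : set (R -> M)) : exists a, pi1 R x0 C -> is_path x0 x0 a /\ loop_class x0 a = C.
  have [[a pa aC]|nC] := pselect (pi1 R x0 C); last by exists (fun=> x0) => /nC.
  by exists a.
have [rep repE] := choice repP.
have hinvP (D : set (R -> N)) : exists C, pi1 R (f x0) D -> pi1 R x0 C /\ h C = D.
  have [/hsurj [C pC hC]|nD] := pselect (pi1 R (f x0) D); last by exists set0 => /nD.
  by exists C.
have [k kE] := choice hinvP.
(* The inverse of [h] followed by the map induced by [f], as a self-map of the classes of [N].
   Lifting homotopies makes it injective, hence onto since there are finitely many classes. *)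
pose g D := loop_class (f x0) (f \o rep (k D)).
have gB D : pi1 R (f x0) D -> pi1 R (f x0) (g D).
  move=> pD; have [pk _] := kE D pD; have [pr _] := repE _ pk.
  by exists (f \o rep (k D)) => //; exact: is_path_comp.
have gi : {in pi1 R (f x0) &, injective g}.
  move=> D D'; rewrite !inE => pD pD' E.
  have [pk kD] := kE D pD; have [pr rD] := repE _ pk.
  have [pk' kD'] := kE D' pD'; have [pr' rD'] := repE _ pk'.
  have H := loop_class_eq (is_path_comp pr') E.
  have [_ /(_ erefl) HM] := loop_lift_eq pr pr' erefl erefl H.
  by rewrite -kD -kD' -rD -rD' (eq_loop_class HM).
have [|D pD gD] := finite_inj_surj fN gB gi (b := loop_class (f x0) b); first by exists b.
have [pk _] := kE D pD; have [pr _] := repE _ pk.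
exists (rep (k D)) => //; apply: loop_homotopic_sym.
exact: loop_class_eq.
Qed.

Theorem covering_homeomorphism : connected [set: N] ->
  simply_connected R N \/
    [/\ pi1_isomorphic R x0 (f x0), finite_set (pi1 R x0) & finite_set (pi1 R (f x0))] ->
  homeomorphism f.
Proof.
move=> cN hpi; split; first exact: f_cont.
have inj := pi1_surjective_injective (pi1_loop_surjective hpi).
have [g gE] := choice (covering_surjective cN).
have fg x : g (f x) = x by apply: inj; rewrite gE.
exists g; split => // y A nA.
have : nbhs y (f @` A^°).
  apply: open_nbhs_nbhs; split; first by apply: f_open; exact: open_interior.
  by exists (g y) => //; exact: nA.
by apply: filterS => _ [x Ax <-] /=; rewrite fg; exact: interior_subset.
Qed.

End CoveringHomeomorphism.

(** * Charts and Finsler norms *)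

Section ChartBasics.
Variables (R : realType) (n : nat) (M : c1_manifold R n).
Implicit Types (c : chart R n M) (x y : M).

Lemma chart_continuous c x : dom c x -> {for x, continuous c}.
Proof.
move=> cx; have := cmap_continuous (c := c).
by rewrite continuous_open_subspace; [apply; rewrite inE|exact: dom_open].
Qed.

Lemma cinv_continuous_at c p : (c @` dom c) p -> {for p, continuous (cinv c)}.
Proof.
move=> cp; have := cinv_continuous (c := c).
by rewrite continuous_open_subspace; [apply; rewrite inE|exact: img_open].
Qed.

Lemma chart_img_nbhs c x : dom c x -> nbhs (c x) (c @` dom c).
Proof. by move=> cx; apply: open_nbhs_nbhs; split; [exact: img_open|exists x]. Qed.

Lemma dom_nbhs c x : dom c x -> nbhs x (dom c).
Proof. by move=> cx; apply: open_nbhs_nbhs; split => //; exact: dom_open. Qed.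

Lemma cmapK c p : (c @` dom c) p -> dom c (cinv c p) /\ c (cinv c p) = p.
Proof. by move=> [y cy <-]; rewrite cinvK. Qed.

Lemma chart_nbhs c x (r : R) : dom c x -> 0 < r ->
  nbhs x [set y | dom c y /\ `|c y - c x| < r].
Proof.
move=> cx r0; have n1 : nbhs x (c @^-1` ball (c x) r).
  by apply: (chart_continuous cx); exact: nbhsx_ballx.
have n3 : nbhs x ((c @^-1` ball (c x) r) `&` dom c).
  by apply: filterI => //; exact: dom_nbhs.
by apply: filterS n3 => y [/mx_ballP].
Qed.

Lemma transition_differentiable c c' x : chart_around x c -> chart_around x c' ->
  differentiable (c' \o cinv c) (c x).
Proof.
move=> [ac cx] [ac' c'x]; have [H _] := atlas_compatible ac ac'.
by case: (H (c x)) => //; exists x.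
Qed.

Lemma chart_diff_inv_transition c c' x w : chart_around x c -> chart_around x c' ->
  chart_diff_inv c x w = chart_diff_inv c' x ('d (c' \o cinv c) (c x) w).
Proof.
move=> cx c'x; rewrite -[LHS](chart_diffK c'x); congr chart_diff_inv.
rewrite /chart_diff /= /chart_diff_inv_val; case: asboolP => [//|[]]; by split.
Qed.

Lemma chart_diffD c x (u v : tangent x) : chart_diff c (u + v) = chart_diff c u + chart_diff c v.
Proof. by []. Qed.

Lemma chart_diffZ c x a (u : tangent x) : chart_diff c (a *: u) = a *: chart_diff c u.
Proof. by []. Qed.

Lemma chart_diff_invD c x u v : chart_around x c ->
  chart_diff_inv c x (u + v) = chart_diff_inv c x u + chart_diff_inv c x v.
Proof.
by move=> cx; rewrite -[RHS](chart_diffK cx) chart_diffD !chart_diff_invK.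
Qed.

Lemma chart_diff_invZ c x a u : chart_around x c ->
  chart_diff_inv c x (a *: u) = a *: chart_diff_inv c x u.
Proof.
by move=> cx; rewrite -[RHS](chart_diffK cx) chart_diffZ !chart_diff_invK.
Qed.

End ChartBasics.

Lemma curve_length_le (R : realType) (V : normedModType R) (g : R -> V) (C : R) :
  (forall t, 0 <= t <= 1 -> forall e, 0 < e -> exists2 d, 0 < d &
     forall s, `|s - t| < d -> `|g s - g t| <= (C + e) * `|s - t|) ->
  `|g 1 - g 0| <= C.
Proof.
move=> h; apply/ler_addgt0Pr => e e0.
pose Phi t := `|g t - g 0| - (C + e) * t.
have : Phi 1 <= Phi 0; last by rewrite /Phi subrr normr0 mulr0 mulr1 subrr subr_le0.
apply: dini_le => [|t /andP[t0 t1]|t e1 /andP[t0 t1] e10]; first exact: ler01.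
  have [d d0 hd] := h t ltac:(by rewrite t0 ltW) e e0.
  exists d => // s /andP[ts sd] s1.
  have := hd s ltac:(by rewrite gtr0_norm ?subr_gt0 // ltrBlDl).
  rewrite gtr0_norm ?subr_gt0 // /Phi => k.
  have : `|g s - g 0| <= `|g s - g t| + `|g t - g 0|.
    by rewrite -[X in `|X| <= _](subrKA (g t)); exact: ler_normD.
  move: k; lra.
have [d d0 hd] := h t ltac:(by rewrite t1 ltW) e e0.
exists d => // s /andP[sd ts] s0.
have := hd s ltac:(by rewrite ltr0_norm ?subr_lt0 // opprB ltrBlDl -ltrBlDr).
rewrite ltr0_norm ?subr_lt0 // /Phi => k.
have : `|g t - g 0| <= `|g s - g t| + `|g s - g 0|.
  by rewrite [X in _ <= X + _]distrC -[X in `|X| <= _](subrKA (g s)); exact: ler_normD.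
move: k; lra.
Qed.

Lemma c1_lipschitz (R : realType) (m n : nat) (A : set 'rV[R]_m) (F : 'rV[R]_m -> 'rV[R]_n) p :
  open A -> A p -> c1_on A F ->
  exists r K : R, [/\ 0 < r, 0 <= K, forall q, `|q - p| < r -> A q &
    forall x y, `|x - p| < r -> `|y - p| < r -> `|F x - F y| <= K * `|x - y|].
Proof.
move=> oA Ap FA; have [_ cJ] := FA p Ap.
have nA : nbhs p A by exact: open_nbhs_nbhs.
have nJ : \forall q \near p, `|jacobian F q - jacobian F p| < 1.
  have n1 : nbhs p (jacobian F @^-1` ball (jacobian F p) 1).
    by apply: cJ; exact: nbhsx_ballx.
  by apply: filterS n1 => q /mx_ballP.
have /nbhs_ballP [r /= r0 hr] : nbhs p (A `&` [set q | `|jacobian F q - jacobian F p| < 1]).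
  by exact: filterI.
pose L := `|jacobian F p| + 1.
exists r, (m%:R * L); split => //.
- by rewrite mulr_ge0 // addr_ge0.
- by move=> q qr; have [] : A q /\ `|jacobian F q - jacobian F p| < 1 by apply: hr; apply/mx_ballP.
move=> x y xr yr.
have seg t : 0 <= t <= 1 -> `|y + t *: (x - y) - p| < r.
  move=> t01; have /andP[t0 t1] := t01.
  rewrite (_ : _ - _ = t *: (x - p) + (1 - t) *: (y - p)); last by vring.
  apply: le_lt_trans (ler_normD _ _) _.
  by rewrite !normrZ (ger0_norm t0) (@ger0_norm _ (1 - t)) ?subr_ge0 //; exact: convex_comb_lt.
have segJ t : 0 <= t <= 1 -> differentiable F (y + t *: (x - y)) /\ `|jacobian F (y + t *: (x - y))| <= L.
  move=> /seg sr.
  have [Aq Jq] : A (y + t *: (x - y)) /\ `|jacobian F (y + t *: (x - y)) - jacobian F p| < 1.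
    by apply: hr; apply/mx_ballP.
  split; first by case: (FA _ Aq).
  rewrite -(subrK (jacobian F p) (jacobian F _)) addrC; apply: le_trans (ler_normD _ _) _.
  by rewrite lerD2l ltW.
have := @curve_length_le R _ (fun t => F (y + t *: (x - y))) (m%:R * L * `|x - y|).
rewrite scale1r scale0r addr0 [y + _]addrC subrK; apply=> t t01 e e0.
have [dF JL] := segJ t t01.
have w1 : 0 < `|x - y| + 1 by rewrite ltr_wpDl.
have /nbhs_ballP[d /= d0 hd] := differentiable_linear_approx dF (divr_gt0 e0 w1).
exists (d / (`|x - y| + 1)); first by rewrite divr_gt0.
move=> s; rewrite ltr_pdivlMr // => sd.
pose h := (s - t) *: (x - y).
have hE : `|h| = `|s - t| * `|x - y| by rewrite normrZ.
have hh := hd h ltac:(by apply/mx_ballP; rewrite subr0 hE (le_lt_trans _ sd) // ler_wpM2l // lerDl).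
rewrite (_ : y + s *: (x - y) = y + t *: (x - y) + h); last by rewrite /h; vring.
rewrite -(subrK (h *m jacobian F (y + t *: (x - y))) (F _ - _)).
apply: le_trans (ler_normD _ _) _; apply: le_trans (lerD hh (mulmx_norm_le _ _)) _.
rewrite addrC mulrDl hE; apply: lerD.
  rewrite (_ : m%:R * L * _ * _ = m%:R * L * (`|s - t| * `|x - y|)); last by ring.
  by apply: ler_wpM2r; rewrite ?mulr_ge0 // ler_wpM2l.
rewrite (_ : _ / _ * _ = e * `|s - t| * (`|x - y| / (`|x - y| + 1))); last by ring.
apply: ler_piMr; first by rewrite mulr_ge0 // ltW.
by apply: ltW; rewrite ltr_pdivrMr // mul1r ltrDl.
Qed.

Lemma continuous_pair_at (X Y Z : topologicalType) (g : X -> Y) (h : X -> Z) x :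
  {for x, continuous g} -> {for x, continuous h} ->
  {for x, continuous (fun x => (g x, h x))}.
Proof.
move=> cg ch; change ((fun x => (g x, h x)) @ x --> (g x, h x)).
by apply: cvg_pair; [exact: cg|exact: ch].
Qed.

Section ChartNorm.
Variables (R : realType) (n : nat) (M : finsler_manifold R n).
Implicit Types (c : chart R n M) (x y : M).

(** The Finsler norm in coordinates: [p] represents a point of the chart and [w] a tangent vector at
    that point. *)
Definition chart_norm c (p w : 'rV[R]_n) : R := fnorm (chart_diff_inv c (cinv c p) w).

Lemma chart_norm_ge0 c p w : 0 <= chart_norm c p w.
Proof. by have [h _ _ _] := fnorm_norm (cinv c p); exact: h. Qed.

Lemma chart_normZ c p a w : atlas c -> (c @` dom c) p -> chart_norm c p (a *: w) = `|a| * chart_norm c p w.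
Proof.
move=> ac /cmapK[cp _]; have [_ _ h _] := fnorm_norm (cinv c p).
by rewrite /chart_norm chart_diff_invZ.
Qed.

Lemma chart_normD c p v w : atlas c -> (c @` dom c) p -> chart_norm c p (v + w) <= chart_norm c p v + chart_norm c p w.
Proof.
move=> ac /cmapK[cp _]; have [_ _ _ h] := fnorm_norm (cinv c p).
by rewrite /chart_norm chart_diff_invD.
Qed.

Lemma chart_norm0 c p : atlas c -> (c @` dom c) p -> chart_norm c p 0 = 0.
Proof. by move=> ac cp; rewrite -(scale0r (0 : 'rV[R]_n)) chart_normZ // normr0 mul0r. Qed.

Lemma chart_norm_eq0 c p w : atlas c -> (c @` dom c) p -> chart_norm c p w = 0 -> w = 0.
Proof.
move=> ac /cmapK[cp _]; have [_ h _ _] := fnorm_norm (cinv c p).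
move=> /h w0; have cx : chart_around (cinv c p) c by [].
by rewrite -(chart_diff_invK cx w) w0.
Qed.

Lemma chart_norm_continuous c p w : atlas c -> (c @` dom c) p ->
  {for (p, w), continuous (fun u : 'rV[R]_n * 'rV[R]_n => chart_norm c u.1 u.2)}.
Proof.
move=> ac cp.
pose tb (u : M * 'rV[R]_n) := TangentBundle (chart_diff_inv c u.1 u.2).
have tbc (u : M * 'rV[R]_n) : dom c u.1 -> {for u, continuous tb}.
  move=> cu W; rewrite nbhsE; case=> O [oO Ou] OW.
  change (nbhs u (tb @^-1` W)); rewrite nbhsE.
  exists [set p : M * 'rV[R]_n | dom c p.1 /\ O (TangentBundle (chart_diff_inv c p.1 p.2))].
    split; first exact: oO.
    by split.
  by move=> v [_ /OW].
have [cx cxp] := cmapK cp.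
have h1 : {for (p, w), continuous (fun u : 'rV[R]_n * 'rV[R]_n => (cinv c u.1, u.2))}.
  have k1 : {for (p, w), continuous (fun u : 'rV[R]_n * 'rV[R]_n => cinv c u.1)}.
    apply: (@continuous_comp _ _ _ (fst : 'rV[R]_n * 'rV[R]_n -> _) (cinv c)); first exact: cont_fst.
    exact: cinv_continuous_at.
  exact: (continuous_pair_at k1 (@cont_snd 'rV[R]_n 'rV[R]_n (p, w))).
have h2 : {for (cinv c p, w), continuous ((fun v : tangent_bundle M => fnorm (tb_vec v)) \o tb)}.
  by apply: continuous_comp; [exact: tbc|exact: fnorm_continuous].
exact: (@continuous_comp _ _ _ (fun u : 'rV[R]_n * 'rV[R]_n => (cinv c u.1, u.2)) _ (p, w) h1 h2).
Qed.

(* Compactness of the unit sphere makes the continuity uniform in w. *)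
Lemma chart_norm_unif c p0 (e : R) : atlas c -> (c @` dom c) p0 -> 0 < e ->
  exists2 d, 0 < d & forall p, `|p - p0| < d -> (c @` dom c) p /\
    forall w, `|chart_norm c p w - chart_norm c p0 w| <= e * `|w|.
Proof.
move=> ac cp e0.
have e2 : 0 < e / 2 by rewrite divr_gt0.
have unif : \forall p \near p0, [set w : 'rV[R]_n | `|w| <= 1] `<=`
    [set w | `|chart_norm c p w - chart_norm c p0 w| <= e].
  have /compact_near_coveringP cpt := @closed_ball_compact R 1 n 1.
  apply: (cpt _ (nbhs p0) (fun p w => `|chart_norm c p w - chart_norm c p0 w| <= e)) => w0 _.
  have n0 : nbhs (p0, w0) ((fun u : 'rV[R]_n * 'rV[R]_n => chart_norm c u.1 u.2) @^-1` ball (chart_norm c p0 w0) (e / 2)).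
    have hc := @chart_norm_continuous c p0 w0 ac cp.
    apply: hc; exact: nbhsx_ballx.
  have /nbhs_ballP[d /= d0 hd] := n0.
  exists (ball w0 d, ball p0 d); first by split; exact: nbhsx_ballx.
  move=> [w p] /= [wd pd].
  have k1 : `|chart_norm c p w - chart_norm c p0 w0| < e / 2 by rewrite distrC; apply: (hd (p, w)).
  have k2 : `|chart_norm c p0 w - chart_norm c p0 w0| < e / 2.
    by rewrite distrC; apply: (hd (p0, w)); split => //; exact: ballxx.
  rewrite (_ : _ - _ = (chart_norm c p w - chart_norm c p0 w0) - (chart_norm c p0 w - chart_norm c p0 w0)); last by ring.
  apply: le_trans (ler_normB _ _) _; move: k1 k2; lra.
have {}unif : nbhs p0 ([set p | [set w : 'rV[R]_n | `|w| <= 1] `<=`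
    [set w | `|chart_norm c p w - chart_norm c p0 w| <= e]] `&` (c @` dom c)).
  by apply: filterI => //; apply: open_nbhs_nbhs; split => //; exact: img_open.
have /nbhs_ballP[d /= d0 hd] := unif; exists d => // p pd.
have [h cpp] := hd p ltac:(by apply/mx_ballP); split => // w.
have [->|w0] := eqVneq w 0; first by rewrite !chart_norm0 // subrr !normr0 mulr0.
have wp : 0 < `|w| by rewrite normr_gt0.
have := h (`|w|^-1 *: w); rewrite /= normrZ normfV normr_id mulVf ?gt_eqF //.
move=> /(_ (lexx 1)); rewrite !chart_normZ // normfV normr_id -mulrBr normrM normfV normr_id.
by rewrite mulrC ler_pdivrMr.
Qed.

(** At [p0] the constants are the extrema of the norm on the unit sphere. They extend to nearby
    points by [chart_norm_unif], half of the lower one being given up. *)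
Lemma chart_norm_equiv c p0 : atlas c -> (c @` dom c) p0 -> exists k C d : R,
  [/\ 0 < k, 0 <= C, 0 < d & forall p, `|p - p0| < d -> (c @` dom c) p /\
     forall w, k * `|w| <= chart_norm c p w <= C * `|w|].
Proof.
move=> ac cp.
have e0 (e : R) : 0 < e -> e / 2 < e by move=> ?; lra.
suff [k [C [k0 C0 h]]] : exists k C : R, [/\ 0 < k, 0 <= C &
    forall w, k * `|w| <= chart_norm c p0 w <= C * `|w|].
  have k2 : 0 < k / 2 by rewrite divr_gt0.
  have [d d0 hd] := chart_norm_unif ac cp k2.
  exists (k / 2), (C + k / 2), d; split => // [|p pd]; first by rewrite addr_ge0 // ltW.
  have [cpp hp] := hd p pd; split => // w.
  have := hp w; have /andP[] := h w; rewrite ler_norml => h1 h2 /andP[h3 h4].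
  by apply/andP; move: h1 h2 h3 h4; set a := `|w|; split; lra.
have cont1 : continuous (chart_norm c p0).
  move=> w; have h1 : {for w, continuous (fun w : 'rV[R]_n => (p0, w))}.
    exact: (cont_pair (@cont_cst 'rV[R]_n _ p0) (@cont_id _)).
  exact: (continuous_comp h1 (chart_norm_continuous (p := p0) (w := w) ac cp)).
pose S := [set w : 'rV[R]_n | `|w| = 1].
have cS : compact S.
  apply: (subclosed_compact _ (@closed_ball_compact R 1 n 1)) => [|w /= ->//].
  rewrite (_ : S = (fun w : 'rV[R]_n => `|w|) @^-1` [set 1]); last by [].
  by apply: preimage_closed => [w _|]; [exact: norm_continuous|]; apply: accessible_closed_set1; apply: hausdorff_accessible; exact: norm_hausdorff.
(* The sphere is empty in dimension 0, where all constants will do. *)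
have [[w1 Sw1]|noS] := pselect (S !=set0); last first.
  exists 1, 0; split => // w; suff -> : w = 0 by rewrite normr0 chart_norm0 // !mulr0 lexx.
  apply/eqP; apply: contrapT => /negP w0; apply: noS; exists (`|w|^-1 *: w).
  by rewrite /S /= normrZ normfV normr_id mulVf // normr_eq0.
have S0 : S !=set0 by exists w1.
have [wm Swm wmP] := EVT_min_rV S0 cS (continuous_subspaceT cont1).
have [wM SwM wMP] := EVT_max_rV S0 cS (continuous_subspaceT cont1).
have {wmP wMP} h w : S w -> chart_norm c p0 wm <= chart_norm c p0 w <= chart_norm c p0 wM.
  by move=> Sw; apply/andP; split; [apply: wmP|apply: wMP]; rewrite inE.
move: Swm; rewrite inE => Swm.
exists (chart_norm c p0 wm), (chart_norm c p0 wM); split => [||w].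
- rewrite lt_neqAle chart_norm_ge0 andbT eq_sym; apply/eqP => /(chart_norm_eq0 ac cp) w0.
  by move: Swm; rewrite /S /= w0 normr0 => /eqP; rewrite eq_sym oner_eq0.
- exact: chart_norm_ge0.
have [->|w0] := eqVneq w 0; first by rewrite normr0 chart_norm0 // !mulr0 lexx.
have wp : 0 < `|w| by rewrite normr_gt0.
have := h (`|w|^-1 *: w); rewrite /S /= normrZ normfV normr_id mulVf ?gt_eqF //.
move=> /(_ erefl); rewrite chart_normZ // normfV normr_id [_ * chart_norm c p0 w]mulrC.
by rewrite ler_pdivlMr // ler_pdivrMr.
Qed.
End ChartNorm.

(** * Length and Finsler distance *)

Section Speed.
Variables (R : realType) (n : nat) (M : finsler_manifold R n).
Implicit Types (c : chart R n M) (x y : M) (g : R -> M).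

Definition speed g (t : R) : R := fnorm (velocity g t).

Lemma speed_ge0 g t : 0 <= speed g t.
Proof. by have [h _ _ _] := fnorm_norm (g t); exact: h. Qed.

Lemma speed_near_eq g g' t : (\forall s \near t, g s = g' s) -> speed g t = speed g' t.
Proof.
move=> gg'; have gt := nbhs_singleton gg'.
(* The type of a velocity depends on [g t]; abstracting over the base point permits rewriting it. *)
pose S x (w : 'rV[R]_n) := fnorm (chart_diff_inv (chart_at x) x w).
rewrite -[LHS]/(S (g t) (derive1 (chart_at (g t) \o g) t)).
rewrite -[RHS]/(S (g' t) (derive1 (chart_at (g' t) \o g') t)) -gt; congr (S _ _).
rewrite !derive1E; apply: near_eq_derive.
by apply: filterS gg' => s /= ->.
Qed.

Lemma derive1_comp_diff (m k : nat) (F : 'rV[R]_m -> 'rV[R]_k) (h : R -> 'rV[R]_m) t :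
  derivable h t 1 -> differentiable F (h t) ->
  derivable (F \o h) t 1 /\ derive1 (F \o h) t = 'd F (h t) (derive1 h t).
Proof.
move=> dh dF; have dh' : differentiable h t by exact/derivable1_diffP.
have dFh : differentiable (F \o h) t by exact: differentiable_comp.
split; first exact/derivable1_diffP.
by rewrite !derive1E !deriveE // diff_comp.
Qed.

Lemma speed_chart c g (h : R -> 'rV[R]_n) t : atlas c -> derivable h t 1 ->
  (\forall s \near t, dom c (g s) /\ c (g s) = h s) ->
  speed g t = chart_norm c (h t) (derive1 h t).
Proof.
move=> ac dh gh; have [cg ch] := nbhs_singleton gh.
have gE : cinv c (h t) = g t by rewrite -ch cinvK.
pose S x c' (w : 'rV[R]_n) := fnorm (chart_diff_inv c' x w).
rewrite /speed /velocity -[LHS]/(S (g t) (chart_at (g t)) (derive1 (chart_at (g t) \o g) t)).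
rewrite -[RHS]/(S (cinv c (h t)) c (derive1 h t)) gE.
have [a0 d0] : chart_around (g t) (chart_at (g t)).
  by rewrite /chart_at; case: cid2.
have dT := transition_differentiable (conj ac cg) (conj a0 d0).
have [_ hE] := derive1_comp_diff (F := chart_at (g t) \o cinv c) dh ltac:(by rewrite -ch).
rewrite /S (chart_diff_inv_transition (derive1 h t) (conj ac cg) (conj a0 d0)) ch.
congr (fnorm (chart_diff_inv _ _ _)).
rewrite -hE !derive1E; apply: near_eq_derive.
by apply: filterS gh => s [cs ghs] /=; rewrite -ghs cinvK.
Qed.

Lemma c1_speed a b g t0 : c1_path a b g -> a <= t0 <= b ->
  exists c (h : R -> 'rV[R]_n) d,
  [/\ atlas c, 0 < d, (forall u, `|u - t0| < d -> derivable h u 1 /\ {for u, continuous (derive1 h)}),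
      (forall u, `|u - t0| < d -> a <= u <= b -> dom c (g u) /\ c (g u) = h u) &
      (forall u, `|u - t0| < d -> a < u < b -> speed g u = chart_norm c (h u) (derive1 h u))].
Proof.
move=> /(_ t0); rewrite in_itv /= => pg /pg[c [ac cg] [h [dh gh]]].
have : nbhs t0 ([set s | derivable h s 1 /\ {for s, continuous (derive1 h)}] `&`
    [set s | s \in `[a, b] -> dom c (g s) /\ c (g s) = h s]) by exact: filterI.
move=> /nbhs_ballP[d /= d0 hd].
have H u : `|u - t0| < d -> (derivable h u 1 /\ {for u, continuous (derive1 h)}) /\
    (a <= u <= b -> dom c (g u) /\ c (g u) = h u).
  rewrite distrC => /hd[h1 h2]; split; first exact: h1.
  by move=> uab; apply: h2; rewrite in_itv.
exists c, h, d; split; [exact: ac|exact: d0|by move=> u /H[]|by move=> u /H[]|move=> u ud /andP[au ub]].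
have [[du _] _] := H u ud; apply: speed_chart => //.
have e0 : 0 < Num.min (d - `|u - t0|) (Num.min (u - a) (b - u)).
  by rewrite !lt_min !subr_gt0 ud au ub.
apply/nbhs_ballP; exists (Num.min (d - `|u - t0|) (Num.min (u - a) (b - u))); first exact: e0.
move=> s /= ; rewrite /ball /= !lt_min => /andP[s1 /andP[s2 s3]].
have [_] := H s ltac:(rewrite (_ : s - t0 = (u - t0) - (u - s)); [apply: le_lt_trans (ler_normB _ _) _; move: s1; lra|ring]).
apply; move: s2 s3; rewrite !ltr_norml => /andP[? ?] /andP[? ?]; apply/andP; split; lra.
Qed.

Lemma chart_norm_curve_continuous c (h : R -> 'rV[R]_n) u : atlas c -> (c @` dom c) (h u) ->
  derivable h u 1 -> {for u, continuous (derive1 h)} ->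
  {for u, continuous (fun s => chart_norm c (h s) (derive1 h s))}.
Proof.
move=> ac hcp du cu.
have ch : {for u, continuous h} by have /derivable1_diffP dd := du; exact: (differentiable_continuous dd).
exact: (@continuous_comp _ _ _ (fun s => (h s, derive1 h s)) _ u (continuous_pair_at ch cu) (chart_norm_continuous (p := h u) (w := derive1 h u) ac hcp)).
Qed.

(** Interior times only: at [a] and [b] the velocity is a two-sided derivative and depends on the
    values of [g] outside the interval. *)
Lemma c1_path_continuous a b g u : c1_path a b g -> a < u < b ->
  {for u, continuous (speed g)}.
Proof.
move=> pg uab; have /andP[au ub] := uab.
have [c [h [d [ac d0 dh gh sp]]]] := c1_speed pg (t0 := u) ltac:(by rewrite !ltW).
have e0 : 0 < Num.min d (Num.min (u - a) (b - u)) by rewrite !lt_min !subr_gt0 d0 au ub.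
have spu : \forall s \near u, chart_norm c (h s) (derive1 h s) = speed g s.
  apply/nbhs_ballP; exists (Num.min d (Num.min (u - a) (b - u))); first exact: e0.
  move=> s /=; rewrite /ball /= !lt_min => /andP[s1 /andP[s2 s3]].
  rewrite sp // 1?distrC //.
  move: s2 s3; rewrite !ltr_norml => /andP[? ?] /andP[? ?]; apply/andP; split; lra.
have uu : `|u - u| < d by rewrite subrr normr0.
have [du cu] := dh u uu.
have hcp : (c @` dom c) (h u).
  by have [cg <-] := gh u uu ltac:(by rewrite !ltW); exists (g u).
have cc := chart_norm_curve_continuous ac hcp du cu.
have spE := nbhs_singleton spu.
change (speed g s @[s --> u] --> speed g u); rewrite -spE.
by apply: cvg_trans cc; apply: near_eq_cvg.
Qed.

End Speed.

Section IntervalIntegral.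
Variables (R : realType).
Implicit Types (a b s t k : R) (f : R -> R).
Local Notation mu := (@lebesgue_measure R).

Lemma integral_cst_itv s t k : s <= t ->
  (\int[mu]_(u in `]s, t[) k%:E = (k * (t - s))%:E)%E.
Proof.
move=> st; rewrite integral_cst //= lebesgue_measure_itv /= lte_fin.
case: ltP => [_|ts]; first by rewrite -EFinD -EFinM.
by rewrite mule0 (_ : t - s = 0) ?mulr0 //; apply/eqP; rewrite subr_eq0 eq_le st ts.
Qed.

Lemma integral_ge_cst f s t k : s <= t -> (forall u, 0 <= f u) ->
  measurable_fun `[s, t] f -> (forall u, s < u < t -> k <= f u) ->
  ((k * (t - s))%:E <= \int[mu]_(u in `[s, t]) (f u)%:E)%E.
Proof.
move=> st f0 mf kf; have [k0|k0] := leP k 0.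
  apply: (@le_trans _ _ 0%E); last by apply: integral_ge0 => u _; rewrite lee_fin.
  by rewrite lee_fin mulr_le0_ge0 // subr_ge0.
have sub : `]s, t[%classic `<=` `[s, t]%classic by apply: subset_itv; rewrite bnd_simp.
have mf' : measurable_fun `[s, t] (EFin \o f) by exact/measurable_EFinP.
apply: (@le_trans _ _ (\int[mu]_(u in `]s, t[) (f u)%:E)%E); last first.
  by apply: ge0_subset_integral => // u _; rewrite lee_fin.
rewrite -integral_cst_itv //; apply: ge0_le_integral; first by [].
- by move=> u _; rewrite lee_fin ltW.
- by [].
- by apply: measurable_funS (sub) mf'.
by move=> u; rewrite /= in_itv /= lee_fin => /kf.
Qed.

Lemma integral_le_cst f s t k : s <= t -> (forall u, 0 <= f u) ->
  measurable_fun `[s, t] f -> (forall u, s < u < t -> f u <= k) ->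
  (\int[mu]_(u in `[s, t]) (f u)%:E <= (k * (t - s))%:E)%E.
Proof.
move=> st f0 mf kf; have sub : `]s, t[%classic `<=` `[s, t]%classic by apply: subset_itv; rewrite bnd_simp.
have mf' : measurable_fun `]s, t[ (EFin \o f).
  by apply: measurable_funS (sub) _ => //; exact/measurable_EFinP.
rewrite (integral_itv_bndoo _ _ mf') -integral_cst_itv //; apply: ge0_le_integral => //.
by move=> u; rewrite /= in_itv /= lee_fin => /kf.
Qed.

Lemma itvcc_setU a b c : a <= b <= c -> `[a, c]%classic = `[a, b]%classic `|` `]b, c]%classic :> set R.
Proof.
move=> /andP[ab bc]; apply/seteqP; split=> t /=; rewrite !in_itv /=.
  by move=> /andP[at_ tc]; have [tb|bt] := leP t b; [left; rewrite at_|right].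
by move=> [] /andP[h1 h2]; rewrite ?h1 ?h2 ?(le_trans h2) ?(le_trans ab (ltW h1)).
Qed.

Lemma itv_oo_subset a b s t : a <= s -> t <= b -> `]s, t[%classic `<=` `[a, b]%classic.
Proof.
move=> as_ tb u /=; rewrite !in_itv /= => /andP[su ut].
by rewrite (le_trans as_ (ltW su)) (le_trans (ltW ut) tb).
Qed.

Lemma integral_itv_split f a b c : a <= b <= c -> (forall u, 0 <= f u) ->
  measurable_fun `[a, c] f ->
  (\int[mu]_(u in `[a, c]) (f u)%:E =
   \int[mu]_(u in `[a, b]) (f u)%:E + \int[mu]_(u in `[b, c]) (f u)%:E)%E.
Proof.
move=> abc f0 mf; have mf' : measurable_fun `[a, c] (EFin \o f) by exact/measurable_EFinP.
have sub2 : `]b, c]%classic `<=` `[a, c]%classic by rewrite (itvcc_setU abc) => u; right.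
rewrite (itvcc_setU abc) ge0_integral_setU //.
- congr (_ + _)%E; apply: integral_itv_obnd_cbnd.
  by apply: measurable_funS (sub2) _.
- by rewrite -itvcc_setU.
- by move=> u _; rewrite lee_fin.
rewrite disj_set2E; apply/eqP/seteqP; split => // u [] /=; rewrite !in_itv /= => /andP[_ h] /andP[h2 _].
by move: (lt_le_trans h2 h); rewrite ltxx.
Qed.

Lemma measurable_itv_closed f a b :
  (forall u, a < u < b -> {for u, continuous f}) -> measurable_fun `[a, b] f.
Proof.
move=> cf; have [ab|ba] := leP a b; last first.
  rewrite (_ : [set` _] = set0); first exact: measurable_fun_set0.
  by apply/seteqP; split => // u /=; rewrite in_itv /= => /andP[h1 h2]; move: ba; rewrite ltNge (le_trans h1 h2).
have -> : `[a, b]%classic = ([set a] `|` `]a, b[%classic) `|` [set b] :> set R.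
  apply/seteqP; split=> t /=; rewrite !in_itv /=.
    move=> /andP[]; rewrite le_eqVlt => /orP[/eqP ->|ta]; first by left; left.
    by rewrite le_eqVlt => /orP[/eqP ->|tb]; [right|left; right; rewrite ta].
  by move=> [[->|/andP[h1 h2]]|->]; rewrite ?lexx ?ab // !ltW.
apply/measurable_funU => //; first exact: measurableU.
split; last exact: measurable_fun_set1.
apply/measurable_funU => //; split; first exact: measurable_fun_set1.
apply: open_continuous_measurable_fun; first exact: itv_open.
by move=> u; rewrite inE /= in_itv /=; exact: cf.
Qed.

End IntervalIntegral.

(** A transitive relation that holds near each point, on both sides, reaches the supremum of the
    points related to [a], and then goes beyond it unless it is [b]. *)
Lemma interval_chain (R : realType) (Q : R -> R -> Prop) (a b : R) :
  a <= b -> (forall s t u, a <= s <= t -> t <= u <= b -> Q s t -> Q t u -> Q s u) ->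
  (forall t, a <= t <= b -> exists2 d, 0 < d &
     (forall s, a <= s <= t -> t - s < d -> Q s t) /\
     (forall s, t <= s <= b -> s - t < d -> Q t s)) ->
  Q a b.
Proof.
move=> ab tr loc.
pose E := [set t | a <= t <= b /\ Q a t].
have Ea : E a.
  split; first by rewrite lexx.
  have [d d0 [_]] := loc a ltac:(by rewrite lexx).
  by apply; rewrite ?lexx ?subrr.
have ubE : ubound E b by move=> t [/andP[]].
have supE : has_sup E by split; [exists a|exists b].
have aT : a <= sup E by apply: sup_upper_bound.
have Tb : sup E <= b by apply: ge_sup => //; exists a.
have [d d0 [L Rt]] := loc (sup E) ltac:(by rewrite aT).
have QT : Q a (sup E).
  have [t [tab Qt] dt] := sup_adherent d0 supE.
  have tT : t <= sup E by exact: sup_upper_bound.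
  have /andP[at_ tb] := tab.
  apply: (tr _ t) => //; [by rewrite lexx|by rewrite tT|apply: L; [by rewrite at_|]].
  by rewrite ltrBlDr -ltrBlDl.
have [bT|Tb'] := leP b (sup E); first by rewrite (_ : b = sup E) //; apply/eqP; rewrite eq_le bT.
pose s := Num.min b (sup E + d / 2).
have Ts : sup E < s by rewrite lt_min Tb' ltrDl divr_gt0.
have sb : s <= b by rewrite ge_min lexx.
have Es : E s.
  split; first by rewrite sb (le_trans aT (ltW Ts)).
  apply: (tr _ (sup E)) => //; rewrite ?lexx ?aT ?(ltW Ts) //.
  apply: Rt; first by rewrite (ltW Ts).
  have : s <= sup E + d / 2 by rewrite ge_min lexx orbT.
  move: d0; lra.
by have := sup_upper_bound supE Es; rewrite leNgt Ts.
Qed.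

Section Paths.
Variables (R : realType) (n : nat) (M : finsler_manifold R n).
Implicit Types (c : chart R n M) (x y : M) (g : R -> M).

Fixpoint c1_chain g (a : R) (s : seq R) : Prop :=
  if s is x :: s' then c1_path a x g /\ c1_chain g x s' else True.

Lemma c1_chainP g a b s :
  (forall i, (i < size s)%N -> c1_path (nth b (a :: s) i) (nth b (a :: s) i.+1) g) <->
  c1_chain g a s.
Proof.
elim: s a => [|x s ih] a; first by split.
split=> [h|[h1 /ih h2] [|i]//= ]; last by rewrite ltnS => /h2.
by split; [exact: (h 0%N)|apply/ih => i si; exact: (h i.+1)].
Qed.

Lemma c1_chain_cat g a s t :
  c1_chain g a (s ++ t) <-> c1_chain g a s /\ c1_chain g (last a s) t.
Proof. by elim: s a => [|x s ih] a /=; [tauto|have := ih x; tauto]. Qed.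

Lemma c1_path_eq g g' a b : (forall t, a <= t <= b -> g t = g' t) ->
  c1_path a b g -> c1_path a b g'.
Proof.
move=> gg' pg t tab; have [c cg [h [dh hg]]] := pg t tab.
exists c; first by rewrite -gg' // -[_ && _]/(t \in `[a, b]).
exists h; split => //; apply: filterS hg => s hs sab.
by rewrite -gg'; [exact: hs|move: sab; rewrite in_itv].
Qed.

Lemma c1_chain_eq g g' a b s : itv_partition a b s ->
  (forall t, a <= t <= b -> g t = g' t) -> c1_chain g a s -> c1_chain g' a s.
Proof.
elim: s a => [//|x s ih] a ps gg' [h1 h2].
have xb := itv_partition_le (itv_partition_cons ps).
have ax : a <= x by case: ps => /= /andP[/ltW].
split; [apply: c1_path_eq h1|apply: ih h2].
- by move=> t /andP[at_ tx]; rewrite gg' // at_ (le_trans tx).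
- exact: itv_partition_cons ps.
by move=> t /andP[xt tb]; rewrite gg' // tb (le_trans ax).
Qed.

Lemma measurable_speed_chain g a b s : itv_partition a b s -> c1_chain g a s ->
  measurable_fun `[a, b] (speed g).
Proof.
elim: s a => [|x s ih] a ps.
  have -> := itv_partition_nil ps; rewrite set_itv1 => _; exact: measurable_fun_set1.
have px := itv_partition_cons ps; have xb := itv_partition_le px.
have ax : a <= x by case: ps => /= /andP[/ltW].
move=> [h1 h2]; have := ih x px h2 => m2.
rewrite (itvcc_setU (b := x)) ?ax //; apply/measurable_funU => //; split.
  by apply: measurable_itv_closed => u /(c1_path_continuous h1).
apply: measurable_funS m2 => //; apply: subset_itv; rewrite bnd_simp //.
Qed.

Lemma piecewise_c1P a b g : piecewise_c1_path a b g <->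
  [/\ a < b, {within `[a, b], continuous g} & exists2 s, itv_partition a b s & c1_chain g a s].
Proof.
split=> -[ab cg [s ps h]]; split => //; exists s => //; first exact/(@c1_chainP g a b s).
exact/(@c1_chainP g a b s).
Qed.

Lemma measurable_speed g a b : piecewise_c1_path a b g -> measurable_fun `[a, b] (speed g).
Proof. by move=> /piecewise_c1P[_ _ [s ps h]]; exact: measurable_speed_chain ps h. Qed.

Lemma path_lengthE a b g :
  path_length a b g = (\int[lebesgue_measure]_(t in `[a, b]) (speed g t)%:E)%E.
Proof. by []. Qed.

Lemma path_length_ge0 a b g : (0 <= path_length a b g)%E.
Proof. by apply: integral_ge0 => t _; rewrite lee_fin; exact: speed_ge0. Qed.

Lemma fdist_ge0 x y : (0 <= fdist x y)%E.
Proof. by apply/ereal_infP => _ [a [b [g [_ _ _ ->]]]]; exact: path_length_ge0. Qed.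

Lemma fdist_path a b g : piecewise_c1_path a b g ->
  (fdist (g a) (g b) <= path_length a b g)%E.
Proof. by move=> pg; apply: ereal_inf_lbound; exists a, b, g. Qed.

Definition path_glue (b : R) g1 g2 : R -> M := fun t => if t <= b then g1 t else g2 t.

(** Near an interior time of either interval the glued path coincides with the corresponding piece,
    and so do the speeds. The joint [b] may be an exception, which integrals do not see. *)
Lemma path_glueP a b e g1 g2 : piecewise_c1_path a b g1 -> piecewise_c1_path b e g2 ->
  g1 b = g2 b -> piecewise_c1_path a e (path_glue b g1 g2) /\
  path_length a e (path_glue b g1 g2) = (path_length a b g1 + path_length b e g2)%E.
Proof.
move=> /piecewise_c1P[ab c1 [s1 p1 h1]] /piecewise_c1P[be c2 [s2 p2 h2]] gb.
have e1 t : a <= t <= b -> g1 t = path_glue b g1 g2 t by rewrite /path_glue => /andP[_ ->].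
have e2 t : b <= t <= e -> g2 t = path_glue b g1 g2 t.
  rewrite /path_glue => /andP[bt _]; case: ifPn => // tb.
  by rewrite (_ : t = b) //; apply/eqP; rewrite eq_le tb bt.
have pw : piecewise_c1_path a e (path_glue b g1 g2).
  apply/piecewise_c1P; split; first exact: lt_trans ab be.
    have -> : `[a, e]%classic = `[a, b]%classic `|` `[b, e]%classic :> set R.
      apply/seteqP; split => t /=; rewrite !in_itv /=.
        by move=> /andP[h1' h2']; have [tb|/ltW bt] := leP t b; [left; rewrite h1'|right; rewrite bt].
      by move=> [] /andP[h1' h2']; rewrite ?h1' ?h2' ?(le_trans h2' (ltW be)) ?(le_trans (ltW ab) h1').
    apply: withinU_continuous; [exact: interval_closed|exact: interval_closed| |].
      by apply: subspace_eq_continuous c1 => t; rewrite inE /= in_itv /= => /e1.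
    by apply: subspace_eq_continuous c2 => t; rewrite inE /= in_itv /= => /e2.
  exists (s1 ++ s2); first exact: itv_partition_cat p1 p2.
  apply/c1_chain_cat; split; first exact: c1_chain_eq p1 e1 h1.
  have -> : last a s1 = b by case: p1 => _ /eqP.
  exact: c1_chain_eq p2 e2 h2.
split => //.
have abe : a <= b <= e by rewrite !ltW.
have ms := measurable_speed pw.
have sp0 u : 0 <= speed (path_glue b g1 g2) u by exact: speed_ge0.
have E1 : (\int[lebesgue_measure]_(t in `[a, b]) (speed (path_glue b g1 g2) t)%:E =
    \int[lebesgue_measure]_(t in `[a, b]) (speed g1 t)%:E)%E.
  apply: eq_integral_itv_bounded.
  - apply: measurable_funS ms; first by [].
    exact: itv_oo_subset (lexx _) (ltW be).
  - have m1 := measurable_speed_chain p1 h1; apply: measurable_funS m1; first by [].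
    exact: itv_oo_subset (lexx _) (lexx _).
  move=> t; rewrite in_itv /= => /andP[at_ tb]; apply: speed_near_eq.
  have : \forall s \near t, s < b by exact: lt_nbhsl.
  by apply: filterS => s sb; rewrite /path_glue ltW.
have E2 : (\int[lebesgue_measure]_(t in `[b, e]) (speed (path_glue b g1 g2) t)%:E =
    \int[lebesgue_measure]_(t in `[b, e]) (speed g2 t)%:E)%E.
  apply: eq_integral_itv_bounded.
  - apply: measurable_funS ms; first by [].
    exact: itv_oo_subset (ltW ab) (lexx _).
  - have m2 := measurable_speed_chain p2 h2; apply: measurable_funS m2; first by [].
    exact: itv_oo_subset (lexx _) (lexx _).
  move=> t; rewrite in_itv /= => /andP[bt te]; apply: speed_near_eq.
  have : \forall s \near t, b < s by exact: lt_nbhsr.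
  by apply: filterS => s bs; rewrite /path_glue leNgt bs.
by rewrite !path_lengthE (integral_itv_split abe sp0 ms) E1 E2.
Qed.

End Paths.

Section Segments.
Variables (R : realType) (n : nat) (M : finsler_manifold R n).
Implicit Types (c : chart R n M) (x y z : M) (g : R -> M).

Lemma affine_derive (p v : 'rV[R]_n) (b t : R) :
  derivable (fun s : R => p + (s - b) *: v) t 1 /\ derive1 (fun s : R => p + (s - b) *: v) t = v.
Proof.
have h : (fun e : R => e^-1 *: (((fun s : R => p + (s - b) *: v) \o shift t) (e *: (1 : R)) -
    (p + (t - b) *: v))) @ 0^' --> v.
  apply: cvg_near_cst; near=> e.
  have e0 : e != 0 by near: e; exact: nbhs_dnbhs_neq.
  rewrite /= [e *: 1]mulr1 (_ : _ - _ = e *: v); last by vring.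
  by rewrite scalerA mulVf // scale1r.
split; first by apply/cvg_ex; exists v.
by rewrite derive1E; apply: cvg_lim.
Unshelve. all: by end_near. Qed.

Lemma chart_segment c (p q : 'rV[R]_n) (K b : R) : atlas c ->
  (forall t, 0 <= t <= 1 -> (c @` dom c) (p + t *: (q - p)) /\
     chart_norm c (p + t *: (q - p)) (q - p) <= K) ->
  exists g, [/\ piecewise_c1_path b (b + 1) g, g b = cinv c p, g (b + 1) = cinv c q &
     (path_length b (b + 1) g <= K%:E)%E].
Proof.
move=> ac hseg; have b1 : b < b + 1 by rewrite ltrDl.
pose h t := p + (t - b) *: (q - p).
have sg t : t \in `[b, b + 1] -> (c @` dom c) (h t) /\ chart_norm c (h t) (q - p) <= K.
  by rewrite in_itv /= => /andP[t1 t2]; apply: hseg; rewrite subr_ge0 t1 lerBlDl.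
have hd t := affine_derive p (q - p) b t.
have ch : continuous h.
  by move=> t; have [/derivable1_diffP d _] := hd t; exact: (differentiable_continuous d).
have cJ t : {for t, continuous (derive1 h)}.
  rewrite (_ : derive1 h = cst (q - p)); last by apply/funext => s; case: (hd s).
  exact: cvg_cst.
have c1 : c1_path b (b + 1) (cinv c \o h).
  move=> t tb; have [ct _] := sg t tb; have [dt _] := cmapK ct.
  exists c; first by split.
  exists h; split; first by apply/nbhs_ballP; exists 1 => [|s _]; [exact: ltr01|split; [by case: (hd s)|exact: cJ]].
  by apply/nbhs_ballP; exists 1 => [|s _]; [exact: ltr01|by move=> /sg[cs _]; exact: cmapK].
have pg : piecewise_c1_path b (b + 1) (cinv c \o h).
  apply/piecewise_c1P; split => //.
    apply: continuous_in_subspaceT => t; rewrite inE => /sg[cp _].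
    by apply: continuous_comp; [exact: ch|exact: cinv_continuous_at].
  by exists [:: b + 1]; [exact: itv_partition1|split].
exists (cinv c \o h); split; [exact: pg|by rewrite /= /h subrr scale0r addr0| |].
  by rewrite /= /h (_ : b + 1 - b = 1) ?scale1r; [congr (cinv c _); vring|ring].
rewrite path_lengthE.
have := @integral_le_cst R (speed (cinv c \o h)) b (b + 1) K (ltW b1) (@speed_ge0 _ _ _ _) (measurable_speed pg).
rewrite (_ : K * _ = K); last by ring.
apply=> u /andP[u1 u2]; have [cu ku] := sg u ltac:(by rewrite in_itv /= !ltW).
rewrite (speed_chart (h := h) ac); [by case: (hd u) => _ ->|by case: (hd u)|].
have n1 : \forall s \near u, b < s by exact: lt_nbhsr.
have n2 : \forall s \near u, s < b + 1 by exact: lt_nbhsl.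
apply: filterS2 n1 n2 => s s1 s2; have [cs _] := sg s ltac:(by rewrite in_itv /= !ltW).
exact: cmapK.
Qed.

(* The segments are appended to, or prepended to, the competing paths on an
   adjacent unit interval. *)
Lemma fdist_segment c (p q : 'rV[R]_n) (K : R) z : atlas c ->
  (forall t, 0 <= t <= 1 -> (c @` dom c) (p + t *: (q - p)) /\
     chart_norm c (p + t *: (q - p)) (q - p) <= K) ->
  (fdist z (cinv c q) <= fdist z (cinv c p) + K%:E)%E /\
  (fdist (cinv c p) z <= fdist (cinv c q) z + K%:E)%E.
Proof.
move=> ac hseg; split.
  rewrite -leeBlDr //; apply/ereal_infP => _ [a [b [g [pg ga gb ->]]]].
  have [g2 [pg2 g2b g2e l2]] := chart_segment b ac hseg.
  have [pG lG] := path_glueP pg pg2 (etrans gb (esym g2b)).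
  rewrite leeBlDr //; have := fdist_path pG; rewrite lG => h.
  have ab : a <= b by case: pg => /ltW.
  have Ga : path_glue b g g2 a = z by rewrite /path_glue ab.
  have Gb : path_glue b g g2 (b + 1) = cinv c q by rewrite /path_glue leNgt ltrDl ltr01.
  rewrite Ga Gb in h.
  by apply: (le_trans h); rewrite leeD2l.
rewrite -leeBlDr //; apply/ereal_infP => _ [a [b [g [pg ga gb ->]]]].
have [g2 [pg2 g2b g2e l2]] := chart_segment (a - 1) ac hseg.
rewrite subrK in pg2 g2e l2.
have [pG lG] := path_glueP pg2 pg (etrans g2e (esym ga)).
rewrite leeBlDr //; have := fdist_path pG; rewrite lG => h.
have ab : a < b by case: pg.
have Ga : path_glue a g2 g (a - 1) = cinv c p by rewrite /path_glue gerBl ler01.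
have Gb : path_glue a g2 g b = z by rewrite /path_glue leNgt ab.
rewrite Ga Gb in h.
move: l2 h; move: (path_length a b g) (path_length (a - 1) a g2) => L1 L2 l2 h.
by apply: (le_trans h); rewrite addeC leeD2l.
Qed.

Lemma chart_segment_fdist c (p q : 'rV[R]_n) (K : R) : atlas c ->
  (forall t, 0 <= t <= 1 -> (c @` dom c) (p + t *: (q - p)) /\
     chart_norm c (p + t *: (q - p)) (q - p) <= K) ->
  (fdist (cinv c p) (cinv c q) <= K%:E)%E.
Proof.
move=> ac /(chart_segment 0 ac)[g [pg g0 g1 lg]].
by apply: le_trans lg; rewrite -g0 -g1; exact: fdist_path.
Qed.

(** On a small ball of coordinates the norm is almost the one at [x], and balls contain their
    segments. The inequalities with [z] are triangle inequalities with one short side, in each of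
    the two orders of the arguments. *)
Lemma fdist_near c x (e : R) : chart_around x c -> 0 < e ->
  exists2 d, 0 < d & (forall p, `|p - c x| < d -> (c @` dom c) p) /\
  forall p q, `|p - c x| < d -> `|q - c x| < d ->
    let K := chart_norm c (c x) (q - p) + e * `|q - p| in
    (fdist (cinv c p) (cinv c q) <= K%:E)%E /\
    forall z, (fdist z (cinv c q) <= fdist z (cinv c p) + K%:E)%E /\
              (fdist (cinv c p) z <= fdist (cinv c q) z + K%:E)%E.
Proof.
move=> [ac cx] e0; have cp : (c @` dom c) (c x) by exists x.
have [d d0 hd] := chart_norm_unif ac cp e0; exists d => //.
split=> [p /hd[]//|p q pd qd K].
have hseg t : 0 <= t <= 1 -> (c @` dom c) (p + t *: (q - p)) /\
     chart_norm c (p + t *: (q - p)) (q - p) <= K.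
  move=> t01; have /andP[t0 t1] := t01.
  have /hd[h1 /(_ (q - p))] : `|p + t *: (q - p) - c x| < d.
    rewrite (_ : _ - _ = t *: (q - c x) + (1 - t) *: (p - c x)); last by vring.
    apply: le_lt_trans (ler_normD _ _) _.
    by rewrite !normrZ (ger0_norm t0) (@ger0_norm _ (1 - t)) ?subr_ge0 //; exact: convex_comb_lt.
  rewrite ler_norml => /andP[_ h2]; split => //; rewrite /K; move: h2; lra.
split; first exact: chart_segment_fdist.
by move=> z; exact: fdist_segment.
Qed.

End Segments.

Lemma connected_ind (X : topologicalType) (A : set X) x0 : connected [set: X] -> A x0 ->
  (forall x : X, exists2 U, nbhs x U & forall a b, U a -> U b -> A a -> A b) ->
  forall x, A x.
Proof.
move=> conX Ax0 loc x.
suff -> : A = [set: X] by [].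
have ball_in (B : set X) : (forall z, B z -> nbhs z B) -> open B by rewrite openE.
apply: conX; first by exists x0.
- exists A; last by rewrite setTI.
  apply: ball_in => y Ay; have [U nU h] := loc y.
  by have Uy := nbhs_singleton nU; apply: filterS nU => z Uz; exact: (h y).
exists A; last by rewrite setTI.
rewrite -openC; apply: ball_in => y Ay; have [U nU h] := loc y.
by have Uy := nbhs_singleton nU; apply: filterS nU => z Uz Az; apply: Ay; exact: (h z).
Qed.

Section Distance.
Variables (R : realType) (n : nat) (M : finsler_manifold R n).
Implicit Types (c : chart R n M) (x y z : M) (g : R -> M).

Lemma fdist_fin (M_connected : connected [set: M]) x y : (fdist x y < +oo)%E.
Proof.
have atl z : exists c, chart_around z c by have [c ac cz] := atlas_cover z; exists c.
apply: (@connected_ind M [set y | (fdist x y < +oo)%E] x) => //.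
  have [c cx] := atl x; have [d d0 [_ h]] := fdist_near cx ltr01.
  have [] := h (c x) (c x); rewrite ?subrr ?normr0 // cinvK => [l _|]; last by case: cx.
  by apply: le_lt_trans l _; exact: ltry.
move=> z; have [c cz] := atl z; have [d d0 [_ h]] := fdist_near cz ltr01.
exists [set y | dom c y /\ `|c y - c z| < d]; first by apply: chart_nbhs => //; case: cz.
move=> a b [da ad] [db bd] /= fa.
have [_ /(_ x)[+ _]] := h (c a) (c b) ad bd; rewrite !cinvK // => l.
by apply: le_lt_trans l _; rewrite lte_add_pinfty // ltry.
Qed.

Lemma finsler_path_connected (M_connected : connected [set: M]) : path_connected R M.
Proof.
move=> x y; have [_ [a [b [g [pg ga gb _]]]] _] := ereal_inf_lt (fdist_fin M_connected x y).
have [ab cg _] := pg.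
pose al (t : R) := (b - a) * unit_clamp t + a.
have cal : continuous al by apply: cont_affine; exact: unit_clamp_continuous.
have alin t : `[a, b]%classic (al t).
  have /andP[u0 u1] := unit_clamp_in t; have ba : 0 < b - a by rewrite subr_gt0.
  rewrite /= in_itv /= /al lerDr mulr_ge0 ?(ltW ba) //= -lerBrDr.
  by rewrite ler_piMr // ltW.
have cga := within_comp_continuous cg cal alin.
exists (g \o al).
have := path_of_continuous cga.
rewrite /= /al (unit_clamp_id (unit0 R)) (unit_clamp_id (unit1 R)).
by rewrite mulr0 add0r mulr1 subrK ga gb.
Qed.

Lemma derivable_near (V : normedModType R) (g : R -> V) (t e : R) : derivable g t 1 -> 0 < e ->
  \forall s \near t, `|g s - g t - (s - t) *: derive1 g t| <= e * `|s - t|.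
Proof.
move=> /derivable_nbhsP /eqaddoP dg e0.
have n1 : \forall s \near (0 : R), `|g (t + s) - g t - s *: derive1 g t| <= e * `|s|.
  have := dg e e0; apply: filterS => s.
  rewrite /= [`|s|]/= => h; apply: le_trans h.
  rewrite -[X in _ <= `|X|]/((g \o shift t) (s *: 1) - (g t + s *: 'D_1 g t)) /=.
  by rewrite [s *: 1]mulr1 -derive1E [s + t]addrC opprD addrA.
have /nbhs_ballP[d /= d0 h] := n1; apply/nbhs_ballP; exists d => // s.
rewrite /ball /= => sd; have := h (s - t); rewrite /= [t + _]addrC subrK; apply.
by rewrite /ball /= sub0r normrN distrC.
Qed.

Lemma min_dist (r u v : R) : `|Num.min r u - Num.min r v| <= `|u - v|.
Proof.
have [ru|ur] := leP r u; have [rv|vr] := leP r v; rewrite ?subrr ?normr0 //.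
- rewrite ger0_norm ?subr_ge0 ?(ltW vr) //; apply: le_trans (ler_norm _); lra.
- rewrite distrC ger0_norm ?subr_ge0 ?(ltW ur) // distrC.
  by apply: le_trans (ler_norm _); lra.
Qed.

Section ChartDistance.
Variables (c : chart R n M) (x : M) (cx : chart_around x c) (k r d0 : R).
Hypotheses (k0 : 0 < k) (rd0 : r < d0).
Hypothesis chart_norm_k : forall p, `|p - c x| < d0 -> (c @` dom c) p /\
  forall w, k * `|w| <= chart_norm c p w.

(** The distance to [x] in the chart, truncated at [r]. The truncation extends it to the whole
    manifold, so that it can be followed along paths that leave the chart. *)
Definition chart_rho y := if `[< dom c y >] then Num.min r `|c y - c x| else r.

(** [S] is the speed at [t0], computed in a chart adapted to the path. Inside the ball of radius
    [d0] the path is differentiated in the chart [c] and the lower bound [k] applies; otherwise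
    [chart_rho] is constant near [t0]. *)
Lemma chart_rho_loc a b g t0 (e : R) : c1_path a b g -> a <= t0 <= b -> 0 < e ->
  exists S d, [/\ 0 < d,
    forall s, a <= s <= b -> `|s - t0| < d ->
      k * `|chart_rho (g s) - chart_rho (g t0)| <= (S + e) * `|s - t0| &
    forall u, a < u < b -> `|u - t0| < d -> S - e <= speed g u].
Proof.
move=> pg t0ab e0; have [c1 [h [d [ac1 d_0 dh gh sp]]]] := c1_speed pg t0ab.
have tt : `|t0 - t0| < d by rewrite subrr normr0.
have [dg0 gh0] := gh t0 tt t0ab.
have h0 : (c1 @` dom c1) (h t0) by exists (g t0).
have [dh0 cdh0] := dh t0 tt.
pose S := chart_norm c1 (h t0) (derive1 h t0).
have cS := chart_norm_curve_continuous ac1 h0 dh0 cdh0.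
have nS : nbhs t0 ((fun s => chart_norm c1 (h s) (derive1 h s)) @^-1` ball S e).
  by apply: cS; exact: nbhsx_ballx.
have /nbhs_ballP[d1 /= d10 hd1] := nS.
have speedS u : a < u < b -> `|u - t0| < Num.min d d1 -> S - e <= speed g u.
  move=> uab; rewrite lt_min => /andP[ud ud1]; rewrite sp //.
  have : ball S e (chart_norm c1 (h u) (derive1 h u)) by apply: hd1; rewrite /ball /= distrC.
  by rewrite /ball /= ltr_norml => /andP[_]; lra.
have ch : {for t0, continuous (cinv c1 \o h)}.
  apply: continuous_comp; last exact: cinv_continuous_at.
  by have /derivable1_diffP dd := dh0; exact: (differentiable_continuous dd).
have gE s : a <= s <= b -> `|s - t0| < d -> g s = cinv c1 (h s).
  by move=> sab sd; have [ds <-] := gh s sd sab; rewrite cinvK.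
have g0E := gE t0 t0ab tt.
have S0 : 0 <= S by exact: chart_norm_ge0.
have [[cg0 cgd]|nK] := pselect (dom c (g t0) /\ `|c (g t0) - c x| < d0); last first.
  (* A compact set, hence closed because the manifold is separated. Outside it [chart_rho] equals
     [r]. *)
  pose K := cinv c @` [set p | `|p - c x| <= r].
  have cK : closed K.
    apply: compact_closed; first exact: carrier_hausdorff.
    apply: continuous_compact.
      apply: continuous_in_subspaceT => p; rewrite inE /= => pr.
      by apply: cinv_continuous_at; case: (chart_norm_k (le_lt_trans pr rd0)).
    have := @closed_ball_compact R 1 n r => cB.
    have -> : [set p | `|p - c x| <= r] = (fun p => p + c x) @` [set p : 'rV[R]_n | `|p| <= r].
      apply/seteqP; split => [p pr|_ [p pr <-]]; last by rewrite /= addrK.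
      by exists (p - c x) => //=; rewrite subrK.
    apply: continuous_compact cB; apply: continuous_subspaceT.
    apply: (@lipschitz_cont _ _ _ _ 1) => // u v.
    by rewrite mul1r (_ : _ - _ = u - v) //; vring.
  have rhoK y : ~ K y -> chart_rho y = r.
    move=> nKy; rewrite /chart_rho; case: asboolP => // dy.
    apply/min_idPl; rewrite leNgt; apply/negP => yr; apply: nKy.
    by exists (c y); rewrite ?cinvK //= ltW.
  have nK0 : ~ K (g t0).
    move=> [p /= pr pE]; have [cp _] := chart_norm_k (le_lt_trans pr rd0).
    have [cp1 cp2] := cmapK cp; apply: nK; rewrite -pE; split => //.
    by rewrite cp2 (le_lt_trans pr).
  have nn : nbhs t0 ((cinv c1 \o h) @^-1` (~` K)).
    by apply: ch; rewrite /= -g0E; apply: open_nbhs_nbhs; split => //; exact: closed_openC.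
  have /nbhs_ballP[d2 /= d20 hd2] := nn.
  exists S, (Num.min (Num.min d d1) d2); split; first by rewrite !lt_min d_0 d10 d20.
    move=> s sab; rewrite !lt_min => /andP[/andP[sd _] sd2].
    rewrite (rhoK (g t0)) // rhoK; first by rewrite subrr normr0 mulr0 mulr_ge0 // addr_ge0 // ltW.
    by rewrite (gE s sab sd); apply: hd2; rewrite /ball /= distrC.
  by move=> u uab; rewrite lt_min => /andP[+ _]; exact: speedS.
have [ac dx] := cx.
have e2 : 0 < e / k by rewrite divr_gt0.
pose F := c \o cinv c1.
have dF : differentiable F (h t0).
  by rewrite -gh0; apply: transition_differentiable.
have [dFh DFh] := derive1_comp_diff dh0 dF.
have kw : k * `|derive1 (F \o h) t0| <= S.
  have [_ hk] := chart_norm_k cgd; apply: le_trans (hk _) _.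
  rewrite DFh /S /chart_norm -gh0 !cinvK // (@chart_diff_inv_transition _ _ _ c1 c) //.
have n1 := derivable_near dFh e2.
have n2 : nbhs t0 ((cinv c1 \o h) @^-1` dom c).
  by apply: ch; rewrite /= -g0E; exact: dom_nbhs.
have n3 : nbhs t0 ([set s | `|(F \o h) s - (F \o h) t0 - (s - t0) *: derive1 (F \o h) t0| <= e / k * `|s - t0|]
    `&` ((cinv c1 \o h) @^-1` dom c)) by exact: filterI.
have /nbhs_ballP[d2 /= d20 hd2] := n3.
exists S, (Num.min (Num.min d d1) d2); split; first by rewrite !lt_min d_0 d10 d20.
  move=> s sab; rewrite !lt_min => /andP[/andP[sd _] sd2].
  have [l1 l2] := hd2 s ltac:(by rewrite /ball /= distrC).
  have gs := gE s sab sd.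
  have r0' : chart_rho (g t0) = Num.min r `|(F \o h) t0 - c x|.
    by rewrite /chart_rho; case: asboolP => // _; rewrite /F /= -g0E.
  have rs : chart_rho (g s) = Num.min r `|(F \o h) s - c x|.
    by rewrite /chart_rho gs; case: asboolP => // nl; case: nl; exact: l2.
  rewrite r0' rs.
  have h1 : k * `|(F \o h) s - (F \o h) t0| <= (S + e) * `|s - t0|.
    have : `|(F \o h) s - (F \o h) t0| <= e / k * `|s - t0| + `|s - t0| * `|derive1 (F \o h) t0|.
      rewrite -normrZ -[X in `|X| <= _](subrK ((s - t0) *: derive1 (F \o h) t0)).
      by apply: le_trans (ler_normD _ _) _; rewrite lerD2r; exact: l1.
    rewrite -(ler_pM2l k0) => h1; apply: (le_trans h1).
    have -> : k * (e / k * `|s - t0| + `|s - t0| * `|derive1 (F \o h) t0|) =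
      (k * `|derive1 (F \o h) t0| + e) * `|s - t0| by field; rewrite gt_eqF.
    by rewrite ler_wpM2r // lerD2r.
  apply: le_trans h1; rewrite ler_pM2l //; apply: le_trans (min_dist _ _ _) _.
  apply: le_trans (ler_dist_dist _ _) _.
  by rewrite (_ : _ - _ - (_ - _) = (F \o h) s - (F \o h) t0) //; vring.
by move=> u uab; rewrite lt_min => /andP[+ _]; exact: speedS.
Qed.

(** On each $C^1$ piece, the rate at which [chart_rho] varies and the speed are both compared with
    the same number [S] near a given time, and [interval_chain] adds up the local estimates. *)
Lemma chart_rho_length a b g : piecewise_c1_path a b g ->
  ((k * (chart_rho (g a) - chart_rho (g b)))%:E <= path_length a b g)%E.
Proof.
move=> /piecewise_c1P[_ _ [s ps hs]]; rewrite path_lengthE.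
elim: s a ps hs => [|t s ih] a ps; first by rewrite (itv_partition_nil ps) subrr mulr0 => _; apply: integral_ge0 => u _; rewrite lee_fin speed_ge0.
have pt := itv_partition_cons ps; have tb := itv_partition_le pt.
have at_ : a <= t by case: ps => /= /andP[/ltW].
move=> ch; have [h1 h2] := ch.
have ms := measurable_speed_chain ps ch.
have atb : a <= t <= b by rewrite at_.
have sp0 u : 0 <= speed g u by exact: speed_ge0.
rewrite (integral_itv_split atb sp0 ms).
rewrite (_ : k * _ = k * (chart_rho (g a) - chart_rho (g t)) + k * (chart_rho (g t) - chart_rho (g b))); last by ring.
rewrite EFinD; apply: leeD; last exact: ih.
have m1 : measurable_fun `[a, t] (speed g).
  by apply: measurable_itv_closed => u /(c1_path_continuous h1).
apply/lee_addgt0Pr => e e0.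
(* The two comparisons with [S] cost [2 * e1] per unit of time, at most [e] in all. *)
pose e1 := e / (2 * (t - a + 1)).
have ta : 0 < t - a + 1 by rewrite ltr_wpDl // subr_ge0.
have e10 : 0 < e1 by rewrite divr_gt0 // mulr_gt0.
pose Q s t := ((k * (chart_rho (g s) - chart_rho (g t)))%:E <=
  \int[lebesgue_measure]_(u in `[s, t]) (speed g u)%:E + (2 * e1 * (t - s))%:E)%E.
suff Qat : Q a t.
  apply: (le_trans Qat); apply: leeD => //; rewrite lee_fin.
  rewrite (_ : 2 * e1 * (t - a) = e * ((t - a) / (t - a + 1))); last by rewrite /e1; field; rewrite gt_eqF.
  by apply: ler_piMr; [exact: ltW|rewrite ler_pdivrMr // mul1r lerDl].
have msub u v : a <= u -> v <= t -> measurable_fun `[u, v] (speed g).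
  move=> au vt; apply: measurable_funS m1; first by [].
  move=> w /=; rewrite !in_itv /= => /andP[uw wv].
  by rewrite (le_trans au uw) (le_trans wv vt).
apply: (@interval_chain R Q a t at_).
  move=> u v w /andP[au uv] /andP[vw wt] Q1 Q2.
  have uvw : u <= v <= w by rewrite uv.
  rewrite /Q (integral_itv_split uvw sp0 (msub _ _ au wt)).
  rewrite (_ : k * _ = k * (chart_rho (g u) - chart_rho (g v)) + k * (chart_rho (g v) - chart_rho (g w))); last by ring.
  rewrite (_ : 2 * e1 * (w - u) = 2 * e1 * (v - u) + 2 * e1 * (w - v)); last by ring.
  by rewrite !EFinD addeACA; apply: leeD.
move=> u uat; have [S [d [d_0 L1 L2]]] := chart_rho_loc h1 uat e10.
have /andP[au ut] := uat.
have side v w : a <= v -> v <= w -> w <= t -> (u = v \/ u = w) -> w - v < d ->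
    k * `|chart_rho (g v) - chart_rho (g w)| <= (S + e1) * (w - v) -> Q v w.
  move=> av vw wt uvw wvd l1; rewrite /Q.
  have l2 : (((S - e1) * (w - v))%:E <= \int[lebesgue_measure]_(u in `[v, w]) (speed g u)%:E)%E.
    apply: integral_ge_cst => //; first exact: msub.
    move=> z /andP[vz zw]; apply: L2.
      by rewrite (le_lt_trans av vz) (lt_le_trans zw wt).
    by case: uvw => ->; rewrite ltr_norml; apply/andP; split; lra.
  apply: le_trans (leeD2r _ l2); rewrite -EFinD lee_fin.
  have l3 : k * (chart_rho (g v) - chart_rho (g w)) <= k * `|chart_rho (g v) - chart_rho (g w)|.
    by rewrite ler_pM2l // ler_norm.
  by apply: (le_trans l3); apply: (le_trans l1); move: (w - v) => z; lra.
exists d => //; split=> v /andP[v1 v2] vd.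
  apply: side => //; [by right|].
  by have := L1 v ltac:(by rewrite v1 (le_trans v2)); rewrite ler0_norm ?subr_le0 // opprB; apply.
apply: side => //; [by left|].
rewrite distrC; have := L1 v ltac:(by rewrite v2 (le_trans au v1)).
by rewrite ger0_norm ?subr_ge0 //; apply.
Qed.

End ChartDistance.

(** The counterpart of [fdist_near]: along a path to [x] from a point outside the chart ball,
    [chart_rho] drops from [r1] to 0, so the path has length at least [k * r1]. *)
Lemma fdist_small c x (r : R) : chart_around x c -> 0 < r ->
  exists2 d : R, 0 < d & forall y, (fdist y x < d%:E)%E -> dom c y /\ `|c y - c x| < r.
Proof.
move=> cx r0; have [ac dx] := cx.
have [k [C [d0 [k0 C0 d00 hd]]]] := chart_norm_equiv ac (ltac:(by exists x) : (c @` dom c) (c x)).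
pose r1 := Num.min r (d0 / 2).
have r10 : 0 < r1 by rewrite lt_min r0 divr_gt0.
have r1d : r1 < d0 by rewrite gt_min; apply/orP; right; move: d00; lra.
have hk p : `|p - c x| < d0 -> (c @` dom c) p /\ forall w, k * `|w| <= chart_norm c p w.
  by move=> /hd[cp h]; split => // w; case/andP: (h w).
exists (k * r1); first exact: mulr_gt0.
move=> y /ereal_inf_lt[_ [a [b [g [pg ga gb ->]]]] lg].
have := le_lt_trans (chart_rho_length cx k0 r1d hk pg) lg.
rewrite lte_fin ltr_pM2l // ga gb.
have -> : chart_rho c x r1 x = 0.
  by rewrite /chart_rho; case: asboolP => // _; rewrite subrr normr0; apply/min_idPr; exact: ltW.
rewrite subr0 /chart_rho; case: asboolP => [dy|]; last by rewrite ltxx.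
rewrite gt_min ltxx /= => yr; split => //; apply: lt_le_trans yr _.
by rewrite ge_min lexx.
Qed.

End Distance.

(** * Local inversion from the co-norm *)

Section LocalInversion.
Variables (R : realType) (n : nat) (M N : finsler_manifold R n) (f : M -> N).
Hypothesis f_lipschitz : locally_lipschitz f.
Implicit Types (x y : M).

Lemma chart_img_open (T : c1_manifold R n) (c : chart R n T) (O : set T) :
  open O -> open (c @` (dom c `&` O)).
Proof.
move=> oO; rewrite openE => _ [y [cy Oy] <-].
have cp : (c @` dom c) (c y) by exists y.
have n1 : nbhs (c y) (cinv c @^-1` O).
  by apply: (cinv_continuous_at cp); rewrite cinvK //; apply: open_nbhs_nbhs.
have n2 : nbhs (c y) (cinv c @^-1` O `&` (c @` dom c)).
  by apply: filterI => //; exact: chart_img_nbhs.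
by apply: filterS n2 => p [/= Op /cmapK[dp pE]]; exists (cinv c p).
Qed.

(** The definition provides some chart at [f x]; the transition to the prescribed one is $C^1$,
    hence Lipschitz near the point. *)
Lemma lipschitz_in_charts x psi0 : chart_around (f x) psi0 ->
  exists phi, chart_around x phi /\ exists r K : R, [/\ 0 < r, 0 <= K,
    forall p, `|p - phi x| < r -> (phi @` dom phi) p /\ dom psi0 (f (cinv phi p)) &
    forall p q, `|p - phi x| < r -> `|q - phi x| < r ->
      `|(psi0 \o f \o cinv phi) p - (psi0 \o f \o cinv phi) q| <= K * `|p - q|].
Proof.
move=> [ap0 dp0]; have [phi [psi [cx [apsi dpsi] fdom [W [nW Wphi] lipW]]]] := f_lipschitz x.
exists phi; split => //; have [aphi dx] := cx.
have [K [K0 FK]] : exists K : R, 0 <= K /\ forall p q, W p -> W q ->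
    `|(psi \o f \o cinv phi) p - (psi \o f \o cinv phi) q| <= K * `|p - q|.
  have [K [_ hK]] := lipW; exists (`|K| + 1); split; first by rewrite addr_ge0.
  move=> p q Wp Wq; have Kl : K < `|K| + 1 by rewrite ltr_pwDr // ler_norm.
  by have := hK _ Kl (p, q); apply; split.
set F := psi \o f \o cinv phi in FK.
have Fx : F (phi x) = psi (f x) by rewrite /F /= cinvK.
have [C1T _] := atlas_compatible apsi ap0.
have [r1 [K1 [r10 K10 sub1 FK1]]] := c1_lipschitz (@chart_img_open N psi _ (dom_open psi0))
  (ltac:(by exists (f x)) : (psi @` (dom psi `&` dom psi0)) (psi (f x))) C1T.
have /nbhs_ballP[r2 /= r20 hW] := nW.
have Kp : 0 < K + 1 by rewrite ltr_wpDl.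
pose r := Num.min r2 (r1 / (K + 1)).
have rr : 0 < r by rewrite lt_min r20 divr_gt0.
have Wr p : `|p - phi x| < r -> W p.
  by rewrite lt_min => /andP[pr _]; apply: hW; apply/mx_ballP.
have Wx : W (phi x) by exact: nbhs_singleton.
have Fr p : `|p - phi x| < r -> `|F p - psi (f x)| < r1.
  move=> pr; have := FK p (phi x) (Wr p pr) Wx; rewrite Fx => h.
  apply: le_lt_trans h _; move: pr; rewrite lt_min ltr_pdivlMr // => /andP[_].
  by apply: le_lt_trans; rewrite mulrC ler_wpM2l // lerDl.
have Fd p : `|p - phi x| < r -> [/\ (phi @` dom phi) p, dom psi0 (f (cinv phi p)) &
    cinv psi (F p) = f (cinv phi p)].
  move=> pr; have phip := Wphi _ (Wr p pr); have [dp pE] := cmapK phip.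
  have dpsip : dom psi (f (cinv phi p)) by apply: fdom; exists (cinv phi p).
  have E : cinv psi (F p) = f (cinv phi p) by rewrite /F /= cinvK.
  split => //; have [y [y1 y2] yE] := sub1 _ (Fr p pr).
  by rewrite -E -yE cinvK.
exists r, (K1 * K); split => //; first exact: mulr_ge0.
  by move=> p /Fd[].
move=> p q pr qr; have [_ _ pE] := Fd p pr; have [_ _ qE] := Fd q qr.
have := FK1 (F p) (F q) (Fr p pr) (Fr q qr); rewrite /= pE qE => h.
by apply: (le_trans h); rewrite -mulrA ler_wpM2l // FK //; exact: Wr.
Qed.

(** The matrix is turned into a linear map between tangent spaces, which belongs to the Clarke
    differential, and is evaluated at [w] divided by its norm. *)
Lemma conorm_clarke x phi psi (k : R) A w : chart_around x phi -> chart_around (f x) psi ->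
  0 < k -> (k%:E < conorm f x)%E -> clarke_euclidean (psi \o f \o cinv phi) (phi x) A ->
  k * chart_norm phi (phi x) w <= chart_norm psi (psi (f x)) (w *m A).
Proof.
move=> cx cfx k0 kf hA; have [aphi dx] := cx; have [apsi dfx] := cfx.
have ip : (phi @` dom phi) (phi x) by exists x.
have iq : (psi @` dom psi) (psi (f x)) by exists (f x).
pose B0 (v : tangent x) := chart_diff_inv psi (f x) (chart_diff phi v *m A).
have linB : linear B0.
  move=> a u v; rewrite /B0 chart_diffD chart_diffZ mulmxDl -scalemxAl.
  by rewrite chart_diff_invD // chart_diff_invZ.
pose B : {linear tangent x -> tangent (f x)} :=
  HB.pack B0 (GRing.isLinear.Build R (tangent x) (tangent (f x)) *:%R B0 linB).
have [->|w0] := eqVneq w 0; first by rewrite mul0mx !chart_norm0 // mulr0.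
have nw : 0 < chart_norm phi (phi x) w.
  rewrite lt_neqAle chart_norm_ge0 andbT eq_sym; apply/eqP => /(chart_norm_eq0 aphi ip) w00.
  by rewrite w00 eqxx in w0.
pose w1 := (chart_norm phi (phi x) w)^-1 *: w.
have w11 : fnorm (chart_diff_inv phi x w1) = 1.
  have : chart_norm phi (phi x) w1 = 1 by rewrite /w1 chart_normZ // gtr0_norm ?invr_gt0 // mulVf // gt_eqF.
  by rewrite /chart_norm cinvK.
have Bw : fnorm (B (chart_diff_inv phi x w1)) = chart_norm psi (psi (f x)) (w1 *m A).
  rewrite -[B _]/(B0 _) /B0 chart_diff_invK // /chart_norm cinvK //.
have := lt_le_trans kf (_ : conorm f x <= (chart_norm psi (psi (f x)) (w1 *m A))%:E)%E.
rewrite lte_fin /w1 -scalemxAl chart_normZ // gtr0_norm ?invr_gt0 // => h.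
suff : k < (chart_norm phi (phi x) w)^-1 * chart_norm psi (psi (f x)) (w *m A).
  by rewrite mulrC ltr_pdivlMr // => /ltW.
apply: h; rewrite /conorm; apply: ge_ereal_inf.
exists (ereal_inf [set (fnorm (B v))%:E | v in [set v | fnorm v = 1]]).
  by exists B => //; exists phi, psi; split => //; exists A.
apply: ge_ereal_inf; exists (fnorm (B (chart_diff_inv phi x w1)))%:E.
  by exists (chart_diff_inv phi x w1).
by rewrite Bw /w1 -scalemxAl chart_normZ // gtr0_norm ?invr_gt0.
Qed.

Lemma conorm_hull x phi psi (k : R) A w : chart_around x phi -> chart_around (f x) psi ->
  0 < k -> (k%:E < conorm f x)%E -> clarke_hull (psi \o f \o cinv phi) (phi x) A ->
  k * chart_norm phi (phi x) w <= chart_norm psi (psi (f x)) (w *m A).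
Proof.
move=> cx cfx k0 kf hA; have [apsi dfx] := cfx.
have iq : (psi @` dom psi) (psi (f x)) by exists (f x).
have [k' [C [d [k'0 C0 d0 hd]]]] := chart_norm_equiv apsi iq.
have [|_ hC] := hd (psi (f x)); first by rewrite subrr normr0.
apply/ler_addgt0Pr => e e0.
pose L := C * (n%:R * `|w|) + 1.
have L0 : 0 < L by rewrite ltr_wpDl // !mulr_ge0.
have [A' [cA' /mx_ballP AA']] := hA _ (nbhsx_ballx A _ (divr_gt0 e0 L0)).
apply: le_trans (conorm_clarke w cx cfx k0 kf cA') _.
have -> : w *m A' = w *m A + w *m (A' - A) by rewrite -mulmxDr addrC subrK.
apply: le_trans (chart_normD _ _ apsi iq) _; rewrite lerD2l.
have /andP[_ h] := hC (w *m (A' - A)); apply: (le_trans h).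
have h2 : C * `|w *m (A' - A)| <= C * (n%:R * `|w|) * `|A' - A|.
  rewrite -mulrA ler_wpM2l //; apply: le_trans (mulmx_norm_le _ _) _.
  by rewrite -!mulrA ler_wpM2l // mulrC.
apply: (le_trans h2); move: AA'; rewrite ltr_pdivlMr // => AA'.
apply: ltW; apply: le_lt_trans AA'; rewrite mulrC ler_wpM2l // /L lerDl //.
Qed.

Lemma real_between (k : R) (l : \bar R) : (k%:E < l)%E -> exists2 k2 : R, k < k2 & (k2%:E < l)%E.
Proof.
case: l => [l| |] //; last by exists (k + 1); rewrite ?ltrDl // ltry.
rewrite lte_fin => kl; exists ((k + l) / 2); rewrite ?lte_fin; lra.
Qed.

(** Matrices of the hull expand by some [k2] larger than [k], and the difference [k2 - k] absorbs
    all local errors. The final estimate is the infinitesimal form of the statement that the inverse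
    of [f] is 1/k-Lipschitz: the norm on the side of [N] is frozen at [f x]. *)
Lemma local_inversion x (k : R) psi : chart_around (f x) psi -> 0 < k -> (k%:E < conorm f x)%E ->
  (exists U, open_nbhs x U /\ forall y z, U y -> U z -> f y = f z -> y = z) /\
  (forall V, nbhs x V -> nbhs (f x) (f @` V)) /\
  {for x, continuous f} /\
  exists2 U, nbhs x U & forall y z, U y -> U z -> [/\ dom psi (f y), dom psi (f z) &
    let L := k^-1 * chart_norm psi (psi (f x)) (psi (f z) - psi (f y)) in
    (fdist y z <= L%:E)%E /\
    forall w, (fdist w z <= fdist w y + L%:E)%E /\ (fdist y w <= fdist z w + L%:E)%E].
Proof.
move=> cfx k0 kf; have [phi [cx [r [K [r0 K0 sub FK]]]]] := lipschitz_in_charts cfx.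
have [aphi dx] := cx; have [apsi dfx] := cfx.
have ip : (phi @` dom phi) (phi x) by exists x.
have iq : (psi @` dom psi) (psi (f x)) by exists (f x).
pose F := psi \o f \o cinv phi.
have Fx : F (phi x) = psi (f x) by rewrite /F /= cinvK.
have [k2 kk2 k2f] := real_between kf.
have k20 : 0 < k2 by exact: lt_trans kk2.
have hull A w := @conorm_hull x phi psi k2 A w cx cfx k20 k2f.
have [a [C1 [d1 [a0 C10 d10 hd1]]]] := chart_norm_equiv aphi ip.
have [|_ na] := hd1 (phi x); first by rewrite subrr normr0.
have [b [C [d2 [b0 C0 d20 hd2]]]] := chart_norm_equiv apsi iq.
have [|_ nC] := hd2 (psi (f x)); first by rewrite subrr normr0.
have Cp : 0 < C + 1 by rewrite ltr_wpDl.
(* The expansion in terms of coordinates: [a] bounds the norm of [M] from below and [C] that of [N]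
   from above. *)
pose kap := k2 * a / (C + 1).
have kap0 : 0 < kap by rewrite divr_gt0 // mulr_gt0.
have coer A (w : 'rV[R]_n) : clarke_hull F (phi x) A -> kap * `|w| <= `|w *m A|.
  move=> hA; have h1 := hull A w hA.
  have /andP[h2 _] := na w; have /andP[_ h3] := nC (w *m A).
  rewrite /kap mulrAC ler_pdivrMr // -mulrA.
  apply: (@le_trans _ _ (k2 * chart_norm phi (phi x) w)); first by rewrite ler_pM2l.
  apply: (le_trans h1); apply: (le_trans h3); rewrite mulrC ler_wpM2l // lerDl //.
have [d /andP[dd0 dr] [inj opn]] := clarke_local_inverse r0 K0 FK kap0 coer.
rewrite -/F in inj opn.
have subd p : `|p - phi x| < d -> (phi @` dom phi) p /\ dom psi (f (cinv phi p)).
  by move=> pd; apply: sub; apply: lt_le_trans pd _; apply: (le_trans dr); lra.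
have subx y : dom phi y -> `|phi y - phi x| < d -> dom psi (f y) /\ F (phi y) = psi (f y).
  by move=> dy /subd[_]; rewrite /F /= cinvK.
split; [|split; [|split]].
- have nU := chart_nbhs dx dd0; rewrite nbhsE in nU; have [U oU hU] := nU.
  exists U; split => // y z Uy Uz fyz.
  have [dy yd] := hU y Uy; have [dz zd] := hU z Uz.
  have := inj _ _ yd zd; have [_ Ey] := subx y dy yd; have [_ Ez] := subx z dz zd.
  have kap2 : 0 < kap / 2 by rewrite divr_gt0.
  rewrite Ey Ez fyz subrr normr0 (pmulr_rle0 _ kap2) => yz0.
  have /eqP E : phi y == phi z by rewrite -subr_eq0 -normr_le0.
  by rewrite -(cinvK dy) E cinvK.
- move=> V nV.
  have n1 : nbhs (phi x) (cinv phi @^-1` V) by apply: (cinv_continuous_at ip); rewrite cinvK.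
  have /nbhs_ballP[r1 /= r10 hV] := n1.
  have r2 : 0 < Num.min r1 d by rewrite lt_min r10.
  have [eta eta0 heta] := opn _ r2.
  apply: filterS (chart_nbhs dfx eta0) => z [dz zeta].
  have [p pr pE] := heta (psi z) ltac:(by rewrite Fx).
  move: pr; rewrite lt_min => /andP[pr1 prd].
  exists (cinv phi p); first by apply: hV; apply/mx_ballP.
  have [dp dfp] := subd p prd.
  by rewrite -(cinvK dfp) -[psi (f _)]/(F p) pE cinvK.
- have nF : {for phi x, continuous F}.
    by apply: (lipschitz_near_cont K0 FK); rewrite subrr normr0.
  have nFphi : {for x, continuous (F \o phi)} by apply: continuous_comp; [exact: chart_continuous|].
  have nG : {for x, continuous (cinv psi \o (F \o phi))}.
    apply: continuous_comp => //; apply: cinv_continuous_at; by rewrite /= Fx.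
  have E : \forall y \near x, (cinv psi \o (F \o phi)) y = f y.
    apply: filterS (chart_nbhs dx dd0) => y [dy yd].
    by have [dfy Ey] := subx y dy yd; rewrite /= Ey cinvK.
  have Ex := nbhs_singleton E.
  change (f y @[y --> x] --> f x); rewrite -Ex.
  by apply: cvg_trans nG; apply: near_eq_cvg.
have Ck0 : 0 < C + k + 1 by rewrite ltr_wpDl // addr_ge0 // ltW.
(* The error [eps] occurs with weight [C] in the increment of [f] and with weight [k] in the
   distance on [M]; together they stay below [k2 - k] times the norm. *)
pose eps := (k2 - k) * a / (C + k + 1).
have eps0 : 0 < eps by rewrite divr_gt0 // mulr_gt0 // subr_gt0.
have [d3 /andP[d30 _] incl] := clarke_inclusion r0 K0 FK eps0.
rewrite -/F in incl.
have [d4 d40 [_ near4]] := fdist_near cx eps0.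
have dm : 0 < Num.min d (Num.min d3 d4) by rewrite !lt_min dd0 d30.
exists [set y | dom phi y /\ `|phi y - phi x| < Num.min d (Num.min d3 d4)]; first exact: chart_nbhs.
move=> y z [dy]; rewrite !lt_min => /andP[yd /andP[yd3 yd4]] [dz].
rewrite !lt_min => /andP[zd /andP[zd3 zd4]].
have [dfy Ey] := subx y dy yd; have [dfz Ez] := subx z dz zd.
split => // L.
have [A hA FA] := incl (phi y) (phi z - phi y) yd3 ltac:(by rewrite [phi y + _]addrC subrK).
have [l1 l2] := near4 _ _ yd4 zd4.
rewrite !cinvK // in l1 l2.
pose K' := chart_norm phi (phi x) (phi z - phi y) + eps * `|phi z - phi y|.
have KL : K' <= L.
  rewrite /L ler_pdivlMl // /K'.
  have h1 := hull A (phi z - phi y) hA.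
  have /andP[h2 _] := na (phi z - phi y).
  move: FA; rewrite [phi y + _]addrC subrK Ey Ez => FA.
  have h3 : chart_norm psi (psi (f x)) ((phi z - phi y) *m A) <=
      chart_norm psi (psi (f x)) (psi (f z) - psi (f y)) + C * (eps * `|phi z - phi y|).
    rewrite -[X in chart_norm _ _ X <= _](subrK (psi (f z) - psi (f y))) addrC.
    apply: le_trans (chart_normD _ _ apsi iq) _; rewrite lerD2l.
    have /andP[_ h] := nC ((phi z - phi y) *m A - (psi (f z) - psi (f y))).
    by apply: (le_trans h); rewrite ler_wpM2l // distrC.
  have h4 : (C + k) * (eps * `|phi z - phi y|) <= (k2 - k) * chart_norm phi (phi x) (phi z - phi y).
    apply: (@le_trans _ _ ((k2 - k) * (a * `|phi z - phi y|))); last first.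
      by rewrite ler_pM2l // subr_gt0.
    rewrite [leLHS]mulrA [leRHS]mulrA ler_wpM2r // /eps.
    have -> : (C + k) * ((k2 - k) * a / (C + k + 1)) = (k2 - k) * a * ((C + k) / (C + k + 1)) by ring.
    apply: ler_piMr; first by apply: mulr_ge0; [rewrite subr_ge0|]; exact: ltW.
    by rewrite ler_pdivrMr // mul1r lerDl.
  move: h1 h3 h4; lra.
split.
  by apply: (le_trans l1); rewrite lee_fin.
move=> w; have [w1 w2] := l2 w; split.
  by apply: (le_trans w1); rewrite leeD2l // lee_fin.
by apply: (le_trans w2); rewrite leeD2l // lee_fin.
Qed.

End LocalInversion.

(** * Divergence of the integral of the co-norm *)

Section Growth.
Variables (R : realType).
Local Notation leb := (@lebesgue_measure R).

(** [G s] is the integral of [mu] over [0, s]. As [mu] is nonincreasing, its value at the left end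
    bounds the growth of [G], and monotone convergence makes [G] unbounded. *)
Lemma integral_growth (mu : R -> R) : {homo mu : s t /~ s <= t} ->
  (forall s, 0 <= mu s <= 1) -> (\int[leb]_(t in `[0%R, +oo[) (mu t)%:E = +oo)%E ->
  exists G : R -> R, (forall s t, 0 <= s <= t -> G s <= G t <= G s + mu s * (t - s)) /\
    forall L, exists2 s, 0 <= s & L < G s.
Proof.
move=> mono mu01 muy.
have mu0 s : 0 <= mu s by case/andP: (mu01 s).
have mm (a b : R) : measurable_fun `[a, b] mu by apply: nonincreasing_measurable => // s t; exact: mono.
pose I (a b : R) : \bar R := (\int[leb]_(t in `[a, b]) (mu t)%:E)%E.
have I0 a b : (0 <= I a b)%E by apply: integral_ge0 => t _; rewrite lee_fin.
have Ile a b : a <= b -> (I a b <= (mu a * (b - a))%:E)%E.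
  by move=> ab; apply: integral_le_cst => // u /andP[/ltW au _]; exact: mono.
have Ifin a b : a <= b -> I a b \is a fin_num.
  by move=> ab; rewrite ge0_fin_numE //; exact: le_lt_trans (Ile a b ab) (ltry _).
exists (fun s => fine (I 0 s)); split.
  move=> s t st /=; have /andP[s0 st'] := st; have t0 := le_trans s0 st'.
  have -> : I 0 t = (I 0%R s + I s t)%E by exact: integral_itv_split.
  have -> : fine (I 0%R s + I s t)%E = fine (I 0 s) + fine (I s t) by rewrite fineD ?Ifin.
  have h : fine (I s t) <= mu s * (t - s) by rewrite -lee_fin fineK ?Ifin // Ile.
  by rewrite lerDl fine_ge0 //= lerD2l.
move=> L; apply: contrapT => noS.
have GL s : 0 <= s -> (I 0%R s <= L%:E)%E.
  move=> s0; rewrite -(fineK (Ifin 0 s s0)) lee_fin leNgt; apply/negP => Ls.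
  by apply: noS; exists s.
pose F (i : nat) : set R := `[0%R, (0 + i%:R)%R]%classic.
have cv : (fun i => \int[leb]_(x in F i) (mu x)%:E)%E @ \oo -->
    (\int[leb]_(x in \bigcup_i F i) (mu x)%:E)%E.
  apply: ge0_nondecreasing_set_cvg_integral.
  - move=> i j ij; apply/subsetPset => u; rewrite /F /= !in_itv /= !add0r => /andP[-> h].
    by rewrite (le_trans h) // ler_nat.
  - by move=> i; exact: measurable_itv.
  - by move=> i; apply/measurable_EFinP; exact: mm.
  - by move=> i x _; rewrite lee_fin.
rewrite /F -itv_bndy_bigcup_BRight muy -/F in cv.
have : (+oo <= L%:E :> \bar R)%E; last by rewrite leye_eq.
rewrite -(cvg_lim _ cv) //; apply: lime_le; first by apply/cvg_ex; exists +oo%E.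
by exists 0%N => // i _; rewrite add0r; exact: GL.
Qed.

End Growth.

Section ConormGrowth.
Variables (R : realType) (n : nat) (M N : finsler_manifold R n) (f : M -> N).
Hypothesis f_lipschitz : locally_lipschitz f.
Variable x0 : M.
Hypothesis m_integral : (\int[lebesgue_measure]_(t in `[0%R, +oo[)
                     conorm_on_ball f x0 t = +oo)%E.

Lemma conorm_ge0 x : (0 <= conorm f x)%E.
Proof.
apply/ereal_infP => _ [B _ <-]; apply/ereal_infP => _ [v _ <-]; rewrite lee_fin.
by have [h _ _ _] := fnorm_norm (f x); exact: h.
Qed.

Lemma fdistxx (x : M) : (fdist x x <= 0%:E)%E.
Proof.
have [c ac cx] := atlas_cover x; have [d d0 [_ h]] := fdist_near (conj ac cx) ltr01.
have [] := h (c x) (c x); rewrite ?subrr ?normr0 // cinvK // mulr0 addr0.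
by rewrite chart_norm0 //; exists x.
Qed.

Lemma conorm_on_ball_mono s t : s <= t -> (conorm_on_ball f x0 t <= conorm_on_ball f x0 s)%E.
Proof.
move=> st; apply: ereal_inf_le_tmp => _ [x xs <-]; exists x => //.
by rewrite /fclosed_ball /= in xs *; apply: (le_trans xs); rewrite lee_fin.
Qed.

Lemma conorm_fin x : (0 < n)%N -> (conorm f x < +oo)%E.
Proof.
move=> n0; have [psi apsi dfx] := atlas_cover (f x).
have [phi [cx [r [K [r0 K0 sub FK]]]]] := lipschitz_in_charts f_lipschitz (conj apsi dfx).
have [aphi dx] := cx.
have [A lA] := clarke_limits_nonempty r0 K0 FK.
have hA : clarke_euclidean (psi \o f \o cinv phi) (phi x) A by exact: sub_gen_smallest.
have [i _] : exists i : 'I_n, True by exists (Ordinal n0).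
rewrite ltNge; apply/negP; rewrite leye_eq => /eqP cy.
have ip : (phi @` dom phi) (phi x) by exists x.
pose w : 'rV[R]_n := delta_mx 0 i.
have w0 : w != 0.
  apply/eqP => /matrixP /(_ 0 i); rewrite !mxE !eqxx => /eqP; by rewrite oner_eq0.
have nw : 0 < chart_norm phi (phi x) w.
  rewrite lt_neqAle chart_norm_ge0 andbT eq_sym; apply/eqP => /(chart_norm_eq0 aphi ip) w00.
  by rewrite w00 eqxx in w0.
pose k := (chart_norm psi (psi (f x)) (w *m A) + 1) / chart_norm phi (phi x) w.
have k0 : 0 < k by rewrite divr_gt0 // ltr_wpDl // chart_norm_ge0.
have := @conorm_clarke R n M N f x phi psi k A w cx (conj apsi dfx) k0 ltac:(by rewrite cy ltry) hA.
by rewrite /k divfK ?gt_eqF // gerDl ler10.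
Qed.

Lemma conorm_dim0 x : n = 0%N -> conorm f x = +oo%E.
Proof.
move=> n0; apply/eqP; rewrite -leye_eq; apply/ereal_infP => _ [B _ <-].
apply/ereal_infP => _ [v /= v1 <-].
have [c ac cx] := atlas_cover x.
have [_ _ hZ _] := fnorm_norm x.
have vz : v = 0 *: v.
  rewrite -[LHS](chart_diffK (conj ac cx)) -[RHS](chart_diffK (conj ac cx)) chart_diffZ.
  congr chart_diff_inv; apply/rowP => i; exfalso.
  by have := ltn_ord i; move: (nat_of_ord i) => k; rewrite n0 ltn0.
by move: v1; rewrite vz hZ normr0 mul0r => /eqP; rewrite eq_sym oner_eq0.
Qed.

Lemma conorm_growth : exists G mu : R -> R, [/\
  forall s, 0 <= s -> 0 < mu s <= 1,
  forall y s, (fdist x0 y <= s%:E)%E -> ((mu s)%:E <= conorm f y)%E,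
  forall s t, 0 <= s <= t -> G s <= G t <= G s + mu s * (t - s) &
  forall L, exists2 s, 0 <= s & L < G s].
Proof.
pose m := conorm_on_ball f x0.
have m0 s : (0 <= m s)%E by apply/ereal_infP => _ [x _ <-]; exact: conorm_ge0.
(* The co-norm is cut at 1, since it is +oo in dimension 0. *)
pose cut (c : R) s := fine (mine (m s) c%:E).
have cutE c s : 0 <= c -> (cut c s)%:E = mine (m s) c%:E.
  move=> c0; rewrite /cut fineK // ge0_fin_numE; first by rewrite gt_min ltry orbT.
  by rewrite le_min m0 lee_fin.
have cut0 c s : 0 <= c -> 0 <= cut c s by move=> c0; rewrite -lee_fin cutE // le_min m0 lee_fin.
have cut_mono c : 0 <= c -> {homo cut c : s t /~ s <= t}.
  move=> c0 s t st; rewrite -lee_fin !cutE // le_min !ge_min lexx !orbT andbT.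
  by rewrite conorm_on_ball_mono.
pose mu := cut 1; have muE s : (mu s)%:E = mine (m s) 1%E by exact: cutE.
have mono : {homo mu : s t /~ s <= t} by exact: cut_mono.
have mu01 s : 0 <= mu s <= 1 by rewrite cut0 //= -lee_fin muE ge_min lexx orbT.
have muy : (\int[lebesgue_measure]_(t in `[0%R, +oo[) (mu t)%:E = +oo)%E.
  have [n0|n0] := posnP n.
    (* In dimension 0 there is no unit vector, so [m] is infinite and its cut is the constant 1. *)
    transitivity (\int[lebesgue_measure]_(t in `[0%R, +oo[) (cst (1 : \bar R) (t : R)))%E.
      apply: eq_integral => t _; rewrite muE; apply/min_idPr.
      rewrite (_ : m t = +oo%E) ?leey //.
      by apply/eqP; rewrite -leye_eq; apply/ereal_infP => _ [x _ <-]; rewrite conorm_dim0.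
    by rewrite integral_cst //= lebesgue_measure_itv /= ltry mul1e sube0.
  have cf : conorm f x0 \is a fin_num by rewrite ge0_fin_numE ?conorm_ge0 ?conorm_fin.
  (* Every ball contains [x0], so [m] is bounded by [c], hence by [c] times its cut at 1: divergence
     survives the cut. *)
  pose c := Num.max 1 (fine (conorm f x0)).
  have c1 : 1 <= c by rewrite le_max lexx.
  have c0 : 0 <= c by exact: le_trans c1.
  have mc t : 0 <= t -> m t = (cut c t)%:E.
    move=> t0; rewrite cutE //; apply/esym/min_idPl.
    apply: (@le_trans _ _ (conorm f x0)).
      apply: ereal_inf_lbound; exists x0 => //.
      by apply: le_trans (fdistxx x0) _; rewrite lee_fin.
    by rewrite -(fineK cf) lee_fin le_max lexx orbT.
  have le1 : (\int[lebesgue_measure]_(t in `[0%R, +oo[) m t <=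
      \int[lebesgue_measure]_(t in `[0%R, +oo[) (c%:E * (mu t)%:E))%E.
    have -> : (\int[lebesgue_measure]_(t in `[0%R, +oo[) m t =
        \int[lebesgue_measure]_(t in `[0%R, +oo[) (cut c t)%:E)%E.
      by apply: eq_integral => t; rewrite inE /= in_itv /= andbT => /mc.
    apply: ge0_le_integral => //.
    - by move=> t _; rewrite lee_fin cut0.
    - by apply/measurable_EFinP; apply: nonincreasing_measurable => // s t; exact: cut_mono.
    - by apply: measurable_funeM; apply/measurable_EFinP; apply: nonincreasing_measurable => // s t; exact: mono.
    move=> t _; rewrite muE cutE //.
    have [mt|mt] := leP (m t) 1%E.
      apply: (@le_trans _ _ (m t)); first by rewrite ge_min lexx.
      by rewrite -[leLHS]mul1e; apply: lee_wpmul2r => //; rewrite lee_fin.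
    by rewrite mule1 ge_min lexx orbT.
  move: le1; rewrite m_integral ge0_integralZl_EFin //; last 2 first.
  - by move=> t _; rewrite lee_fin cut0.
  - by apply/measurable_EFinP; apply: nonincreasing_measurable => // s t; exact: mono.
  rewrite leye_eq => /eqP h; apply/eqP; rewrite -leye_eq leNgt; apply/negP => lt.
  have : (c%:E * \int[lebesgue_measure]_(t in `[0%R, +oo[) (mu t)%:E)%E \is a fin_num.
    rewrite fin_numM // ge0_fin_numE //; apply: integral_ge0 => t _; rewrite lee_fin cut0 //.
  by rewrite h.
have [G [G1 G2]] := integral_growth mono mu01 muy.
exists G, mu; split => //.
  move=> s s0; case/andP: (mu01 s) => h ->; rewrite andbT lt_neqAle h andbT.
  (* If [mu s] were 0, [G] would not grow after [s] and would be bounded. *)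
  apply/eqP => mus; have [t t0] := G2 (G s).
  have [ts|st] := leP t s.
    by rewrite ltNge; case/andP: (G1 t s ltac:(by rewrite t0)) => ->.
  by case/andP: (G1 s t ltac:(by rewrite s0 ltW)) => _; rewrite -mus mul0r addr0 leNgt => /negbTE ->.
move=> y s ys; rewrite muE; apply: (@le_trans _ _ (m s)); first by rewrite ge_min lexx.
by apply: ereal_inf_lbound; exists y.
Qed.

End ConormGrowth.

(** * Lifting segments of charts *)

(** The constant [K'] may depend on [t]: it only provides the semicontinuity that [dini_le] asks on
    the left. *)
Lemma one_sided_lipschitz (R : realType) (phi : R -> R) (K a b : R) : a <= b ->
  (forall t, a <= t <= b -> exists d K' : R, 0 < d /\ forall s, a <= s <= b -> `|s - t| < d ->
     phi s <= phi t + K * `|s - t| /\ phi t <= phi s + K' * `|s - t|) ->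
  phi b <= phi a + K * (b - a).
Proof.
move=> ab h; suff : phi b - K * b <= phi a - K * a by lra.
apply: (@dini_le R (fun t => phi t - K * t)) => //.
  move=> t /andP[at_ tb]; have [d [K' [d0 hd]]] := h t ltac:(by rewrite at_ ltW).
  exists d => // s /andP[ts sd] sb.
  have [h1 _] := hd s ltac:(by rewrite (le_trans at_ (ltW ts))) ltac:(by rewrite gtr0_norm ?subr_gt0 // ltrBlDl).
  by move: h1; rewrite gtr0_norm ?subr_gt0 //; lra.
move=> t e /andP[at_ tb] e0; have [d [K' [d0 hd]]] := h t ltac:(by rewrite tb ltW).
pose L := `|K'| + `|K| + 1.
have L0 : 0 < L by rewrite ltr_wpDl // addr_ge0.
exists (Num.min d (e / L)); first by rewrite lt_min d0 divr_gt0.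
move=> s /andP[ds st] as_.
have sdL : t - s < Num.min d (e / L) by rewrite ltrBlDl -ltrBlDr.
move: sdL; rewrite lt_min ltr_pdivlMr // => /andP[sd sL].
have [_ h1] := hd s ltac:(by rewrite as_ (le_trans (ltW st))) ltac:(by rewrite distrC gtr0_norm ?subr_gt0).
move: h1; rewrite distrC gtr0_norm ?subr_gt0 // => h1.
have ts : 0 < t - s by rewrite subr_gt0.
have h2 : K' * (t - s) <= `|K'| * (t - s) by rewrite ler_pM2r // ler_norm.
have h3 : - K * (t - s) <= `|K| * (t - s) by rewrite ler_pM2r // -normrN ler_norm.
move: h1 h2 h3 sL; rewrite /L; lra.
Qed.

Section LiftEstimates.
Variables (R : realType) (n : nat) (M N : finsler_manifold R n) (f : M -> N).
Hypothesis M_connected : connected [set: M].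
Hypothesis f_lipschitz : locally_lipschitz f.
Variables (x0 : M) (G mu : R -> R).
Hypothesis mu01 : forall s, 0 <= s -> 0 < mu s <= 1.
Hypothesis mu_conorm : forall y s, (fdist x0 y <= s%:E)%E -> ((mu s)%:E <= conorm f y)%E.
Hypothesis Gmu : forall s t, 0 <= s <= t -> G s <= G t <= G s + mu s * (t - s).
Hypothesis G_unbounded : forall L, exists2 s, 0 <= s & L < G s.

Let Gmu' s t : 0 <= s -> s <= t -> G s <= G t <= G s + mu s * (t - s).
Proof. by move=> s0 st; apply: Gmu; rewrite s0. Qed.

Lemma fdistE (x y : M) : fdist x y = (fine (fdist x y))%:E.
Proof. by rewrite fineK // ge0_fin_numE ?fdist_ge0 ?fdist_fin. Qed.

Definition rad (x : M) : R := fine (fdist x0 x).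

Lemma rad_ge0 x : 0 <= rad x.
Proof. by rewrite fine_ge0 // fdist_ge0. Qed.

(** Local inversion requires a strict inequality, which halving the bound provides. *)
Lemma half_mu_conorm x s : rad x <= s -> 0 < mu s / 2 /\ ((mu s / 2)%:E < conorm f x)%E.
Proof.
move=> rs; have s0 := le_trans (rad_ge0 x) rs; have /andP[m0 _] := mu01 s0.
split; first by rewrite divr_gt0.
apply: (@lt_le_trans _ _ (mu s)%:E); first by rewrite lte_fin; lra.
by apply: mu_conorm; rewrite fdistE lee_fin.
Qed.

Lemma inversion_at x psi : chart_around (f x) psi ->
  (exists U, open_nbhs x U /\ forall y z, U y -> U z -> f y = f z -> y = z) /\
  (forall V, nbhs x V -> nbhs (f x) (f @` V)) /\ {for x, continuous f}.
Proof.
move=> cfx; have [k0 kf] := half_mu_conorm (lexx (rad x)).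
by have [h1 [h2 [h3 _]]] := local_inversion f_lipschitz cfx k0 kf.
Qed.

Lemma f_continuous : continuous f.
Proof.
move=> x; have [psi apsi dfx] := atlas_cover (f x).
by have [_ [_ h]] := inversion_at (conj apsi dfx).
Qed.

Lemma f_locally_injective x :
  exists2 U, open_nbhs x U & forall a b, U a -> U b -> f a = f b -> a = b.
Proof.
have [psi apsi dfx] := atlas_cover (f x).
by have [[U [oU hU]] _] := inversion_at (conj apsi dfx); exists U.
Qed.

Lemma f_image_open O : open O -> open (f @` O).
Proof.
move=> oO; rewrite openE => _ [x Ox <-].
have [psi apsi dfx] := atlas_cover (f x).
have [_ [h _]] := inversion_at (conj apsi dfx).
by apply: h; apply: open_nbhs_nbhs.
Qed.

Section Line.
Variables (psi : chart R n N) (c0 a b : 'rV[R]_n) (eta C : R).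
Hypothesis apsi : atlas psi.
Hypothesis nuC : forall q, `|q - c0| < eta -> (psi @` dom psi) q /\
  forall w, chart_norm psi q w <= C * `|w|.
Hypotheses (C0 : 0 <= C) (aeta : `|a - c0| < eta) (beta : `|b - c0| < eta).

Definition chart_line (t : R) : N := cinv psi (a + unit_clamp t *: (b - a)).

Lemma chart_line_in t : `|a + unit_clamp t *: (b - a) - c0| < eta.
Proof.
have t01 := unit_clamp_in t; have /andP[t0 t1] := t01.
rewrite (_ : _ - _ = unit_clamp t *: (b - c0) + (1 - unit_clamp t) *: (a - c0)); last by vring.
apply: le_lt_trans (ler_normD _ _) _.
by rewrite !normrZ (ger0_norm t0) (@ger0_norm _ (1 - _)) ?subr_ge0 //; exact: convex_comb_lt.
Qed.

Lemma chart_line_continuous : continuous chart_line.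
Proof.
have ca : continuous (fun t => a + unit_clamp t *: (b - a)).
  apply: (cont_comp (@unit_clamp_continuous R) (h := fun t : R => a + t *: (b - a))).
  apply: (@lipschitz_cont _ R^o _ _ `|b - a|) => // u v.
  by rewrite (_ : _ - _ = (u - v) *: (b - a)) ?normrZ 1?mulrC //; vring.
move=> t; have [ht _] := nuC (chart_line_in t).
exact: (@continuous_comp _ _ _ (fun t => a + unit_clamp t *: (b - a)) (cinv psi) t (ca t) (cinv_continuous_at ht)).
Qed.

Section Lift.
Variables (p : R -> M) (T : R).
Hypotheses (p_cont : continuous p) (T01 : 0 <= T <= 1).
Hypothesis p_lift : forall t, 0 <= t <= T -> f (p t) = chart_line t.

Lemma lift_chart t : 0 <= t <= T -> dom psi (f (p t)) /\ psi (f (p t)) = a + t *: (b - a).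
Proof.
move=> tT; have /andP[t0 tT'] := tT; have /andP[_ T1] := T01.
have t1 : unit_clamp t = t by apply: unit_clamp_id; rewrite in_itv /= t0 (le_trans tT').
rewrite p_lift // /chart_line t1; apply: cmapK.
by have := nuC (chart_line_in t); rewrite t1 => -[].
Qed.

Lemma lift_local t k : 0 <= t <= T -> 0 < k -> (k%:E < conorm f (p t))%E ->
  exists2 d, 0 < d & forall s s', 0 <= s <= T -> 0 <= s' <= T -> `|s - t| < d -> `|s' - t| < d ->
  let L := C * `|b - a| / k * `|s' - s| in
  (fdist (p s) (p s') <= L%:E)%E /\
  forall w, (fdist w (p s') <= fdist w (p s) + L%:E)%E /\ (fdist (p s) w <= fdist (p s') w + L%:E)%E.
Proof.
move=> tT k0 kf; have [dt Et] := lift_chart tT.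
have [_ [_ [_ [U nU hU]]]] := local_inversion f_lipschitz (conj apsi dt) k0 kf.
have nU' : nbhs t (p @^-1` U) := p_cont nU.
have /nbhs_ballP[d /= d0 hd] := nU'.
exists d; first exact: d0.
move=> s s' sT s'T sd s'd; pose L := C * `|b - a| / k * `|s' - s|; rewrite -/L.
have Us : U (p s) by apply: hd; rewrite /ball /= distrC.
have Us' : U (p s') by apply: hd; rewrite /ball /= distrC.
have [_ _ [h1 h2]] := hU _ _ Us Us'.
have [_ Es] := lift_chart sT; have [_ Es'] := lift_chart s'T.
have KL : k^-1 * chart_norm psi (psi (f (p t))) (psi (f (p s')) - psi (f (p s))) <= L.
  have [_ hC] := nuC (chart_line_in t).
  have t1 : unit_clamp t = t.
    by have /andP[? ?] := tT; have /andP[_ ?] := T01; apply: unit_clamp_id; rewrite in_itv /=; apply/andP; split; lra.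
  rewrite t1 -Et in hC.
  rewrite /L Es Es' (_ : _ - _ = (s' - s) *: (b - a)); last by vring.
  rewrite [_ / k]mulrC -mulrA ler_pM2l ?invr_gt0 //; apply: (le_trans (hC _)).
  by rewrite normrZ -mulrA [`|b - a| * _]mulrC.
split; first by apply: (le_trans h1); rewrite lee_fin.
move=> w; have [w1 w2] := h2 w; split.
  by apply: (le_trans w1); rewrite leeD2l // lee_fin.
by apply: (le_trans w2); rewrite leeD2l // lee_fin.
Qed.

Local Notation D := (C * `|b - a|).

(** Where the distance to [x0] is [r], it grows at a rate at most [2 * D / mu r], and [G] at a rate
    at most [mu r]: the product does not depend on [r]. *)
Lemma lift_growth t : 0 <= t <= T -> G (rad (p t)) <= G (rad (p 0)) + 2 * D * t.
Proof.
move=> /andP[t0 tT]; have D0 : 0 <= D by rewrite mulr_ge0.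
rewrite -[X in _ * X]subr0; apply: (one_sided_lipschitz (phi := fun s => G (rad (p s)))) => // s /andP[s0 st].
have sT : 0 <= s <= T by rewrite s0 (le_trans st).
have [k0 kf] := half_mu_conorm (lexx (rad (p s))).
have [d d0 hd] := lift_local sT k0 kf.
pose m := mu (rad (p s)).
have m0 : 0 < m by have := mu01 (rad_ge0 (p s)); rewrite -/m => /andP[].
(* The bound in the reverse direction depends on the point through [m], which [one_sided_lipschitz]
   allows; it uses that [mu] is at most 1. *)
exists d, (D / (m / 2)); split => // u /andP[u0 ut] ud.
have uT : 0 <= u <= T by rewrite u0 (le_trans ut).
have ss : `|s - s| < d by rewrite subrr normr0.
have [_ /(_ x0)[h1 _]] := hd s u sT uT ss ud.
have [_ /(_ x0)[h2 _]] := hd u s uT sT ud ss.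
have {}h1 : rad (p u) <= rad (p s) + D / (m / 2) * `|u - s|.
  by rewrite -lee_fin EFinD /rad -!fdistE.
have {}h2 : rad (p s) <= rad (p u) + D / (m / 2) * `|u - s|.
  by rewrite [`|u - s|]distrC -lee_fin EFinD /rad -!fdistE.
have Dm0 : 0 <= D / (m / 2) * `|u - s| by rewrite !mulr_ge0 // invr_ge0 divr_ge0 // ltW.
split.
  have [us|su] := leP (rad (p u)) (rad (p s)).
    have /andP[g1 _] := Gmu' (rad_ge0 _) us.
    by apply: (le_trans g1); rewrite lerDl !mulr_ge0.
  have /andP[_ g2] := Gmu' (rad_ge0 _) (ltW su).
  apply: (le_trans g2); rewrite lerD2l -/m.
  have -> : 2 * D * `|u - s| = m * (D / (m / 2) * `|u - s|) by field; rewrite gt_eqF.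
  by rewrite ler_pM2l // lerBlDl.
have [us|su] := leP (rad (p u)) (rad (p s)).
  have /andP[_ g2] := Gmu' (rad_ge0 _) us.
  apply: (le_trans g2); rewrite lerD2l.
  have /andP[mu0 mu1] := mu01 (rad_ge0 (p u)).
  apply: (@le_trans _ _ (rad (p s) - rad (p u))); first by rewrite ler_piMl // subr_ge0.
  by rewrite lerBlDl.
have /andP[g1 _] := Gmu' (rad_ge0 _) (ltW su).
by apply: (le_trans g1); rewrite lerDl.
Qed.

(** By [lift_growth] the lift stays within distance [rho] of [x0], where [mu rho / 2] is a uniform
    strict lower bound of the co-norm. *)
Lemma lift_lipschitz rho : 0 <= rho -> G (rad (p 0)) + 2 * D < G rho ->
  forall s t, 0 <= s <= t -> t <= T ->
  (fdist (p s) (p t) <= (2 * D / mu rho * (t - s))%:E)%E /\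
  (fdist (p t) (p s) <= (2 * D / mu rho * (t - s))%:E)%E.
Proof.
move=> rho0 Grho s t /andP[s0 st] tT; have D0 : 0 <= D by rewrite mulr_ge0.
have /andP[_ T1] := T01.
have bnd u : 0 <= u <= T -> rad (p u) <= rho.
  move=> uT; have := lift_growth uT; have /andP[u0 uT'] := uT => h.
  rewrite leNgt; apply/negP => ru.
  have /andP[g1 _] := Gmu' rho0 (ltW ru).
  have h2 : 2 * D * u <= 2 * D by rewrite ler_piMr ?mulr_ge0 // (le_trans uT').
  move: h h2 g1 Grho; lra.
have /andP[m0 _] := mu01 rho0.
have KE : 2 * D / mu rho = D / (mu rho / 2) by field; rewrite gt_eqF.
have loc u : s <= u <= t -> exists2 d, 0 < d & forall v, s <= v <= t -> `|v - u| < d ->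
    forall w, [/\ fine (fdist w (p v)) <= fine (fdist w (p u)) + 2 * D / mu rho * `|v - u|,
      fine (fdist w (p u)) <= fine (fdist w (p v)) + 2 * D / mu rho * `|v - u|,
      fine (fdist (p v) w) <= fine (fdist (p u) w) + 2 * D / mu rho * `|v - u| &
      fine (fdist (p u) w) <= fine (fdist (p v) w) + 2 * D / mu rho * `|v - u|].
  move=> /andP[su ut]; have uT : 0 <= u <= T by rewrite (le_trans s0 su) (le_trans ut tT).
  have [k0 kf] := half_mu_conorm (bnd u uT).
  have [d d0 hd] := lift_local uT k0 kf; exists d => // v /andP[sv vt] vd w.
  have vT : 0 <= v <= T by rewrite (le_trans s0 sv) (le_trans vt tT).
  have uu : `|u - u| < d by rewrite subrr normr0.
  have [_ /(_ w)[h1 h2]] := hd u v uT vT uu vd.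
  have [_ /(_ w)[h3 h4]] := hd v u vT uT vd uu.
  by rewrite KE; split; rewrite -lee_fin EFinD -!fdistE // [`|v - u|]distrC.
have zero (x : M) : fine (fdist x x) <= 0 by rewrite -lee_fin -fdistE fdistxx.
split; rewrite fdistE lee_fin.
  apply: (@le_trans _ _ (fine (fdist (p s) (p s)) + 2 * D / mu rho * (t - s))); last by rewrite gerDr.
  apply: (one_sided_lipschitz (phi := fun u => fine (fdist (p s) (p u)))) => // u ust.
  have [d d0 hd] := loc u ust; exists d, (2 * D / mu rho); split => // v vst vd.
  by have [? ? _ _] := hd v vst vd (p s).
apply: (@le_trans _ _ (fine (fdist (p s) (p s)) + 2 * D / mu rho * (t - s))); last by rewrite gerDr.
apply: (one_sided_lipschitz (phi := fun u => fine (fdist (p u) (p s)))) => // u ust.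
have [d d0 hd] := loc u ust; exists d, (2 * D / mu rho); split => // v vst vd.
by have [_ _ ? ?] := hd v vst vd (p s).
Qed.

End Lift.
Section Existence.
Hypothesis M_complete : finsler_complete M.

(** Links completeness, stated with the distance, to limits in the topology of the manifold. *)
Lemma fdist_nbhs (x : M) (U : set M) : nbhs x U ->
  exists2 d : R, 0 < d & forall y, (fdist y x < d%:E)%E -> U y.
Proof.
move=> nU; have [c ac cx] := atlas_cover x.
have n1 : nbhs (c x) (cinv c @^-1` U).
  by apply: (cinv_continuous_at (c := c)); [exists x|rewrite cinvK].
have /nbhs_ballP[r /= r0 hr] := n1.
have [d d0 hd] := fdist_small (conj ac cx) r0; exists d => // y /hd[cy yr].
by rewrite -(cinvK cy); apply: hr; apply/mx_ballP.
Qed.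

(** Let [S] be the supremum of the times up to which a lift exists. Lifts up to times tending to [S]
    agree by uniqueness, and their ends form a Cauchy sequence. Its limit lies above [chart_line S],
    and a local section there prolongs one of the lifts. *)
Lemma chart_line_lift x : f x = chart_line 0 ->
  exists p : R -> M, [/\ continuous p, p 0 = x & forall t, 0 <= t <= 1 -> f (p t) = chart_line t].
Proof.
move=> fx; pose A (T : R) (p : R -> M) :=
  [/\ continuous p, p 0 = x & forall t, 0 <= t <= T -> f (p t) = chart_line t].
pose E := [set T | 0 <= T <= 1 /\ exists p, A T p].
have E0 : E 0.
  split; first by rewrite lexx ler01.
  exists (cst x); split => // [|t /andP[t0 t1]]; first exact: cst_continuous.
  by rewrite (_ : t = 0) //; apply/eqP; rewrite eq_le t0 t1.
have E1 : ubound E 1 by move=> T [/andP[]].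
have supE : has_sup E by split; [exists 0|exists 1].
pose S := sup E.
have seqE i : exists u : R * (R -> M), [/\ 0 <= u.1 <= 1, A u.1 u.2, S - i.+1%:R^-1 < u.1 & u.1 <= S].
  have i0 : 0 < i.+1%:R^-1 :> R by rewrite invr_gt0.
  have [T ET ST] := sup_adherent i0 supE; have [T1 [p Ap]] := ET.
  by exists (T, p); split => //; exact: sup_upper_bound.
have [u hu] := choice seqE.
pose T i := (u i).1; pose p i := (u i).2; pose e i := p i (T i).
have pT i : f (e i) = chart_line (T i).
  by have [/andP[T0 T1] [_ _ h] _ _] := hu i; apply: h; rewrite T0 lexx.
have uniq i j t : 0 <= t <= T i -> T i <= T j -> p i t = p j t.
  move=> tT Tij; have [/andP[Ti0 _] [ci i0 hi] _ _] := hu i; have [_ [cj j0 hj] _ _] := hu j.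
  pose cl (s : R) := Num.max 0 (Num.min (T i) s).
  have ccl : continuous cl.
    by apply: (@lipschitz_cont _ R R _ 1) => // v w; rewrite mul1r; exact: clamp_dist.
  have clin s : 0 <= cl s <= T i.
    rewrite /cl; case: (clampP s Ti0) => //; by rewrite lexx ?Ti0.
  have clid s : 0 <= s <= T i -> cl s = s.
    rewrite /cl => /andP[s0 sT]; case: (clampP s Ti0) => // h; apply/eqP; rewrite eq_le ?s0 ?sT ?h //.
  have := @lift_unique R M N f (@carrier_hausdorff R n M) f_locally_injective (p i \o cl) (p j \o cl) 0
    (cont_comp ccl ci) (cont_comp ccl cj).
  have h s : f ((p i \o cl) s) = f ((p j \o cl) s).
    rewrite /= hi ?clin // hj //; have /andP[c1 c2] := clin s.
    by rewrite c1 (le_trans c2).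
  have i0' : p i 0 = x := i0.
  have j0' : p j 0 = x := j0.
  move=> /(_ h); rewrite /= clid ?lexx // i0' j0' => /(_ erefl t).
  by rewrite clid.
(* One radius, hence one Lipschitz constant [K], serves all the lifts, since they start at the same
   point. *)
have [rho rho0 Grho] := G_unbounded (G (rad x) + 2 * (C * `|b - a|)).
have /andP[m0 _] := mu01 rho0.
pose K := 2 * (C * `|b - a|) / mu rho.
have K0 : 0 <= K by rewrite divr_ge0 ?mulr_ge0 // ltW.
have close i j : T i <= T j -> (fdist (e i) (e j) <= (K * (T j - T i))%:E)%E /\
    (fdist (e j) (e i) <= (K * (T j - T i))%:E)%E.
  move=> Tij; have [/andP[Ti0 _] _ _ _] := hu i; have [Tj1 [cj j0 hj] _ _] := hu j.
  have -> : e i = p j (T i) by apply: uniq => //; rewrite Ti0 lexx.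
  have Gp : G (rad (p j 0)) + 2 * (C * `|b - a|) < G rho.
    by have -> : p j 0 = x := j0.
  by apply: (lift_lipschitz cj Tj1 hj rho0 Gp); rewrite ?Ti0 ?lexx.
have cauchy e1 : 0 < e1 -> exists k, forall i j, (k <= i)%N -> (k <= j)%N ->
    (fdist (e i) (e j) < e1%:E)%E.
  move=> e10; have Kp : 0 < K + 1 by rewrite ltr_wpDl.
  have [k hk] := exists_natSinv_lt (divr_gt0 e10 Kp); exists k => i j ki kj.
  have Tk l : (k <= l)%N -> S - k.+1%:R^-1 < T l /\ T l <= S.
    move=> kl; have [_ _ h1 h2] := hu l; split => //.
    apply: le_lt_trans h1; rewrite lerD2l lerN2 lef_pV2 ?posrE ?ltr0n // ler_nat //.
  have [i1 i2] := Tk i ki; have [j1 j2] := Tk j kj.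
  move: hk i1 j1; move: (k.+1%:R^-1) => z; rewrite ltr_pdivlMr // => hk i1 j1.
  have small d : 0 <= d -> d < z -> ((K * d)%:E < e1%:E)%E.
    move=> d0 dz; rewrite lte_fin; apply: le_lt_trans hk.
    rewrite mulrC; apply: ler_pM => //; [exact: ltW|by rewrite lerDl].
  have [ij|/ltW ji] := leP (T i) (T j).
    have [h _] := close i j ij; apply: (le_lt_trans h); apply: small; move: i1 j2 ij; lra.
  have [_ h] := close j i ji; apply: (le_lt_trans h); apply: small; move: j1 i2 ji; lra.
have [y hy] := M_complete cauchy.
have ev (W : set M) : nbhs y W -> exists k, forall i, (k <= i)%N -> W (e i).
  move=> /fdist_nbhs[d d0 hd]; have [k hk] := hy d d0; exists k => i /hk; exact: hd.
have Tev d : 0 < d -> exists k, forall i, (k <= i)%N -> `|T i - S| < d.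
  move=> d0; have [k hk] := exists_natSinv_lt d0; exists k => i ki.
  have [_ _ h1 h2] := hu i; rewrite distrC ger0_norm ?subr_ge0 // ltrBlDl -ltrBlDr.
  apply: le_lt_trans h1; rewrite lerD2l lerN2; apply: le_trans (ltW hk).
  by rewrite lef_pV2 ?posrE ?ltr0n // ler_nat.
have fy : f y = chart_line S.
  apply: (@carrier_hausdorff R n N) => V1 V2 nV1 nV2.
  have [k1 hk1] := ev (f @^-1` V1) (f_continuous nV1).
  have n2 : nbhs S (chart_line @^-1` V2) := chart_line_continuous nV2.
  have /nbhs_ballP[d /= d0 hd] := n2.
  have [k2 hk2] := Tev d d0.
  exists (chart_line (T (maxn k1 k2))); split.
    by rewrite -pT; apply: hk1; exact: leq_maxl.
  by apply: hd; rewrite /ball /= distrC; apply: hk2; exact: leq_maxr.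
have [U [V [sigma [oU [oV Vfy] sig1 sig2]]]] :=
  local_section f_image_open f_locally_injective y.
have nV : nbhs S (chart_line @^-1` V).
  by apply: chart_line_continuous; rewrite -fy; apply: open_nbhs_nbhs.
have /nbhs_ballP[d /= d0 hd] := nV.
have [k1 hk1] := ev U (open_nbhs_nbhs oU); have [k2 hk2] := Tev d d0.
pose i := maxn k1 k2.
have Ui : U (e i) by apply: hk1; exact: leq_maxl.
have Ti : `|T i - S| < d by apply: hk2; exact: leq_maxr.
have [/andP[Ti0 Ti1] [ci i0 hi] _ TiS] := hu i; rewrite -/(T i) -/(p i) in Ti0 Ti1 ci i0 hi TiS.
(* A lift up to [S'] is built, so [S'] is at most the supremum [S]; this forces [S'] to be 1. *)
pose S' := Num.min 1 (S + d / 2).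
have TS' : T i <= S' by rewrite le_min Ti1 (le_trans TiS) // lerDl divr_ge0 // ltW.
pose cl (s : R) := Num.max (T i) (Num.min S' s).
have ccl : continuous cl.
  by apply: (@lipschitz_cont _ R R _ 1) => // v w; rewrite mul1r; exact: clamp_dist.
have Vcl s : V (chart_line (cl s)).
  apply: hd; rewrite /ball /= distrC.
  have [c1 c2] : T i <= cl s /\ cl s <= S' by rewrite /cl; case: (clampP s TS') => [_|/andP[]|_].
  have S'S : S' <= S + d / 2 by rewrite ge_min lexx orbT.
  move: Ti; rewrite !ltr_norml => /andP[h1 h2]; apply/andP; split; move: c1 c2 S'S h1 h2 d0; lra.
have csig : continuous (fun s => sigma (chart_line (cl s))).
  move=> s; have clc : continuous chart_line by exact: chart_line_continuous.
  have ccs : {for s, continuous (chart_line \o cl)} by exact: (cont_comp ccl clc).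
  have cs : {for (chart_line \o cl) s, continuous sigma} by case: (sig2 _ (Vcl s)).
  exact: (continuous_comp ccs cs).
pose q s := if s <= T i then p i s else sigma (chart_line (cl s)).
have cq : continuous q.
  apply: (glue_continuous (h := fun s : R => s) (@cont_id _) ci csig) => s ->.
  rewrite (_ : cl (T i) = T i); first by rewrite -pT sig1.
  by rewrite /cl; case: (clampP (T i) TS') => // h; apply/eqP; rewrite eq_le h TS'.
have ES' : E S'.
  split; first by rewrite (le_trans Ti0 TS') ge_min lexx.
  exists q; split => //; first by rewrite /q Ti0.
  move=> t /andP[t0 tS]; rewrite /q; case: ifPn => [tT|]; first by apply: hi; rewrite t0.
  rewrite -ltNge => tT; have [_ -> _] := sig2 _ (Vcl t); congr chart_line.
  by rewrite /cl; case: (clampP t TS') => // h; apply/eqP; rewrite eq_le ?tS ?h ?(ltW tT).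
have S'S : S' <= S by exact: sup_upper_bound.
have S1 : S' = 1.
  move: S'S; rewrite /S'; have [//|h] := leP 1 (S + d / 2).
  by rewrite gerDl leNgt divr_gt0.
by move: ES'; rewrite S1 => -[_ [p1 A1]]; exists p1.
Qed.

End Existence.
End Line.

(** * Local sections over chart balls *)

Hypothesis M_complete : finsler_complete M.

(** The section through [x] sends [z] to the end of the lift, starting at [x], of the segment from
    [f x] to [z] in a chart ball about [y]. By convexity the same [V] serves for all [x] above
    it. *)
Lemma chart_section y : exists2 V, open_nbhs y V & forall x, V (f x) ->
  exists2 s : N -> M, s (f x) = x & forall z, V z -> f (s z) = z /\ {for z, continuous s}.
Proof.
have [psi apsi dy] := atlas_cover y.
have iy : (psi @` dom psi) (psi y) by exists y.
have [k [C [eta [k0 C0 eta0 heta]]]] := chart_norm_equiv apsi iy.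
have nuC q : `|q - psi y| < eta -> (psi @` dom psi) q /\ forall w, chart_norm psi q w <= C * `|w|.
  by move=> /heta[h1 h2]; split => // w; case/andP: (h2 w).
have nB := chart_nbhs dy eta0; rewrite nbhsE in nB; have [V oV VB] := nB.
exists V => // x Vfx; have [dfx fxe] := VB _ Vfx.
have lifts z : exists p : R -> M, V z -> [/\ continuous p, p 0 = x &
    forall t, 0 <= t <= 1 -> f (p t) = chart_line psi (psi (f x)) (psi z) t].
  have [Vz|nVz] := pselect (V z); last by exists (cst x).
  have [dz ze] := VB _ Vz.
  have fx0 : f x = chart_line psi (psi (f x)) (psi z) 0.
    by rewrite /chart_line (unit_clamp_id (unit0 R)) scale0r addr0 cinvK.
  by have [p hp] := chart_line_lift apsi nuC C0 fxe ze M_complete fx0; exists p.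
have [P hP] := choice lifts.
(* Outside [V] the constant path at [x] is a default value, so that every path of the family is
   continuous and starts at [x]. *)
pose G' (z : N) (t : R) := if `[< V z >] then P z (unit_clamp t) else x.
have GV z t : V z -> G' z t = P z (unit_clamp t).
  by move=> Vz; rewrite /G'; case: asboolP.
have fG z t : V z -> f (G' z t) = chart_line psi (psi (f x)) (psi z) t.
  move=> Vz; rewrite GV //; have [_ _ ->] := hP z Vz; last by have := unit_clamp_in t; rewrite in_itv.
  by rewrite /chart_line (unit_clamp_id (unit_clamp_in t)).
have cG z : continuous (G' z).
  rewrite /G'; case: asboolP => Vz; last exact: cst_continuous.
  by have [cp _ _] := hP z Vz; apply: (cont_comp (@unit_clamp_continuous R) cp).
have G0 z : G' z 0 = x.
  rewrite /G'; case: asboolP => // Vz; rewrite (unit_clamp_id (unit0 R)).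
  by have [] := hP z Vz.
have nV z : V z -> nbhs z V by move=> Vz; apply: open_nbhs_nbhs; split => //; case: oV.
have joint z t : V z -> {for (z, t), continuous (fun u : N * R => f (G' u.1 u.2))}.
  move=> Vz; have [dz ze] := VB _ Vz.
  pose H (u : N * R) := psi (f x) + unit_clamp u.2 *: (psi u.1 - psi (f x)).
  have cH : {for (z, t), continuous H}.
    have c1 : {for (z, t), continuous (fun u : N * R => psi u.1)}.
      by apply: (@continuous_comp _ _ _ (fst : N * R -> N) psi); [exact: cont_fst|exact: chart_continuous].
    have c2 : {for (z, t), continuous (fun u : N * R => unit_clamp u.2)}.
      by apply: (@continuous_comp _ _ _ (snd : N * R -> R) (@unit_clamp R)); [exact: cont_snd|exact: unit_clamp_continuous].
    pose sh (w v : 'rV[R]_n) := v + w.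
    have csh w : continuous (sh w).
      apply: (@lipschitz_cont _ _ _ _ 1) => // v v'.
      by rewrite mul1r (_ : _ - _ = v - v') // /sh; vring.
    have c3 : {for (z, t), continuous (fun u : N * R => sh (- psi (f x)) (psi u.1))}.
      by apply: (@continuous_comp _ _ _ (fun u : N * R => psi u.1) (sh (- psi (f x)))); [|exact: csh].
    have c4 : {for (z, t), continuous (fun u : N * R => unit_clamp u.2 *: sh (- psi (f x)) (psi u.1))}.
      apply: (@continuous_comp _ _ _ (fun u : N * R => (unit_clamp u.2, sh (- psi (f x)) (psi u.1))) (fun z : R * 'rV[R]_n => z.1 *: z.2)).
        exact: continuous_pair_at.
      exact: scale_continuous.
    have -> : H = (fun u => sh (psi (f x)) (unit_clamp u.2 *: sh (- psi (f x)) (psi u.1))).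
      by apply/funext => u; rewrite /H /sh addrC.
    by apply: (@continuous_comp _ _ _ (fun u : N * R => unit_clamp u.2 *: sh (- psi (f x)) (psi u.1)) (sh (psi (f x)))); [|exact: csh].
  have cc : {for (z, t), continuous (cinv psi \o H)}.
    apply: continuous_comp => //; apply: cinv_continuous_at.
    by have [] := nuC _ (chart_line_in fxe ze t).
  have E : \forall u \near (z, t), (cinv psi \o H) u = f (G' u.1 u.2).
    exists (V, setT); first by split; [exact: nV|exact: filterT].
    by move=> [z' t'] /= [Vz' _]; rewrite fG.
  have Ez := nbhs_singleton E.
  change (f (G' u.1 u.2) @[u --> (z, t)] --> f (G' z t)); rewrite -[f (G' z t)]Ez.
  by apply: cvg_trans cc; apply: near_eq_cvg.
exists (fun z => G' z 1).
  apply: (@lift_unique R M N f (@carrier_hausdorff R n M) f_locally_injective (G' (f x)) (cst x) 0) => //.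
    exact: cst_continuous.
  by move=> t; rewrite fG // /chart_line subrr scaler0 addr0 cinvK.
move=> z Vz; split.
  rewrite fG // /chart_line (unit_clamp_id (unit1 R)) scale1r addrC subrK cinvK //.
  by case: (VB _ Vz).
have cG0 : {for z, continuous (fun z => G' z 0)}.
  rewrite (_ : (fun z => G' z 0) = cst x); last by apply/funext => z'; rewrite G0.
  exact: cst_continuous.
have jc := @lift_family_continuous R M N f (@carrier_hausdorff R n M) f_continuous f_image_open f_locally_injective
  N G' z 0 (fun t => joint z t Vz) cG cG0 1.
exact: (@continuous_comp _ _ _ (fun z => (z, 1 : R)) (fun u : N * R => G' u.1 u.2) z (continuous_pair_at (@cont_id N z) (@cont_cst N R 1 z)) jc).
Qed.

End LiftEstimates.

Theorem corollary4p4 (R : realType) (n : nat) (M N : finsler_manifold R n)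
    (M_connected : connected [set: M]) (N_connected : connected [set: N])
    (M_complete : finsler_complete M)
    (f : M -> N) (f_lipschitz : locally_lipschitz f)
    (f_rank : forall x : M, maximal_rank f x)
    (x0 : M)
    (m_integral : (\int[lebesgue_measure]_(t in `[0%R, +oo[)
                     conorm_on_ball f x0 t = +oo)%E)
    (hpi1 : simply_connected R N \/
            [/\ pi1_isomorphic R x0 (f x0),
                finite_set (pi1 R x0) & finite_set (pi1 R (f x0))]) :
  homeomorphism f.
Proof.
have [G [mu [mu01 mu_conorm Gmu Gu]]] := conorm_growth f_lipschitz m_integral.
have M_hausdorff := @carrier_hausdorff R n M.
have f_cont : continuous f by exact: (f_continuous M_connected f_lipschitz mu01 mu_conorm).
have f_open : forall O, open O -> open (f @` O).
  by move=> O; exact: (f_image_open M_connected f_lipschitz mu01 mu_conorm).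
have f_inj := f_locally_injective M_connected f_lipschitz mu01 mu_conorm.
have f_section := chart_section M_connected f_lipschitz mu01 mu_conorm Gmu Gu M_complete.
have M_path := finsler_path_connected M_connected.
exact: (covering_homeomorphism M_hausdorff f_cont f_open f_inj f_section M_path N_connected hpi1).
Qed.
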